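(* For any symmetric convex body $K\subset\mathbb{R}^n$ and any semi-norm $\|\cdot\|$ on $\mathbb{R}^n$, $$\int_{\partial K} \frac{\|n_x\|^2}{\langle x,n_x\rangle}\,dH_{n-1}(x)\leq \left(\inf_{T}\frac{2C_{poin}(TK)}{r(TK)}\right)\cdot \frac{\left(\int_{\partial K} \|n_x\|\,dH_{n-1}(x) \right)^2}{|K|},$$ where the infimum runs over all volume preserving linear operators $T:\mathbb{R}^n\to\mathbb{R}^n$.
   Context: A convex body is a compact convex set with non-empty interior; symmetric means $K=-K$. $|\cdot|$ is Lebesgue measure and $H_{n-1}$ is the $(n-1)$-dimensional Hausdorff measure. $n_x$ is the outer unit normal of $K$ at $x\in\partial K$ (uniquely defined for almost every boundary point). $r(K)$ is the in-radius of $K$, i.e. the radius of the largest Euclidean ball contained in $K$. $C_{poin}(K)$ is the Poincaré constant of $K$: the smallest number such that $$\int_K g^2-\frac{1}{|K|}\left(\int_K g\right)^2\leq C_{poin}^2(K)\int_K |\nabla g|^2$$ for all $C^1$-smooth functions $g$ on $K$ for which these integrals exist. *)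

(* Defs.v *)
From HB Require Import structures.
From mathcomp Require Import all_boot all_order all_algebra.
From mathcomp Require Import all_classical all_reals all_analysis.

Set Implicit Arguments.
Unset Strict Implicit.
Unset Printing Implicit Defensive.

Import Order.TTheory GRing.Theory Num.Theory.
Import numFieldNormedType.Exports.

Local Open Scope classical_set_scope.
Local Open Scope ring_scope.

(** Euclidean structure. The canonical norm [`|x|] on ['rV[R]_n] is the sup norm:
    it induces the usual topology, but it is not the Euclidean norm. *)
Section euclidean.
Context {R : realType} {n : nat}.
Implicit Types x y : 'rV[R]_n.

Definition dot x y : R := \sum_(i < n) x 0 i * y 0 i.

Definition enorm x : R := Num.sqrt (dot x x).

Definition eball (c : 'rV[R]_n) (r : R) : set 'rV[R]_n :=
  [set x | enorm (x - c) <= r].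

Definition diam (U : set 'rV[R]_n) : \bar R :=
  ereal_sup [set (enorm (p.1 - p.2))%:E | p in U `*` U].

End euclidean.

(** Outer measure generated by countable covers weighted by a gauge [tau]. *)
Definition cover_measure (R : realType) (T : Type) (tau : set T -> \bar R)
    (X : set T) : \bar R :=
  ereal_inf [set (\sum_(k <oo) tau (U k))%E
            | U in [set U : (set T)^nat | X `<=` \bigcup_k U k]].

(* [T] with every set measurable, so that [mu_ext] restricts no cover. *)
Definition all_measurable (T : Type) : Type := T.

Section all_measurable.
Context {T : pointedType}.
Let D := all_measurable T.
HB.instance Definition _ := Pointed.copy (all_measurable T) T.
Let D0 : [set: set D] set0. Proof. by []. Qed.
Let DC (A : set D) : [set: set D] A -> [set: set D] (~` A). Proof. by []. Qed.
Let DU (F : (set D)^nat) :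
  (forall i, [set: set D] (F i)) -> [set: set D] (\bigcup_i F i).
Proof. by []. Qed.
HB.instance Definition _ := @isMeasurable.Build default_measure_display
  (all_measurable T) [set: set D] D0 DC DU.
End all_measurable.

Section cover_measure_theory.
Local Open Scope ereal_scope.
Context {R : realType} {T : pointedType} (tau : set T -> \bar R).

Lemma cover_measureE :
  cover_measure tau = @mu_ext _ (all_measurable T) R tau.
Proof.
apply/funext => X; rewrite /cover_measure /mu_ext; congr ereal_inf.
by apply/seteqP; split => _ [U UX <-]; exists U => //; case: UX.
Qed.

Hypotheses (tau0 : tau set0 = 0) (tau_ge0 : forall U, 0 <= tau U).

Lemma cover_measure0 : cover_measure tau set0 = 0.
Proof. by rewrite cover_measureE mu_ext0. Qed.

Lemma cover_measure_ge0 X : 0 <= cover_measure tau X.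
Proof. by rewrite cover_measureE mu_ext_ge0. Qed.

Lemma le_cover_measure : {homo cover_measure tau : A B / A `<=` B >-> A <= B}.
Proof. by move=> A B AB; rewrite cover_measureE (@le_mu_ext _ (all_measurable T)). Qed.

Lemma cover_measure_sigma_subadditive : sigma_subadditive (cover_measure tau).
Proof.
rewrite cover_measureE.
exact: (@mu_ext_sigma_subadditive _ (all_measurable T)).
Qed.

End cover_measure_theory.

(** Lebesgue measure on ['rV[R]_n]: Caratheodory's measure for the outer measure
    given by countable covers by boxes. The gauge of a set is the volume of the
    smallest closed box containing it; the empty set is singled out for [n = 0],
    where every box is a point, of volume 1. *)
Section lebesgue.
Context {R : realType} (n : nat).

Definition box (a b : 'rV[R]_n) : set 'rV[R]_n :=
  [set x | forall i, a 0 i <= x 0 i <= b 0 i].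

Definition box_gauge (U : set 'rV[R]_n) : \bar R :=
  if U == set0 then 0%E else
  ereal_inf [set (\prod_(i < n) (p.2 0 i - p.1 0 i))%:E
            | p in [set p : 'rV[R]_n * 'rV[R]_n |
                    (forall i, p.1 0 i <= p.2 0 i) /\ U `<=` box p.1 p.2]].

Definition lebesgue_outer : set 'rV[R]_n -> \bar R := cover_measure box_gauge.

Let box_gauge0 : box_gauge set0 = 0%E.
Proof. by rewrite /box_gauge eqxx. Qed.

Let box_gauge_ge0 U : (0 <= box_gauge U)%E.
Proof.
rewrite /box_gauge; case: ifP => // _; apply: le_ereal_inf_tmp => _ [p [p12 _] <-].
by rewrite lee_fin; apply: prodr_ge0 => i _; rewrite subr_ge0.
Qed.

HB.instance Definition _ := isOuterMeasure.Build R _ lebesgue_outer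
  (cover_measure0 box_gauge0 box_gauge_ge0) (cover_measure_ge0 box_gauge_ge0)
  (@le_cover_measure _ _ box_gauge)
  (cover_measure_sigma_subadditive box_gauge_ge0).

Definition lebesgue_outer_measure : {outer_measure set 'rV[R]_n -> \bar R} :=
  lebesgue_outer.

Definition lebesgue :
    {measure set (caratheodory_type lebesgue_outer_measure) -> \bar R} :=
  lebesgue_outer_measure : set (caratheodory_type lebesgue_outer_measure) -> \bar R.

End lebesgue.

(** [m]-dimensional Hausdorff measure on ['rV[R]_n], normalized by the volume of
    the unit ball of dimension [m], so that it agrees with the [m]-dimensional
    surface area (and is the counting measure for [m = 0]). *)
Section hausdorff.
Context {R : realType} (n m : nat).
Local Open Scope ereal_scope.

Definition hausdorff_gauge (delta : R) (U : set 'rV[R]_n) : \bar R :=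
  if U == set0 then 0 else
  if diam U <= delta%:E then
    lebesgue m (eball (0 : 'rV[R]_m) 1) * (2^-1%:E * diam U) ^+ m
  else +oo.

Definition hausdorff_outer (X : set 'rV[R]_n) : \bar R :=
  ereal_sup [set cover_measure (hausdorff_gauge delta) X
            | delta in [set delta : R | (0 < delta)%R]].

Let gauge0 delta : hausdorff_gauge delta set0 = 0.
Proof. by rewrite /hausdorff_gauge eqxx. Qed.

Let gauge_ge0 delta U : 0 <= hausdorff_gauge delta U.
Proof.
rewrite /hausdorff_gauge; case: ifPn => // /set0P[x Ux]; case: ifP => // _.
apply: mule_ge0; first exact: measure_ge0.
apply: expe_ge0; apply: mule_ge0; first by rewrite lee_fin invr_ge0.
apply: ereal_sup_ubound; exists (x, x) => //=; congr (_%:E).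
rewrite /enorm /dot subrr big1 ?sqrtr0// => i _; by rewrite mxE mul0r.
Qed.

Let hausdorff_outer_ge0 X : 0 <= hausdorff_outer X.
Proof.
apply: (@le_trans _ _ (cover_measure (hausdorff_gauge 1) X)).
  exact: cover_measure_ge0.
by apply: ereal_sup_ubound; exists 1%R => //=.
Qed.

Let hausdorff_outer0 : hausdorff_outer set0 = 0.
Proof.
apply/eqP; rewrite eq_le hausdorff_outer_ge0 andbT.
by apply: ge_ereal_sup => _ [d _ <-]; rewrite cover_measure0.
Qed.

Let le_hausdorff_outer : {homo hausdorff_outer : A B / A `<=` B >-> A <= B}.
Proof.
move=> A B AB; apply: ge_ereal_sup => _ [d d0 <-].
apply: (le_trans (@le_cover_measure _ _ (hausdorff_gauge d) _ _ AB)).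
by apply: ereal_sup_ubound; exists d.
Qed.

Let hausdorff_outer_sigma_subadditive : sigma_subadditive hausdorff_outer.
Proof.
move=> F; apply: ge_ereal_sup => _ [d d0 <-].
apply: (le_trans (cover_measure_sigma_subadditive (gauge_ge0 d) F)).
apply: lee_nneseries => [k _ _|k _]; first exact: cover_measure_ge0.
by apply: ereal_sup_ubound; exists d.
Qed.

HB.instance Definition _ := isOuterMeasure.Build R _ hausdorff_outer
  hausdorff_outer0 hausdorff_outer_ge0 le_hausdorff_outer
  hausdorff_outer_sigma_subadditive.

Definition hausdorff_outer_measure : {outer_measure set 'rV[R]_n -> \bar R} :=
  hausdorff_outer.

Definition hausdorff :
    {measure set (caratheodory_type hausdorff_outer_measure) -> \bar R} :=
  hausdorff_outer_measure : set (caratheodory_type hausdorff_outer_measure) -> \bar R.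

End hausdorff.

Section convex_bodies.
Context {R : realType} {n : nat}.
Implicit Types (K : set 'rV[R]_n) (x v : 'rV[R]_n).

Definition convex_body K := [/\ compact K, convex_set K & K° !=set0].

Definition symmetric_set K := [set - x | x in K] = K.

Definition boundary K := closure K `\` K°.

Definition unit_outer_normal K x v :=
  enorm v = 1 /\ forall y, K y -> dot (y - x) v <= 0.

(* An arbitrary unit outer normal at the boundary points, forming an
   H_(n-1)-null set for a convex body, where there are several of them. *)
Definition normal K x : 'rV[R]_n := xget 0 [set v | unit_outer_normal K x v].

Definition inradius K : \bar R :=
  ereal_sup [set r%:E | r in [set r | 0 <= r /\ exists c, eball c r `<=` K]].

Definition grad (g : 'rV[R]_n -> R) x : 'rV[R]_n :=
  \row_(i < n) 'D_(delta_mx 0 i) g x.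

(* C^1 in the interior of [K], with no condition at the boundary: the
   integrability conditions below then have content. *)
Definition C1_on K (g : 'rV[R]_n -> R) :=
  forall x, K° x -> differentiable g x /\ {for x, continuous (grad g)}.

Definition poincare_inequality K (C : R) := forall g : 'rV[R]_n -> R,
  C1_on K g ->
  (lebesgue n).-integrable K (EFin \o g) ->
  (lebesgue n).-integrable K (fun x => (g x ^+ 2)%:E) ->
  (lebesgue n).-integrable K (fun x => (enorm (grad g x) ^+ 2)%:E) ->
  \int[lebesgue n]_(x in K) (g x ^+ 2)
    - (fine (lebesgue n K))^-1 * (\int[lebesgue n]_(x in K) g x) ^+ 2
  <= C ^+ 2 * \int[lebesgue n]_(x in K) (enorm (grad g x) ^+ 2).

Definition poincare_constant K : \bar R :=
  ereal_inf [set C%:E | C in [set C | 0 <= C /\ poincare_inequality K C]].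

Definition seminorm (N : 'rV[R]_n -> R) :=
  (forall x y, N (x + y) <= N x + N y) /\
  (forall (a : R) x, N (a *: x) = `|a| * N x).

Definition volume_preserving (T : 'rV[R]_n -> 'rV[R]_n) :=
  forall A : set (caratheodory_type (lebesgue_outer_measure n)),
    measurable A -> lebesgue n (T @` A) = lebesgue n A.

End convex_bodies.

(* Main.v *)
(**
  Fix [x] on the boundary of [K], with outer unit normal [u] and [h = <x, u>].
  Hahn-Banach gives [w] with [|<w, .>| <= N] and [<w, u> = N u]; put
  [v = (h / N u) w], so that [<v, u> = h] and [N >= (N u / h) |<v, .>|].

  Let [I] be the integral of [|<v, n>|] over the boundary.  Projecting the
  boundary along [v] shows that a slab [{y in K, |phi y - c| <= s}], where [phi]
  is a linear form with [phi v = 1], has volume at most [s I].  Hence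
  [|K| <= c I] for the constant [c = |K| / (2 Q)], where [2 s Q] bounds the volume
  of all such slabs, and [(N u / h) |K| <= c M] with [M] the integral of [N n].

  On the other hand [c <= 2 C_poin (T K) / r (T K)] for every volume preserving
  [T]: the linear form in the direction [T v] is spread out on [T K], since its
  slabs have small volume, so its variance is large and
  [C_poin (T K) >= |T v| c / 2]; and [r (T K) <= |T v|] because
  [<v, u> = h] is the maximum of [<., u>] on [K].
  So [N u / h <= (2 C_poin / r) M / |K|] pointwise, and it remains to multiply by
  [N u] and to integrate.

  The slab estimate is proved for the Hausdorff measure itself: the boundary is cut
  into pieces on which some normal is almost constant, and an (n-1)-dimensional
  isodiametric inequality bounds the volume of the tube in the direction [v] over
  each set of a Hausdorff cover of such a piece.  The isodiametric inequality
  follows from a discrete Prekopa-Leindler inequality for the grid cubes met by [A]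
  and by [-A].
*)
Require Import Defs.
From HB Require Import structures.
From mathcomp Require Import all_boot all_order all_algebra.
From mathcomp Require Import all_classical all_reals all_analysis.
From mathcomp Require Import measurable_realfun zify ring lra.
Set Implicit Arguments.
Unset Strict Implicit.
Unset Printing Implicit Defensive.
Import Order.TTheory GRing.Theory Num.Theory.
Import numFieldNormedType.Exports.
Local Open Scope classical_set_scope.
Local Open Scope ring_scope.

(** * Euclidean structure and Lebesgue outer measure *)

(** The normal at a boundary point is an arbitrary choice, so nothing is known about the
    measurability of the integrands. Their integrals are treated as lower integrals, through
    monotonicity, positive scaling and staircases over measurable pieces; the pieces are cut by the
    existence of some normal near a given vector, which is a closed condition.

    Projecting a piece of the boundary along [v] distorts distances without bound where [v] is
    nearly tangent. The slab estimate is therefore proved for [(1 - d) K], whose lines of direction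
    [v] leave [K] at a definite angle, and then [d] tends to 0. Each line leaves [K] at two ends,
    one for [v] and one for [- v]; this saves the factor 2 that turns [2 s I] into [s I].

    A bound [2 s Q] for all slabs says that the linear form has density at most [Q]. Among such
    distributions the uniform one has the least variance, with constant 1/12, which would give the
    square root of 3 in place of the 2 of the theorem. The value 1/16 is what the factor 2 asks for,
    and leaves room for a crude sampling of the distribution function. *)

Section euclidean_theory.
Context {R : realType} {n : nat}.
Implicit Types x y z : 'rV[R]_n.

Lemma dotC x y : dot x y = dot y x.
Proof. by apply: eq_bigr => i _; rewrite mulrC. Qed.

Lemma dotDl x y z : dot (x + y) z = dot x z + dot y z.
Proof. by rewrite -big_split; apply: eq_bigr => i _ /=; rewrite mxE mulrDl. Qed.

Lemma dotDr x y z : dot z (x + y) = dot z x + dot z y.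
Proof. by rewrite dotC dotDl !(dotC _ z). Qed.

Lemma dotZl a x y : dot (a *: x) y = a * dot x y.
Proof. by rewrite mulr_sumr; apply: eq_bigr => i _ /=; rewrite mxE mulrA. Qed.

Lemma dotZr a x y : dot x (a *: y) = a * dot x y.
Proof. by rewrite dotC dotZl dotC. Qed.

Lemma dotNl x y : dot (- x) y = - dot x y.
Proof. by rewrite -scaleN1r dotZl mulN1r. Qed.

Lemma dotNr x y : dot x (- y) = - dot x y.
Proof. by rewrite dotC dotNl dotC. Qed.

Lemma dotBl x y z : dot (x - y) z = dot x z - dot y z.
Proof. by rewrite dotDl dotNl. Qed.

Lemma dotBr x y z : dot z (x - y) = dot z x - dot z y.
Proof. by rewrite dotDr dotNr. Qed.

Lemma dot0l x : dot 0 x = 0.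
Proof. by rewrite /dot big1 // => i _; rewrite mxE mul0r. Qed.

Lemma dot0r x : dot x 0 = 0.
Proof. by rewrite dotC dot0l. Qed.

Lemma dotxx_ge0 x : 0 <= dot x x.
Proof. by apply: sumr_ge0 => i _; rewrite -expr2 sqr_ge0. Qed.

Lemma dotxx_eq0 x : (dot x x == 0) = (x == 0).
Proof.
apply/eqP/eqP => [x0|->]; last exact: dot0l.
apply/rowP => i; rewrite mxE; apply/eqP.
have := psumr_eq0P (fun i _ => sqr_ge0 (x 0 i)) x0 => /(_ i isT)/eqP.
by rewrite sqrf_eq0.
Qed.

Lemma enorm_ge0 x : 0 <= enorm x. Proof. exact: sqrtr_ge0. Qed.

Lemma enorm_sqr x : enorm x ^+ 2 = dot x x.
Proof. by rewrite sqr_sqrtr ?dotxx_ge0. Qed.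

Lemma enorm_eq0 x : (enorm x == 0) = (x == 0).
Proof. by rewrite -sqrf_eq0 enorm_sqr dotxx_eq0. Qed.

Lemma enorm_gt0 x : (0 < enorm x) = (x != 0).
Proof. by rewrite lt_def enorm_ge0 andbT enorm_eq0. Qed.

Lemma enorm0 : enorm (0 : 'rV[R]_n) = 0.
Proof. by apply/eqP; rewrite enorm_eq0. Qed.

Lemma enormZ a x : enorm (a *: x) = `|a| * enorm x.
Proof. by rewrite /enorm dotZl dotZr mulrA -expr2 sqrtrM ?sqr_ge0// sqrtr_sqr. Qed.

Lemma enormN x : enorm (- x) = enorm x.
Proof. by rewrite -scaleN1r enormZ normrN1 mul1r. Qed.

Lemma enormB x y : enorm (x - y) = enorm (y - x).
Proof. by rewrite -enormN opprB. Qed.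

Lemma ler_dot x y : `|dot x y| <= enorm x * enorm y.
Proof.
have [->|y0] := eqVneq y 0; first by rewrite dot0r normr0 enorm0 mulr0.
have yy : 0 < dot y y by rewrite lt_def dotxx_eq0 y0 dotxx_ge0.
rewrite -ler_sqr ?nnegrE ?mulr_ge0 ?enorm_ge0// exprMn !enorm_sqr real_normK ?num_real//.
have := dotxx_ge0 (dot y y *: x - dot x y *: y).
rewrite dotBl !dotBr !dotZl !dotZr (dotC y x).
set a := dot x x; set b := dot x y; set c := dot y y in yy *.
have -> : c * (c * a) - c * (b * b) - (b * (c * b) - b * (b * c)) =
  c * (a * c - b ^+ 2) by ring.
by rewrite pmulr_rge0// subr_ge0.
Qed.

Lemma ler_enormD x y : enorm (x + y) <= enorm x + enorm y.
Proof.
rewrite -ler_sqr ?nnegrE ?addr_ge0 ?enorm_ge0// sqrrD !enorm_sqr dotDl !dotDr (dotC y x).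
have := le_trans (ler_norm _) (ler_dot x y); lra.
Qed.

Lemma coord_le_enorm x i : `|x 0 i| <= enorm x.
Proof.
rewrite -ler_sqr ?nnegrE ?enorm_ge0// enorm_sqr real_normK ?num_real//.
rewrite /dot (bigD1 i)//= -expr2 lerDl; apply: sumr_ge0 => j _.
by rewrite -expr2 sqr_ge0.
Qed.

Lemma enorm_le_coord x e : 0 <= e -> (forall i, `|x 0 i| <= e) -> enorm x <= n%:R * e.
Proof.
move=> e0 xe; rewrite -ler_sqr ?nnegrE ?enorm_ge0 ?mulr_ge0// enorm_sqr.
apply: (@le_trans _ _ (\sum_(i < n) e ^+ 2)).
  apply: ler_sum => i _; rewrite -expr2 -[x 0 i ^+ 2]real_normK ?num_real//.
  by rewrite ler_sqr ?nnegrE// xe.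
rewrite sumr_const card_ord -[_ *+ n]mulr_natl exprMn ler_wpM2r ?sqr_ge0//.
by rewrite -natrX ler_nat; case: (n) => // k; rewrite expnS leq_pmulr// expn1.
Qed.

End euclidean_theory.

Section lebesgue_outer_theory.
Context {R : realType}.
Local Notation mu n := (@lebesgue_outer_measure R n).
Local Open Scope ereal_scope.

Definition box_vol n (a b : 'rV[R]_n) : R := \prod_(i < n) (b 0 i - a 0 i).

Definition le_row n (a b : 'rV[R]_n) := forall i, (a 0 i <= b 0 i)%R.

Lemma box_vol_ge0 n (a b : 'rV[R]_n) : le_row a b -> (0 <= box_vol a b)%R.
Proof. by move=> ab; apply: prodr_ge0 => i _; rewrite subr_ge0. Qed.

Lemma lebesgue_outerE n A : mu n A = cover_measure (@box_gauge R n) A.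
Proof. by []. Qed.

Lemma box_gauge_ge0 n U : 0 <= @box_gauge R n U.
Proof.
rewrite /box_gauge; case: ifP => // _; apply: le_ereal_inf_tmp => _ [p [p12 _] <-].
by rewrite lee_fin; apply: prodr_ge0 => i _; rewrite subr_ge0.
Qed.

Lemma cover_measure_le (T : Type) (tau : set T -> \bar R) (X : set T) (U : (set T)^nat) :
  X `<=` \bigcup_k U k -> cover_measure tau X <= \sum_(k <oo) tau (U k).
Proof. by move=> XU; apply: ereal_inf_lbound; exists U. Qed.

Lemma cover_measure_le1 (T : Type) (tau : set T -> \bar R) (X : set T) :
  tau set0 = 0 -> (forall U, 0 <= tau U) -> cover_measure tau X <= tau X.
Proof.
move=> t0 tge; apply: (le_trans (@cover_measure_le _ _ _ (fun k => if k is 0%N then X else set0) _)).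
  by move=> x Xx; exists 0%N.
by rewrite (@nneseries_split _ _ 0%N 1%N)// big_nat1/= eseries0 ?adde0// => -[|k].
Qed.

Lemma lebesgue_box_le n (a b : 'rV[R]_n) :
  le_row a b -> mu n (box a b) <= (box_vol a b)%:E.
Proof.
move=> ab; rewrite lebesgue_outerE; apply: (le_trans (cover_measure_le1 _ _ _)) => [|U|].
- by rewrite /box_gauge eqxx.
- exact: box_gauge_ge0.
- rewrite /box_gauge; case: ifPn => _; first by rewrite lee_fin box_vol_ge0.
  apply: ereal_inf_lbound; exists (a, b); last by [].
  by split.
Qed.

Lemma box_finite n (a b : 'rV[R]_n) : le_row a b -> mu n (box a b) < +oo.
Proof. by move=> /lebesgue_box_le/le_lt_trans; apply; rewrite ltry. Qed.

(* Covers are arbitrary in [box_gauge], so comparing an outer measure with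
   Lebesgue's on boxes is enough. *)
Lemma outer_le_lebesgue n (Phi : set 'rV[R]_n -> \bar R) (c : R) :
  (0 < c)%R -> Phi set0 = 0 -> {homo Phi : A B / A `<=` B >-> A <= B} ->
  sigma_subadditive Phi ->
  (forall a b, le_row a b -> Phi (box a b) <= (c * box_vol a b)%:E) ->
  forall A, Phi A <= c%:E * mu n A.
Proof.
move=> c0 Phi0 Phile Phisub Phibox A.
have gauge U : Phi U <= c%:E * box_gauge U.
  rewrite /box_gauge; case: ifPn => [/eqP->|_]; first by rewrite Phi0 mule0.
  rewrite -lee_pdivrMl//; apply: le_ereal_inf_tmp => _ [[a b]/= [ab Uab] <-].
  rewrite lee_pdivrMl// -EFinM; apply: le_trans (Phibox _ _ ab); exact: Phile.
rewrite lebesgue_outerE /cover_measure -lee_pdivrMl//.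
apply: le_ereal_inf_tmp => _ [U AU <-]; rewrite lee_pdivrMl//.
apply: (le_trans (Phile _ _ AU)); apply: (le_trans (Phisub _)).
rewrite -nneseriesZl; last by move=> k _; exact: box_gauge_ge0.
apply: lee_nneseries => [k _ _|k _]; last exact: gauge.
by rewrite -Phi0; apply: Phile.
Qed.

End lebesgue_outer_theory.

(** * Rectangles *)

Section integrals.
Context d (T : measurableType d) (R : realType) (mu : {measure set T -> \bar R}).
Local Open Scope ereal_scope.
Import HBNNSimple.

(* No measurability: [\int] of a nonnegative function is a supremum over the
   simple functions below it. *)
Lemma lower_integral_le (D : set T) (f g : T -> \bar R) :
  (forall x, D x -> 0 <= f x) -> (forall x, D x -> f x <= g x) ->
  \int[mu]_(x in D) f x <= \int[mu]_(x in D) g x.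
Proof.
move=> f0 fg; have g0 x : D x -> 0 <= g x by move=> Dx; exact: le_trans (f0 _ Dx) (fg _ Dx).
rewrite !ge0_integralE//; apply: ge_ereal_sup => _ [h hf <-].
apply: ereal_sup_ubound; exists h => // x; apply: (le_trans (hf x)).
by rewrite !patchE; case: ifPn => // /set_mem; exact: fg.
Qed.

(** Multiplying the simple functions below [f] gives one inequality for every positive factor; using
    it for [c] and for [c^-1] gives equality, with [f] arbitrary nonnegative. *)
Lemma lower_integralZ (D : set T) (f : T -> \bar R) (c : R) :
  (0 < c)%R -> (forall x, D x -> 0 <= f x) ->
  \int[mu]_(x in D) (c%:E * f x) = c%:E * \int[mu]_(x in D) f x.
Proof.
have half (a : R) (g : T -> \bar R) : (0 < a)%R -> (forall x, D x -> 0 <= g x) ->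
    a%:E * \int[mu]_(x in D) g x <= \int[mu]_(x in D) (a%:E * g x).
  move=> a0 g0; rewrite -lee_pdivlMl//.
  rewrite !ge0_integralE//; last by move=> x Dx; rewrite mule_ge0 ?lee_fin ?(ltW a0)// g0.
  apply: ge_ereal_sup => _ [h hg <-]; rewrite lee_pdivlMl//.
  rewrite -sintegralrM; apply: ereal_sup_ubound.
  exists (scale_nnsfun h (ltW a0)) => // x /=.
  have := hg x; rewrite !patchE; case: ifPn => _; last first.
    by rewrite !lee_fin pmulr_rle0.
  by rewrite EFinM => hx; rewrite lee_pmul2l// lte_fin.
move=> c0 f0; apply/eqP; rewrite eq_le half// andbT.
rewrite -lee_pdivrMl//.
have := @half (c^-1)%R (fun x => c%:E * f x).
rewrite invr_gt0 => /(_ c0) H; apply: (le_trans (H _)).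
  by move=> x Dx; rewrite mule_ge0 ?lee_fin ?(ltW c0)// f0.
apply: lower_integral_le => x Dx; last by rewrite muleA -EFinM mulVf ?gt_eqF// mul1e.
by rewrite muleA -EFinM mulVf ?gt_eqF// mul1e f0.
Qed.

(** Only the staircase has to be measurable: its integral is computed exactly and monotonicity of
    the lower integral does the rest. *)
Lemma lower_integral_staircase (D : set T) (k : nat) (a : nat -> R) (B : nat -> set T)
    (f : T -> R) : measurable D -> (forall i, measurable (B i)) -> (forall i, B i `<=` D) ->
  (forall i, (0 <= a i)%R) -> (forall x, D x -> (\sum_(i < k) a i * \1_(B i) x <= f x)%R) ->
  \sum_(i < k) (a i)%:E * mu (B i) <= \int[mu]_(x in D) (f x)%:E.
Proof.
move=> mD mB BD a0 h.
have -> : \sum_(i < k) (a i)%:E * mu (B i) =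
    \int[mu]_(x in D) \sum_(i < k) (a i * \1_(B i) x)%R%:E.
  rewrite ge0_integral_sum//; last 2 first.
  - by move=> i; apply/measurable_EFinP; apply: measurable_funM.
  - by move=> i x _; rewrite lee_fin mulr_ge0.
  apply: eq_bigr => i _; under eq_integral do rewrite EFinM.
  rewrite ge0_integralZl_EFin//; last exact/measurable_EFinP.
  by rewrite integral_indic// setIidl.
apply: lower_integral_le => x Dx; last by rewrite sumEFin lee_fin h.
by apply: sume_ge0 => i _; rewrite lee_fin mulr_ge0.
Qed.

Lemma bound_integrable (D : set T) (f : T -> R) (M : R) : measurable D -> mu D < +oo ->
  measurable_fun D f -> (forall x, D x -> (`|f x| <= M)%R) -> mu.-integrable D (EFin \o f).
Proof.
move=> mD Dfin mf fM; apply: measurable_bounded_integrable => //.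
exists M; split; first exact: num_real.
by move=> N MN x Dx /=; apply: le_trans (fM _ Dx) _; exact: ltW.
Qed.

End integrals.

Section rectangles.
Context {R : realType}.
Local Open Scope ereal_scope.
Local Notation leb := (@lebesgue_measure R).

Let int_indic (c : R) (E : set R) (e : R) : (0 <= c)%R -> measurable E ->
  leb E = e%:E -> \int[leb]_x (c * \1_E x)%:E = (c * e)%:E.
Proof.
move=> c0 mE Ee; under eq_integral do rewrite EFinM.
rewrite ge0_integralZl_EFin//; last exact/measurable_EFinP.
by rewrite integral_indic// setIT [X in _ * X]Ee.
Qed.

(** Both sides are integrals over the line of the functions compared in the last hypothesis; for the
    series this is monotone convergence. *)
Lemma interval_cover (I : Type) (J : seq I) (u e : I -> R) (E : I -> set R)
    (w g : nat -> R) (G : nat -> set R) :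
  (forall j, (0 <= u j)%R) -> (forall k, (0 <= w k)%R) ->
  (forall j, measurable (E j)) -> (forall k, measurable (G k)) ->
  (forall j, leb (E j) = (e j)%:E) -> (forall k, leb (G k) = (g k)%:E) ->
  (forall x, (\sum_(j <- J) u j * \1_(E j) x)%R%:E
             <= \sum_(k <oo) (w k * \1_(G k) x)%R%:E) ->
  (\sum_(j <- J) u j * e j)%R%:E <= \sum_(k <oo) (w k * g k)%R%:E.
Proof.
move=> u0 w0 mE mG Ee Gg H.
have mI (c : R) (A : set R) : measurable A -> measurable_fun setT (fun x => (c * \1_A x)%R%:E).
  by move=> mA; apply/measurable_EFinP/measurable_funM.
have -> : (\sum_(j <- J) u j * e j)%R%:E =
    \int[leb]_x (\sum_(j <- J) u j * \1_(E j) x)%R%:E.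
  under [RHS]eq_integral do rewrite -sumEFin.
  rewrite ge0_integral_sum//; last 2 first.
  - by move=> j; exact: mI.
  - by move=> j x _; rewrite lee_fin mulr_ge0.
  by rewrite -sumEFin; apply: eq_bigr => j _; rewrite (int_indic _ _ (Ee j)).
have -> : \sum_(k <oo) (w k * g k)%R%:E =
    \int[leb]_x \sum_(k <oo) (w k * \1_(G k) x)%R%:E.
  rewrite integral_nneseries//; last 2 first.
  - by move=> j; exact: mI.
  - by move=> j x _; rewrite lee_fin mulr_ge0.
  by apply: eq_eseriesr => k _; rewrite (int_indic _ _ (Gg k)).
apply: lower_integral_le => // x _; rewrite lee_fin sumr_ge0// => j _.
by rewrite mulr_ge0.
Qed.

(* Integrate out one coordinate after the other. *)
Lemma rectangle_cover m (I : Type) (J : seq I) (u : I -> R) (e : I -> 'I_m -> R)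
    (E : I -> 'I_m -> set R) (w : nat -> R) (g : nat -> 'I_m -> R)
    (G : nat -> 'I_m -> set R) :
  (forall j, (0 <= u j)%R) -> (forall k, (0 <= w k)%R) ->
  (forall j i, measurable (E j i)) -> (forall k i, measurable (G k i)) ->
  (forall j i, leb (E j i) = (e j i)%:E) -> (forall k i, leb (G k i) = (g k i)%:E) ->
  (forall x : 'I_m -> R,
     (\sum_(j <- J) u j * \prod_i \1_(E j i) (x i))%R%:E
     <= \sum_(k <oo) (w k * \prod_i \1_(G k i) (x i))%R%:E) ->
  (\sum_(j <- J) u j * \prod_i e j i)%R%:E
  <= \sum_(k <oo) (w k * \prod_i g k i)%R%:E.
Proof.
elim: m u e E w g G => [|m IH] u e E w g G u0 w0 mE mG Ee Gg H.
  have A (F : I -> 'I_0 -> R) : (\sum_(j <- J) u j * \prod_i F j i = \sum_(j <- J) u j)%R.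
    by apply: eq_bigr => j _; rewrite big_ord0 mulr1.
  have B (F : nat -> 'I_0 -> R) :
      \sum_(k <oo) (w k * \prod_i F k i)%R%:E = \sum_(k <oo) (w k)%:E.
    by apply: eq_eseriesr => j _; rewrite big_ord0 mulr1.
  by have := H (fun=> 0%R); rewrite !A !B.
have e0 j i : (0 <= e j i)%R by rewrite -lee_fin -Ee measure_ge0.
have g0 k i : (0 <= g k i)%R by rewrite -lee_fin -Gg measure_ge0.
have A (v : I -> R) (F : I -> 'I_m.+1 -> R) : (\sum_(j <- J) v j * \prod_i F j i =
    \sum_(j <- J) (v j * \prod_i F j (lift ord0 i)) * F j ord0)%R.
  by apply: eq_bigr => j _; rewrite big_ord_recl -mulrA [(_ * F _ _)%R]mulrC.
have B (v : nat -> R) (F : nat -> 'I_m.+1 -> R) :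
    \sum_(k <oo) (v k * \prod_i F k i)%R%:E =
    \sum_(k <oo) (v k * \prod_i F k (lift ord0 i) * F k ord0)%R%:E.
  by apply: eq_eseriesr => j _; rewrite big_ord_recl -mulrA [(_ * F _ _)%R]mulrC.
rewrite A B; apply: (@interval_cover _ _ _ _ (fun j => E j ord0) _ _ (fun k => G k ord0)) => //.
- by move=> j; rewrite mulr_ge0// prodr_ge0.
- by move=> j; rewrite mulr_ge0// prodr_ge0.
(* With the first coordinate frozen at [x0], its indicators are absorbed into the weights; this is
   why the statement carries [u] and [w]. *)
move=> x0; under eq_bigr do rewrite mulrAC.
under [X in _ <= X]eq_eseriesr do rewrite mulrAC.
apply: (IH (fun j => u j * \1_(E j ord0) x0)%R (fun j i => e j (lift ord0 i))
  (fun j i => E j (lift ord0 i)) (fun k => w k * \1_(G k ord0) x0)%R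
  (fun k i => g k (lift ord0 i)) (fun k i => G k (lift ord0 i))) => //.
- by move=> j; rewrite mulr_ge0.
- by move=> j; rewrite mulr_ge0.
move=> y.
have := H (fun i => if unlift ord0 i is Some j then y j else x0); rewrite A B.
rewrite (eq_bigr (fun j => u j * \1_(E j ord0) x0 *
    \prod_i \1_(E j (lift ord0 i)) (y i))%R); last first.
  move=> j _; rewrite unlift_none mulrAC; congr (_ * _)%R.
  by apply: eq_bigr => i _; rewrite liftK.
rewrite (@eq_eseriesr _ _ (fun k => (w k * \1_(G k ord0) x0 *
    \prod_i \1_(G k (lift ord0 i)) (y i))%:E))// => k _.
rewrite unlift_none mulrAC; congr (_ * _)%:E.
by apply: eq_bigr => i _; rewrite liftK.
Qed.

End rectangles.

(** * Lebesgue outer measure of boxes, dilations and cylinders *)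

Section lebesgue_boxes.
Context {R : realType}.
Local Notation mu n := (@lebesgue_outer_measure R n).
Local Open Scope ereal_scope.

Definition obox n (a b : 'rV[R]_n) : set 'rV[R]_n :=
  [set x | forall i, (a 0 i <= x 0 i < b 0 i)%R].

Lemma prod_indic n (E : 'I_n -> set R) (x : 'I_n -> R) :
  (\prod_i \1_(E i) (x i) = (`[< forall i, E i (x i) >])%:R :> R)%R.
Proof.
case: asboolP => [h|/existsNP[i h]].
  by rewrite big1// => i _; rewrite indicE mem_set.
by rewrite (bigD1 i)//= indicE memNset// mul0r.
Qed.

(** The weight [p.1.1] is 1 except for the empty set, where it is 0: for [n = 0] even the smallest
    box has volume 1. *)
Lemma box_gauge_box n (U : set 'rV[R]_n) (e : R) : (0 < e)%R -> box_gauge U < +oo ->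
  exists p : R * 'rV[R]_n * 'rV[R]_n, [/\ (0 <= p.1.1)%R, le_row p.1.2 p.2,
    forall x, U x -> (1 <= p.1.1 * (`[< box p.1.2 p.2 x >])%:R)%R &
    (p.1.1 * box_vol p.1.2 p.2)%:E <= box_gauge U + e%:E].
Proof.
move=> e0; have := box_gauge_ge0 U; rewrite /box_gauge; case: ifPn => [/eqP-> _ _|U0 g0 goo].
  exists (0%R, 0%R, 0%R); split => //=.
  by rewrite mul0r add0e lee_fin; exact: ltW.
have : ereal_inf [set (\prod_(i < n) (p.2 0 i - p.1 0 i))%:E
    | p in [set p : 'rV[R]_n * 'rV[R]_n |
      (forall i, (p.1 0 i <= p.2 0 i)%R) /\ U `<=` box p.1 p.2]] \is a fin_num.
  by rewrite ge0_fin_numE.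
move=> /(lb_ereal_inf_adherent e0)[_ [[a b]/= [ab Uab] <-]] /ltW vab.
exists (1%R, a, b); split => //=.
  by move=> x /Uab abx; rewrite asboolT// mulr1.
by rewrite mul1r.
Qed.

Lemma nneseries_pinfty (f : nat -> \bar R) k : (forall k, 0 <= f k) -> f k = +oo ->
  \sum_(k <oo) f k = +oo.
Proof.
move=> f0 fk; apply/eqP; rewrite -leye_eq -fk.
apply: (le_trans _ (@nneseries_lim_ge _ _ predT 0%N k.+1 _)) => //.
by rewrite big_nat_recr//= leeDr// sume_ge0.
Qed.

(** The lower bound for the outer measure. At each point the indicators of the disjoint half-open
    boxes add up to at most 1, and on [X] those of a box cover to at least 1; [rectangle_cover]
    turns this into a comparison of volumes. *)
Lemma lebesgue_disjoint_boxes n (I : eqType) (J : seq I) (p q : I -> 'rV[R]_n)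
    (X : set 'rV[R]_n) : uniq J -> (forall j, le_row (p j) (q j)) ->
  (forall j j' x, j \in J -> j' \in J ->
    obox (p j) (q j) x -> obox (p j') (q j') x -> j = j') ->
  (forall j, j \in J -> obox (p j) (q j) `<=` X) ->
  (\sum_(j <- J) box_vol (p j) (q j))%R%:E <= mu n X.
Proof.
move=> uJ pq disj sub; rewrite lebesgue_outerE.
apply: le_ereal_inf_tmp => _ [U XU <-]; apply/lee_addgt0Pr => e e0.
have [[k goo]|/forallNP goo] := pselect (exists k, box_gauge (U k) = +oo).
  rewrite (nneseries_pinfty _ goo) ?addye ?leey// => ?; exact: box_gauge_ge0.
have ek k : (0 < e / (2 ^ k.+1)%:R)%R by rewrite divr_gt0// ltr0n expn_gt0.
have gk k : box_gauge (U k) < +oo by rewrite lt_neqAle leey andbT; apply/eqP/goo.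
have /choice[f P] := fun k => box_gauge_box (ek k) (gk k).
pose w k := (f k).1.1; pose a k := (f k).1.2; pose b k := (f k).2.
have {}P k : [/\ (0 <= w k)%R, le_row (a k) (b k),
    forall x, U k x -> (1 <= w k * (`[< box (a k) (b k) x >])%:R)%R &
    (w k * box_vol (a k) (b k))%:E <= box_gauge (U k) + (e / (2 ^ k.+1)%:R)%:E] := P k.
apply: (@le_trans _ _ (\sum_(k <oo) (w k * box_vol (a k) (b k))%:E)); last first.
  apply: (le_trans _ (epsilon_trick _ _ (ltW e0))); last by move=> k; exact: box_gauge_ge0.
  apply: lee_nneseries => [k _ _|k _]; last by have [] := P k.
  by rewrite lee_fin mulr_ge0 ?box_vol_ge0//; have [] := P k.
rewrite [X in X%:E <= _](eq_bigr (fun j => 1 * \prod_i (q j 0 i - p j 0 i))%R); last first.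
  by move=> j _; rewrite mul1r.
apply: (@rectangle_cover _ n I J (fun=> 1%R) (fun j i => q j 0 i - p j 0 i)%R
  (fun j i => `[p j 0%R i, q j 0%R i[%classic) w (fun k i => b k 0 i - a k 0 i)%R
  (fun k i => `[a k 0%R i, b k 0%R i]%classic)) => //.
- by move=> k; have [] := P k.
- move=> j i; rewrite lebesgue_measure_itv/= lte_fin; case: ltP => //.
  have := pq j i => h1 h2; rewrite (_ : q j 0%R i = p j 0%R i) ?subrr//.
  by apply: le_anti; rewrite h1 h2.
- move=> k i; rewrite lebesgue_measure_itv/= lte_fin; case: ltP => //.
  have [_ + _ _] := P k; move=> /(_ i) h1 h2; rewrite (_ : b k 0%R i = a k 0%R i) ?subrr//.
  by apply: le_anti; rewrite h1 h2.
move=> x; pose y := (\row_i x i)%R.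
under eq_bigr do rewrite prod_indic mul1r.
rewrite (@eq_eseriesr _ _ (fun k => (w k * (`[< box (a k) (b k) y >])%:R)%:E)); last first.
  move=> k _; rewrite prod_indic; congr (_ * (nat_of_bool _)%:R)%:E.
  by apply: asbool_equiv_eq; split => h i; have := h i; rewrite /= in_itv/= mxE.
have t0 k : (0 <= w k * (`[< box (a k) (b k) y >])%:R)%R by rewrite mulr_ge0//; have [] := P k.
have [[j jJ jx]|none] := pselect (exists2 j, j \in J & obox (p j) (q j) y); last first.
  rewrite big1_seq ?nneseries_ge0// => [k _ _|j /= jJ]; first by rewrite lee_fin.
  rewrite asboolF// => h; apply: none; exists j => // i.
  by have := h i; rewrite /= in_itv/= mxE.
have [k _ Uky] := XU _ (sub _ jJ _ jx).
apply: (@le_trans _ _ (w k * (`[< box (a k) (b k) y >])%:R)%:E); last first.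
  apply: (le_trans _ (@nneseries_lim_ge _ _ predT 0%N k.+1 _)) => [|? _ _]; last by rewrite lee_fin.
  by rewrite big_nat_recr//= leeDr// sume_ge0// => ? _; rewrite lee_fin.
rewrite lee_fin; have [_ _ + _] := P k => /(_ _ Uky); apply: le_trans.
rewrite (bigD1_seq j)//= big1_seq ?addr0 ?lern1 ?leq_b1// => j' /andP[j'j j'J].
rewrite asboolF// => h; move/eqP: j'j; apply; apply: (disj _ _ y) => // i.
by have := h i; rewrite /= in_itv/= mxE.
Qed.

Lemma lebesgue_obox_ge n (a b : 'rV[R]_n) X : le_row a b -> obox a b `<=` X ->
  (box_vol a b)%:E <= mu n X.
Proof.
move=> ab abX; have := @lebesgue_disjoint_boxes n unit [:: tt] (fun=> a) (fun=> b) X.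
by rewrite big_seq1; apply => // -[] [].
Qed.

Lemma lebesgue_boxE n (a b : 'rV[R]_n) : le_row a b -> mu n (box a b) = (box_vol a b)%:E.
Proof.
move=> ab; apply/eqP; rewrite eq_le lebesgue_box_le// lebesgue_obox_ge// => x h i.
by have /andP[-> /ltW->] := h i.
Qed.

(** As a function of [A] the left side is an outer measure, so it suffices to bound it on boxes. *)
Lemma lebesgue_bigcup_le m n (F : 'rV[R]_m -> set 'rV[R]_n) (c : R) : (0 < c)%R ->
  (forall a b, le_row a b -> mu n (\bigcup_(x in box a b) F x) <= (c * box_vol a b)%:E) ->
  forall A, mu n (\bigcup_(x in A) F x) <= c%:E * mu m A.
Proof.
move=> c0 H; apply: outer_le_lebesgue => //.
- by rewrite bigcup_set0 outer_measure0.
- by move=> A B AB; apply: le_outer_measure; exact: bigcup_subset.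
- move=> A; rewrite (_ : \bigcup_(x in _) _ = \bigcup_k \bigcup_(x in A k) F x).
    exact: outer_measure_sigma_subadditive.
  apply/seteqP; split => [y [x [k _ Akx] Fxy]|y [k _ [x Akx Fxy]]].
    by exists k => //; exists x.
  by exists x => //; exists k.
Qed.

Lemma lebesgue_image_le m n (f : 'rV[R]_m -> 'rV[R]_n) (c : R) : (0 < c)%R ->
  (forall a b, le_row a b -> mu n (f @` box a b) <= (c * box_vol a b)%:E) ->
  forall A, mu n (f @` A) <= c%:E * mu m A.
Proof.
have E A : f @` A = \bigcup_(x in A) [set f x].
  by apply/seteqP; split => y [x Ax]; [move=> <-|move=> ->]; exists x.
by move=> c0 H A; rewrite E; apply: lebesgue_bigcup_le => // a b ab; rewrite -E H.
Qed.

Lemma lebesgue_affine_le n (t : R) (z : 'rV[R]_n) A : (0 < t)%R ->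
  mu n [set t *: x + z | x in A]%R <= (t ^+ n)%:E * mu n A.
Proof.
move=> t0; apply: lebesgue_image_le => [|a b ab]; first by rewrite exprn_gt0.
apply: (@le_trans _ _ (mu n (box (t *: a + z) (t *: b + z))%R)).
  apply: le_outer_measure => _ [x abx <-] i; rewrite !mxE.
  by rewrite !lerD2r !ler_pM2l//; exact: abx.
rewrite lebesgue_boxE; last by move=> i; rewrite !mxE lerD2r ler_pM2l.
rewrite lee_fin /box_vol -[X in (_ ^+ X)%R]card_ord -prodr_const -big_split/=.
by rewrite (eq_bigr (fun i => t * (b 0 i - a 0 i))%R)// => i _; rewrite !mxE; ring.
Qed.

Lemma lebesgue_scale n (t : R) A : (0 < t)%R ->
  mu n [set t *: x | x in A]%R = (t ^+ n)%:E * mu n A.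
Proof.
have le (s : R) B : (0 < s)%R -> mu n [set s *: x | x in B]%R <= (s ^+ n)%:E * mu n B.
  move=> s0; have := @lebesgue_affine_le n s 0%R B s0.
  by under [X in mu n X <= _ -> _]eq_imagel do rewrite addr0.
move=> t0; apply/eqP; rewrite eq_le le//=.
rewrite -lee_pdivlMl ?exprn_gt0//.
have := @le (t^-1)%R [set t *: x | x in A]%R; rewrite invr_gt0 => /(_ t0).
rewrite exprVn image_comp (_ : _ @` A = A)//.
rewrite -[RHS]image_id; apply: eq_imagel => x _ /=.
by rewrite scalerA mulVf ?gt_eqF// scale1r.
Qed.

Definition cylinder m (A : set 'rV[R]_m) (p q : R) : set 'rV[R]_(m + 1) :=
  [set z | A (lsubmx z) /\ (p <= rsubmx z 0 0 <= q)%R].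

Lemma lebesgue_cylinder_le m (p q : R) (A : set 'rV[R]_m) : (p < q)%R ->
  mu (m + 1) (cylinder A p q) <= (q - p)%:E * mu m A.
Proof.
move=> pq; rewrite (_ : cylinder A p q = \bigcup_(x in A) cylinder [set x] p q); last first.
  by apply/seteqP; split => [z [Az zpq]|z [x Ax [/= zx zpq]]]; [exists (lsubmx z)|split; rewrite ?zx].
apply: lebesgue_bigcup_le => [|a b ab]; first by rewrite subr_gt0.
pose a' := row_mx a (\row__ p)%R : 'rV[R]_(m + 1).
pose b' := row_mx b (\row__ q)%R : 'rV[R]_(m + 1).
apply: (@le_trans _ _ (mu (m + 1) (box a' b'))).
  apply: le_outer_measure => z [x abx [/= zx zpq]] i; rewrite -[z]hsubmxK.
  rewrite -[i]splitK; case: (fintype.split i) => j; rewrite /= ?(row_mxEl, row_mxEr).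
    by rewrite zx; exact: abx.
  by rewrite !mxE !ord1; move: zpq; rewrite !mxE.
rewrite lebesgue_boxE; last first.
  move=> i; rewrite -[i]splitK; case: (fintype.split i) => j;
    by rewrite /= ?(row_mxEl, row_mxEr) ?mxE// ltW.
rewrite lee_fin /box_vol big_split_ord/= big_ord1 mulrC !row_mxEr !mxE.
by rewrite (eq_bigr (fun i => b 0 i - a 0 i)%R)// => i _; rewrite !row_mxEl.
Qed.

End lebesgue_boxes.

(** * Linear images *)

Section limits.
Context {R : realType}.

Lemma lee_cvg (x : \bar R) (u : R ^nat) (l : R) : u @ \oo --> l ->
  (forall n, (x <= (u n)%:E)%E) -> (x <= l%:E)%E.
Proof.
move=> ul; case: x => [r| |] h; last by rewrite leNye.
  rewrite lee_fin -(cvg_lim _ ul)//; apply: limr_ge; first by apply/cvg_ex; exists l.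
  by apply: nearW => n; rewrite -lee_fin.
by have := h 0%N; rewrite leye_eq.
Qed.

Lemma cvg_prodD_harmonic n (w c : 'I_n -> R) :
  (fun N => \prod_(i < n) (w i + c i * harmonic N)) @ \oo --> \prod_(i < n) w i.
Proof.
elim: n w c => [|n IH] w c.
  under eq_fun do rewrite big_ord0; rewrite big_ord0; exact: cvg_cst.
under eq_fun do rewrite big_ord_recl; rewrite big_ord_recl; apply: cvgM; last exact: IH.
rewrite -[X in _ --> X]addr0; apply: cvgD; first exact: cvg_cst.
by rewrite -(mulr0 (c ord0)); apply: cvgMr; exact: cvg_harmonic.
Qed.

End limits.

Section grid.

Fixpoint grid (ks : seq nat) : seq (seq nat) :=
  if ks is k :: ks' then [seq j :: s | j <- iota 0 k, s <- grid ks'] else [:: [::]].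

Lemma size_grid ks : size (grid ks) = (\prod_(k <- ks) k)%N.
Proof.
by elim: ks => [|k ks IH]; rewrite ?big_nil ?big_cons//= size_allpairs size_iota IH.
Qed.

Lemma mem_grid ks s : (s \in grid ks) = all2 ltn s ks.
Proof.
elim: ks s => [|k ks IH] [|j s] //=.
  by apply/negbTE/negP => /allpairsP[[a b]/= [_ _]].
apply/allpairsP/andP => [[[a b]/= [ak bg [-> ->]]]|[jk sks]].
  by rewrite -IH bg; move: ak; rewrite mem_iota.
by exists (j, s); rewrite /= mem_iota IH.
Qed.

Lemma uniq_grid ks : uniq (grid ks).
Proof.
elim: ks => //= k ks IH; apply: allpairs_uniq => //; first exact: iota_uniq.
by move=> [a b] [a' b'] _ _ /= [-> ->].
Qed.

Lemma grid_map n (f k : 'I_n -> nat) : (forall i, (f i < k i)%N) ->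
  [seq f i | i <- enum 'I_n] \in grid [seq k i | i <- enum 'I_n].
Proof. by move=> fk; rewrite mem_grid; elim: (enum 'I_n) => //= i s ->; rewrite fk. Qed.

Lemma nth_enum_map n (f : 'I_n -> nat) (i : 'I_n) :
  nth 0%N [seq f i | i <- enum 'I_n] i = f i.
Proof. by rewrite (nth_map i) ?size_enum_ord// nth_ord_enum. Qed.

End grid.

Section linear_images.
Context {R : realType}.
Local Notation mu n := (@lebesgue_outer_measure R n).
Local Open Scope ereal_scope.

Lemma outer_measure_seqU (T : Type) (nu : {outer_measure set T -> \bar R}) (I : Type)
    (s : seq I) (F : I -> set T) :
  nu (\big[setU/set0]_(i <- s) F i) <= \sum_(i <- s) nu (F i).
Proof.
elim: s => [|i s IH]; first by rewrite !big_nil outer_measure0.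
by rewrite !big_cons; apply: (le_trans (outer_measureU2 _ _ _)); rewrite leeD2l.
Qed.

Definition cube n : set 'rV[R]_n := box (const_mx (-1)%R) (const_mx 1%R).
Arguments cube : clear implicits.

Lemma lebesgue_cube n : mu n (cube n) = (2 ^+ n)%:E.
Proof.
rewrite lebesgue_boxE; last by move=> i; rewrite !mxE; lra.
rewrite /box_vol (eq_bigr (fun=> 2%R)) ?prodr_const ?card_ord// => i _.
by rewrite !mxE opprK.
Qed.

(** A box is covered by at most the product of the [(N+1)(b_i - a_i) + 1] cubes of side [1/(N+1)].
    Each is a translate of a small copy of [cube n], whose image has measure at most [c / (N+1)^n];
    the excess disappears as [N] grows. *)
Lemma lebesgue_linear_le n (f : {linear 'rV[R]_n -> 'rV[R]_n}) (c : R) :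
  (0 < c)%R -> mu n (f @` cube n) <= (c * 2 ^+ n)%:E ->
  forall A, mu n (f @` A) <= c%:E * mu n A.
Proof.
move=> c0 fQ; apply: lebesgue_image_le => // a b ab.
apply: (lee_cvg (u := fun N => c * \prod_(i < n) ((b 0 i - a 0 i) + 1 * harmonic N))%R).
  by apply: cvgMr; exact: cvg_prodD_harmonic.
move=> N; have N0 : (0 < N.+1%:R :> R)%R by [].
pose k i := (Num.truncn (N.+1%:R * (b 0 i - a 0 i))%R).+1.
(* [cen s] is the centre of the small cube of index [s], and [hN] below is half its side, as
   [cube n] has side 2. *)
pose cen (s : seq nat) : 'rV[R]_n := (\row_i (a 0 i + ((nth 0%N s i)%:R + 2^-1) / N.+1%:R))%R.
pose hN : R := (2^-1 / N.+1%:R)%R.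
have hN0 : (0 < hN)%R by rewrite divr_gt0// invr_gt0.
pose C s := [set hN *: x + f (cen s) | x in f @` cube n]%R.
have Cle s : mu n (C s) <= (c / N.+1%:R ^+ n)%:E.
  apply: (le_trans (lebesgue_affine_le _ _ hN0)).
  apply: (@le_trans _ _ ((hN ^+ n)%:E * (c * 2 ^+ n)%:E)).
    by rewrite lee_wpmul2l// lee_fin exprn_ge0// ltW.
  rewrite -EFinM lee_fin /hN exprMn !exprVn.
  have : (2 ^+ n != 0 :> R)%R by rewrite expf_neq0.
  have : (N.+1%:R ^+ n != 0 :> R)%R by rewrite expf_neq0.
  move: (2 ^+ n)%R (N.+1%:R ^+ n)%R => A B B0 A0.
  by rewrite le_eqVlt; apply/orP; left; apply/eqP; field; rewrite A0 B0.
have cover : f @` box a b `<=` \big[setU/set0]_(s <- grid [seq k i | i <- enum 'I_n]) C s.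
  move=> _ [x abx <-]; pose g i := Num.truncn (N.+1%:R * (x 0 i - a 0 i))%R.
  have gx i : ((g i)%:R <= N.+1%:R * (x 0 i - a 0 i) < (g i).+1%:R)%R.
    apply: Num.Theory.truncn_itv; rewrite mulr_ge0// subr_ge0.
    by have /andP[] := abx i.
  have gk i : (g i < k i)%N.
    rewrite ltnS; apply: Num.Theory.le_truncn; rewrite ler_wpM2l// lerD2r.
    by have /andP[] := abx i.
  rewrite -bigcup_seq; exists [seq g i | i <- enum 'I_n]; first exact: grid_map.
  pose y := (hN^-1 *: (x - cen [seq g i | i <- enum 'I_n]))%R.
  exists (f y); last first.
    by rewrite -linearZ -linearD /y scalerA mulfV ?gt_eqF// scale1r subrK.
  exists y => // i; rewrite !mxE nth_enum_map /hN.
  have /andP[g1 g2] := gx i.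
  have -> : ((2^-1 / N.+1%:R)^-1 * (x 0 i - (a 0 i + ((g i)%:R + 2^-1) / N.+1%:R)) =
    2 * (N.+1%:R * (x 0 i - a 0 i) - (g i)%:R) - 1 :> R)%R by field.
  by move: g2; rewrite -natr1; lra.
apply: (le_trans (le_outer_measure _ _ _ cover)).
apply: (le_trans (outer_measure_seqU _ _ _)).
apply: (@le_trans _ _ (\sum_(s <- grid [seq k i | i <- enum 'I_n]) (c / N.+1%:R ^+ n)%:E)).
  by apply: lee_sum => s _; exact: Cle.
rewrite sumEFin lee_fin big_const_seq count_predT iter_addr_0 size_grid big_map big_enum/=.
rewrite -[leLHS]mulr_natr natr_prod -mulrA; apply: ler_wpM2l; first exact: ltW.
rewrite mulrC.
rewrite -[X in (_ ^+ X)%R]card_ord -prodr_const -prodf_div. rewrite [leLHS](eq_bigl xpredT)//.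
apply: ler_prod => i _.
rewrite divr_ge0//= mul1r ler_pdivrMr// mulrDl mulVf// /k -natr1 lerD2r mulrC.
by rewrite Num.Theory.truncn_le mulr_ge0// subr_ge0.
Qed.

End linear_images.
Arguments cube {R} n _.

(** * Measurability of closed sets *)

Section euclidean_topology.
Context {R : realType} {n : nat}.
Implicit Types (x y : 'rV[R]_n) (A C : set 'rV[R]_n).

Lemma nbhs_enorm x A :
  nbhs x A <-> exists2 e : R, 0 < e & forall y, enorm (y - x) < e -> A y.
Proof.
split=> [/nbhs_ballP[e /= e0 eA]|[e e0 eA]].
  exists e => // y ye; apply: eA; split => // i j; rewrite !ord1 /ball/= distrC.
  by have := coord_le_enorm (y - x) j; rewrite !mxE => /le_lt_trans; apply.
have n0 : 0 < n.+1%:R :> R by [].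
apply/nbhs_ballP; exists (e / n.+1%:R) => /=; first by rewrite divr_gt0.
move=> y [_ xy]; apply: eA.
apply: (@le_lt_trans _ _ (n%:R * (e / n.+1%:R))).
  apply: enorm_le_coord => [|i]; first by rewrite divr_ge0 ?ltW.
  by have := xy ord0 i; rewrite /ball/= !mxE distrC => /ltW.
by rewrite mulrCA gtr_pMr// ltr_pdivrMr// mul1r ltr_nat.
Qed.

Lemma closed_enorm C x : closed C ->
  (forall e : R, 0 < e -> exists2 y, C y & enorm (y - x) < e) -> C x.
Proof.
move=> cC h; apply: cC => A /nbhs_enorm[e e0 eA].
by have [y Cy yx] := h _ e0; exists y; split=> //; exact: eA.
Qed.

Lemma enorm_closed C :
  (forall x, (forall e : R, 0 < e -> exists2 y, C y & enorm (y - x) < e) -> C x) -> closed C.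
Proof.
move=> h x xC; apply: h => e e0.
have [|y [Cy yx]] := xC [set y | enorm (y - x) < e]; last by exists y.
by apply/nbhs_enorm; exists e.
Qed.

End euclidean_topology.

Section lebesgue_measurable.
Context {R : realType} (n : nat).
Local Notation mu := (@lebesgue_outer_measure R n).
Local Notation cara := (caratheodory_type mu).
Local Open Scope ereal_scope.

Lemma box_gauge_le (V : set 'rV[R]_n) (a b : 'rV[R]_n) : le_row a b -> V `<=` box a b ->
  box_gauge V <= (box_vol a b)%:E.
Proof.
move=> ab Vab; rewrite /box_gauge; case: ifPn => _; first by rewrite lee_fin box_vol_ge0.
by apply: ereal_inf_lbound; exists (a, b); last by []; split.
Qed.

Lemma box_gauge_split (U : set 'rV[R]_n) i (t : R) :
  box_gauge (U `&` [set x | (x 0 i <= t)%R]) + box_gauge (U `&` ~` [set x | (x 0 i <= t)%R])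
  <= box_gauge U.
Proof.
have g0 : @box_gauge R n set0 = 0 by rewrite /box_gauge eqxx.
rewrite [leRHS]/box_gauge; case: ifPn => [/eqP->|_]; first by rewrite !set0I g0 adde0.
apply: le_ereal_inf_tmp => _ [[a b]/= [ab Uab] <-].
have := ab i => abi; have [bt|tb] := leP (b 0%R i) t.
  rewrite [X in _ + box_gauge X](_ : _ = set0) ?g0 ?adde0; last first.
    rewrite -subset0 => x [/Uab/(_ i)/andP[_ xb]]; apply.
    exact: le_trans bt.
  by apply: box_gauge_le => // x [/Uab].
have [at_|ta] := leP (a 0%R i) t; last first.
  rewrite [X in box_gauge X + _](_ : _ = set0) ?g0 ?add0e; last first.
    rewrite -subset0 => x [/Uab/(_ i)/andP[ax _]] /= xt.
    by have := lt_le_trans ta (le_trans ax xt); rewrite ltxx.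
  by apply: box_gauge_le => // x [/Uab].
pose b' := (\row_j (if j == i then t else b 0 j))%R : 'rV[R]_n.
pose a' := (\row_j (if j == i then t else a 0 j))%R : 'rV[R]_n.
have -> : (\prod_(j < n) (b 0 j - a 0 j) = box_vol a b' + box_vol a' b)%R.
  have E1 : (\prod_(j < n | j != i) (b' 0 j - a 0 j) = \prod_(j < n | j != i) (b 0 j - a 0 j))%R.
    by apply: eq_bigr => j /negbTE ji; rewrite !mxE ji.
  have E2 : (\prod_(j < n | j != i) (b 0 j - a' 0 j) = \prod_(j < n | j != i) (b 0 j - a 0 j))%R.
    by apply: eq_bigr => j /negbTE ji; rewrite !mxE ji.
  have D (F : 'I_n -> R) : (\prod_j F j = F i * \prod_(j | j != i) F j)%R by rewrite (bigD1 i).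
  rewrite /box_vol !D E1 E2 !mxE eqxx -mulrDl; congr (_ * _)%R.
  by ring.
rewrite EFinD leeD// box_gauge_le// => [j|x [/Uab xab /= xt] j|j|x [/Uab xab /= /negP]].
- by rewrite !mxE; case: eqP => [->|_].
- by rewrite !mxE; have := xab j; case: eqP => [->|_]//; rewrite xt => /andP[->].
- by rewrite !mxE; case: eqP => [->|_]//; exact: ltW.
rewrite -ltNge => xt j.
by rewrite !mxE; have := xab j; case: eqP => [->|_]//; rewrite (ltW xt) => /andP[_ ->].
Qed.

Lemma halfspace_measurable i (t : R) : measurable ([set x | (x 0 i <= t)%R] : set cara).
Proof.
apply: le_caratheodory_measurable => X; rewrite [leRHS]lebesgue_outerE.
apply: le_ereal_inf_tmp => _ [U XU <-].
have le1 (Y : set 'rV[R]_n) : mu (X `&` Y) <= \sum_(k <oo) box_gauge (U k `&` Y).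
  rewrite lebesgue_outerE; apply: cover_measure_le => x [/XU[k _ Ukx] Yx].
  by exists k.
apply: (le_trans (leeD (le1 _) (le1 _))).
rewrite -nneseriesD; [|by move=> *; exact: box_gauge_ge0..].
apply: lee_nneseries => [k _ _|k _]; last exact: box_gauge_split.
by rewrite adde_ge0// box_gauge_ge0.
Qed.

(* A closed set is the intersection over [N] of the unions of the half-open
   grid cubes of side [1/N] meeting it. *)
Lemma lebesgue_closed_measurable (C : set 'rV[R]_n) : closed C -> measurable (C : set cara).
Proof.
move=> cC.
pose G N (z : {ffun 'I_n -> int}) : set cara := \bigcap_(i in [set: 'I_n])
  ([set x | (x 0 i <= (z i)%:~R / N.+1%:R)%R] `&`
   ~` [set x | (x 0 i <= ((z i)%:~R - 1) / N.+1%:R)%R]).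
have mG N z : measurable (G N z).
  apply: fin_bigcap_measurable => [|i _]; first exact: finite_finset.
  by apply: measurableI; [|apply: measurableC]; exact: halfspace_measurable.
pose F N z : set cara := if `[< exists2 y, C y & G N z y >] then G N z else set0.
have -> : (C : set cara) = \bigcap_N \bigcup_z F N z.
  apply/seteqP; split => [x Cx N _|x h].
    pose z := [ffun i => Num.ceil (x 0%R i * N.+1%:R)].
    have Gx : G N z x.
      move=> i _; rewrite /= ffunE.
      have /andP[h1 h2] := Num.Theory.real_ceil_itv (num_real (x 0 i * N.+1%:R)%R).
      split; first by rewrite ler_pdivlMr.
      by apply/negP; rewrite -ltNge ltr_pdivrMr// -[1%R]/(1%:~R%R) -intrB.
    by exists z => //; rewrite /F asboolT//; exists x.
  apply: (closed_enorm cC) => e e0.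
  have [N Ne] : exists N, (n%:R / N.+1%:R < e)%R.
    exists (Num.truncn (n%:R / e)); rewrite ltr_pdivrMr// mulrC -ltr_pdivrMr//.
    exact: Num.Theory.truncnS_gt.
  have [z _] := h N I; rewrite /F; case: asboolP => // -[y Cy Gy] Gx.
  exists y => //; apply: le_lt_trans Ne; apply: enorm_le_coord => [|i]; first by rewrite invr_ge0.
  have [] := Gx i I; have [] := Gy i I => /= y1 /negP; rewrite -ltNge => y2 x1 /negP.
  rewrite -ltNge => x2; rewrite !mxE.
  have -> : (N.+1%:R^-1 = (z i)%:~R / N.+1%:R - ((z i)%:~R - 1) / N.+1%:R :> R)%R by ring.
  move: y1 y2 x1 x2; move: ((z i)%:~R / _)%R (((z i)%:~R - 1) / _)%R => Z1 Z0 *.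
  by rewrite ler_norml; apply/andP; split; lra.
apply: bigcapT_measurable => N; apply: countable_bigcupT_measurable => [|z].
  exact: countableP.
by rewrite /F; case: ifP.
Qed.

End lebesgue_measurable.

(** * Balls and isometric involutions *)

Section balls.
Context {R : realType} (n : nat).
Local Notation mu := (@lebesgue_outer_measure R n).
Local Open Scope ereal_scope.

Lemma eball_closed (c : 'rV[R]_n) r : closed (eball c r).
Proof.
apply: enorm_closed => x h; rewrite /eball /=; apply/ler_addgt0Pr => e e0.
have [y yc yx] := h e e0.
have -> : (x - c = (y - c) + (x - y))%R by rewrite [RHS]addrC addrA subrK.
by apply: (le_trans (ler_enormD _ _)); rewrite lerD// enormB ltW.
Qed.

Lemma eball_cube : eball (0 : 'rV[R]_n) 1 `<=` cube n.
Proof.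
move=> x; rewrite /eball /= subr0 => x1 i; rewrite !mxE -ler_norml.
exact: le_trans (coord_le_enorm x i) x1.
Qed.

Lemma eball_fin : mu (eball 0%R 1%R) \is a fin_num.
Proof.
rewrite ge0_fin_numE ?outer_measure_ge0//.
by rewrite (le_lt_trans (le_outer_measure _ _ _ eball_cube))// lebesgue_cube ltry.
Qed.

Lemma box_interior_gt0 (A : set 'rV[R]_n) (x : 'rV[R]_n) : nbhs x A -> 0 < mu A.
Proof.
move=> /nbhs_enorm[e e0 eA]; pose d : R := (e / n.+1%:R)%R.
have d0 : (0 < d)%R by rewrite divr_gt0.
pose b : 'rV[R]_n := (x + const_mx d)%R.
have xb : le_row x b by move=> i; rewrite !mxE lerDl ltW.
apply: (@lt_le_trans _ _ (box_vol x b)%:E); last first.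
  apply: lebesgue_obox_ge => // y xyb; apply: eA.
  apply: (@le_lt_trans _ _ (n%:R * d)%R).
    apply: enorm_le_coord => [|i]; first exact: ltW.
    rewrite !mxE; have /andP[h1] := xyb i; rewrite !mxE => h2.
    by rewrite ger0_norm; lra.
  by rewrite /d mulrCA gtr_pMr// ltr_pdivrMr// mul1r ltr_nat.
by rewrite lte_fin; apply: prodr_gt0 => i _; rewrite !mxE; lra.
Qed.

Lemma eball_gt0 : 0 < mu (eball 0%R 1%R).
Proof.
apply: (@box_interior_gt0 _ 0%R); apply/nbhs_enorm; exists 1%R => // y /ltW.
by [].
Qed.

Lemma lebesgue_eball (r : R) : (0 < r)%R ->
  mu (eball 0%R r) = (r ^+ n)%:E * mu (eball 0%R 1%R).
Proof.
move=> r0; rewrite -lebesgue_scale//; congr (mu _); apply/seteqP; split => x.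
  rewrite /eball /= subr0 => xr; exists (r^-1 *: x)%R; last first.
    by rewrite scalerA mulfV ?gt_eqF// scale1r.
  by rewrite subr0 enormZ gtr0_norm ?invr_gt0// mulrC ler_pdivrMr// mul1r.
case=> y; rewrite /eball /= !subr0 => y1 <-.
by rewrite enormZ gtr0_norm// ger_pMr.
Qed.

(** The unit ball is mapped onto itself. If [f] enlarged the cube by a factor [c > 1], it would
    enlarge every set by at most [c]; but the ball, a part of the cube of positive measure, is not
    enlarged at all, so the cube could not reach the factor [c]. *)
Lemma lebesgue_orthogonal_le (f : {linear 'rV[R]_n -> 'rV[R]_n}) :
  involutive f -> (forall x, enorm (f x) = enorm x) ->
  forall A, mu (f @` A) <= mu A.
Proof.
move=> fK fE; pose B := eball (0 : 'rV[R]_n) 1.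
have fB : f @` B = B.
  apply/seteqP; split => [_ [x + <-]|x]; rewrite /B /eball /= ?subr0; first by rewrite fE.
  by move=> x1; exists (f x) => //; rewrite subr0 fE.
suff : mu (f @` cube n) <= (1 * 2 ^+ n)%:E.
  by move=> h A; have := lebesgue_linear_le ltr01 h A; rewrite mul1e.
rewrite mul1r leNgt; apply/negP => fQ.
have n2 : (0 < 2 ^+ n :> R)%R by rewrite exprn_gt0.
have Qfin : mu (f @` cube n) \is a fin_num.
  rewrite ge0_fin_numE ?outer_measure_ge0//.
  pose r : R := n%:R.
  have : f @` cube n `<=` box (const_mx (- r)%R) (const_mx r).
    move=> _ [x xQ <-] i; rewrite !mxE -ler_norml.
    apply: (le_trans (coord_le_enorm _ _)); rewrite fE -[leRHS]mulr1.
    apply: enorm_le_coord => // j; rewrite ler_norml.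
    by have := xQ j; rewrite !mxE.
  move=> /le_outer_measure/le_lt_trans; apply; apply: box_finite => i.
  by rewrite !mxE; have : (0 <= r)%R by []; lra.
pose q := fine (mu (f @` cube n)); pose w := fine (mu B).
have qE : mu (f @` cube n) = q%:E by rewrite fineK.
have wE : mu B = w%:E by rewrite fineK// eball_fin.
have w0 : (0 < w)%R by rewrite -lte_fin -wE eball_gt0.
move: fQ; rewrite qE lte_fin => fQ.
(* The exact factor by which the cube is enlarged, so that [lebesgue_linear_le] applies with it to
   the rest of the cube. *)
pose c := (q / 2 ^+ n)%R.
have c1 : (1 < c)%R by rewrite ltr_pdivlMr// mul1r.
have c0 : (0 < c)%R by exact: lt_trans c1.
have cq : (c * 2 ^+ n = q)%R by rewrite mulfVK// gt_eqF.
have kap : mu (f @` cube n) <= (c * 2 ^+ n)%:E by rewrite qE cq.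
have mB : mu.-caratheodory B := lebesgue_closed_measurable (@eball_closed 0%R 1%R).
have := mB (cube n); rewrite lebesgue_cube (setIidr eball_cube) wE => H.
have dfin : mu (cube n `&` ~` B) \is a fin_num.
  rewrite ge0_fin_numE ?outer_measure_ge0//.
  by rewrite (le_lt_trans (le_outer_measure _ _ _ (@subIsetl _ _ _)))// lebesgue_cube ltry.
pose d := fine (mu (cube n `&` ~` B)).
have dE : mu (cube n `&` ~` B) = d%:E by rewrite fineK.
move: H; rewrite dE -EFinD => -[H].
have : mu (f @` cube n) <= mu (f @` B) + mu (f @` (cube n `&` ~` B)).
  apply: le_trans (outer_measureU2 _ _ _); apply: le_outer_measure => _ [x xQ <-].
  by have [xB|xB] := pselect (B x); [left|right]; exists x.
rewrite fB wE qE => /le_trans/(_ (leeD2l _ (lebesgue_linear_le c0 kap _))).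
rewrite dE -EFinM -EFinD lee_fin -cq H mulrDr lerD2r.
by rewrite ger_pMl// leNgt c1.
Qed.

End balls.

Section householder.
Context {R : realType} (n : nat).

(** The reflection in the hyperplane orthogonal to [u - e]. Being an involution it is also
    self-adjoint, which spares a transpose later. *)
Lemma householder (e u : 'rV[R]_n) : enorm e = 1 -> enorm u = 1 ->
  exists f : {linear 'rV[R]_n -> 'rV[R]_n},
    [/\ involutive f, forall x y, dot (f x) (f y) = dot x y & f e = u].
Proof.
move=> e1 u1; have [->|eu] := eqVneq e u; first by exists idfun; split.
have ee : dot e e = 1 by rewrite -enorm_sqr e1 expr1n.
have uu : dot u u = 1 by rewrite -enorm_sqr u1 expr1n.
have [w wE] : exists w, w = u - e by exists (u - e).
pose c := 2 / dot w w.
have w0 : dot w w != 0 by rewrite dotxx_eq0 wE subr_eq0 eq_sym.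
pose M : 'M[R]_n := 1%:M - c *: (w^T *m w).
have ME x : x *m M = x - (c * dot x w) *: w.
  rewrite mulmxBr mulmx1 -scalemxAr mulmxA -scalerA; congr (_ - _ *: _).
  apply/rowP => j; rewrite !mxE big_ord1 !mxE; congr (_ * _).
  by apply: eq_bigr => i _; rewrite mxE.
have cw : c * dot w w = 2 by rewrite /c mulfVK.
exists (mulmxr M); split => /= [x|x y|].
- rewrite /= !ME dotBl dotZl -addrA -opprD -scalerDl.
  set k := (X in x - X *: w); have -> : k = 0.
    have -> : k = c * dot x w * (2 - c * dot w w) by rewrite /k; ring.
    by rewrite cw subrr mulr0.
  by rewrite scale0r subr0.
- rewrite /= !ME dotBl !dotBr !dotZl !dotZr (dotC w y).
  have -> : c * dot x w * (c * dot y w * dot w w) = c * dot x w * dot y w * (c * dot w w) by ring.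
  by rewrite cw; ring.
- rewrite /= ME -{1}(subrKC e u) -wE; congr (_ + _); rewrite -scaleNr -[RHS]scale1r; congr (_ *: _).
  have ww : dot w w = - 2 * dot e w.
    by rewrite wE !dotBl !dotBr ee uu (dotC u e); ring.
  have ew : dot e w != 0 by move: w0; rewrite ww mulf_eq0 negb_or => /andP[].
  by rewrite /c ww; move: (dot e w) ew => W W0; field.
Qed.

End householder.

(** * Shears do not increase the outer measure *)

Section shears.
Context {R : realType}.
Local Notation mu n := (@lebesgue_outer_measure R n).
Local Open Scope ereal_scope.

(** [S] is conjugate, through maps whose factors [a] and [a^-1] cancel, to maps [St] that take the
    cube into a box arbitrarily close to it. The factor of [S] is therefore at most the limit 1 of
    the factors of the [St]. *)
Lemma lebesgue_conj_le n (S : {linear 'rV[R]_n -> 'rV[R]_n}) (c : 'I_n -> R) :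
  (forall i, (0 <= c i)%R) ->
  (forall N : nat, exists (g St h : {linear 'rV[R]_n -> 'rV[R]_n}) (a : R),
    [/\ (0 < a)%R, forall x, S x = g (St (h x)),
      forall x i, cube n x -> (`|St x 0 i| <= 1 + c i * harmonic N)%R,
      forall A, mu n (g @` A) <= a%:E * mu n A &
      forall A, mu n (h @` A) <= a^-1%:E * mu n A]) ->
  forall A, mu n (S @` A) <= mu n A.
Proof.
move=> c0 H; suff : mu n (S @` cube n) <= (1 * 2 ^+ n)%:E.
  by move=> h A; have := lebesgue_linear_le ltr01 h A; rewrite mul1e.
have p1 : (\prod_(i < n) 1 = 1 :> R)%R by rewrite big1.
rewrite -[X in (X * _)%R]p1.
apply: (lee_cvg (u := fun N => (\prod_(i < n) (1 + c i * harmonic N)) * 2 ^+ n)%R).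
  by apply: cvgMl; exact: cvg_prodD_harmonic.
move=> N; have [g [St [h [a [a0 SE Stc gle hle]]]]] := H N.
have k0 i : (0 < 1 + c i * harmonic N :> R)%R.
  by apply: ltr_pwDl => //; apply: mulr_ge0 => //; exact: harmonic_ge0.
have Stle A : mu n (St @` A) <= (\prod_(i < n) (1 + c i * harmonic N))%R%:E * mu n A.
  apply: lebesgue_linear_le; first exact: prodr_gt0.
  pose b : 'rV[R]_n := (\row_i (1 + c i * harmonic N))%R.
  apply: (@le_trans _ _ (mu n (box (- b)%R b))).
    apply: le_outer_measure => _ [x xQ <-] i.
    by have := Stc x i xQ; rewrite ler_norml /b !mxE.
  apply: (le_trans (lebesgue_box_le _)) => [i|]; first by rewrite !mxE; have := k0 i; lra.
  rewrite lee_fin /box_vol -[X in (_ ^+ X)%R]card_ord -prodr_const.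
  rewrite [X in (_ <= _ * X)%R](eq_bigl xpredT)// -big_split/=.
  rewrite le_eqVlt; apply/orP; left; apply/eqP; apply: eq_bigr => i _; rewrite /b !mxE /=.
  by ring.
rewrite (_ : S @` cube n = g @` (St @` (h @` cube n))); last first.
  by rewrite !image_comp; apply: eq_imagel => x _; rewrite SE.
apply: (le_trans (gle _)).
apply: (@le_trans _ _ (a%:E * ((\prod_(i < n) (1 + c i * harmonic N))%R%:E *
    (a^-1%:E * (2 ^+ n)%:E)))).
  rewrite lee_wpmul2l ?lee_fin ?(ltW a0)//; apply: (le_trans (Stle _)).
  rewrite lee_wpmul2l ?lee_fin ?prodr_ge0//; first by move=> i _; exact: ltW.
  by apply: (le_trans (hle _)); rewrite lebesgue_cube.
rewrite -!EFinM lee_fin mulrCA (mulrA a) mulfV ?gt_eqF// mul1r.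
by [].
Qed.

Context {m : nat}.
Implicit Types (x : 'rV[R]_(m + 1)).


Definition scale_last (t : R) : 'M[R]_(m + 1) := block_mx 1%:M 0%R 0%R t%:M.

Definition shear_last (L : 'cV[R]_m) : 'M[R]_(m + 1) := block_mx 1%:M L 0%R 1%:M.

Definition shear_init (w : 'rV[R]_m) : 'M[R]_(m + 1) := block_mx 1%:M 0%R w 1%:M.

Lemma mul_scale_last t (y : 'rV[R]_m) (z : 'rV[R]_1) :
  row_mx y z *m scale_last t = row_mx y (t *: z)%R.
Proof. by rewrite mul_row_block !mulmx1 !mulmx0 addr0 add0r mul_mx_scalar. Qed.

Lemma mul_shear_last L (y : 'rV[R]_m) (z : 'rV[R]_1) :
  row_mx y z *m shear_last L = row_mx y (y *m L + z)%R.
Proof. by rewrite mul_row_block !mulmx1 !mulmx0 addr0. Qed.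

Lemma mul_shear_init w (y : 'rV[R]_m) (z : 'rV[R]_1) :
  row_mx y z *m shear_init w = row_mx (y + z *m w)%R z.
Proof. by rewrite mul_row_block !mulmx1 !mulmx0 add0r. Qed.

Lemma lebesgue_scale_last t A : (0 < t)%R ->
  mu (m + 1) (mulmxr (scale_last t) @` A) <= t%:E * mu (m + 1) A.
Proof.
move=> t0; apply: lebesgue_image_le => // a b ab.
apply: (@le_trans _ _ (mu _ (box (a *m scale_last t) (b *m scale_last t)))).
  apply: le_outer_measure => _ [x abx <-] i /=.
  have := abx i; rewrite -[x]hsubmxK -[a]hsubmxK -[b]hsubmxK !mul_scale_last.
  rewrite -[i]splitK; case: (fintype.split i) => j; rewrite /= ?(row_mxEl, row_mxEr) ?mxE//.
  by rewrite !ler_pM2l.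
apply: (le_trans (lebesgue_box_le _)) => [i|].
  have := ab i; rewrite -[a]hsubmxK -[b]hsubmxK !mul_scale_last.
  rewrite -[i]splitK; case: (fintype.split i) => j; rewrite /= ?(row_mxEl, row_mxEr) ?mxE//.
  by rewrite ler_pM2l.
rewrite lee_fin /box_vol -[a]hsubmxK -[b]hsubmxK !mul_scale_last !big_split_ord/= !big_ord1.
rewrite !row_mxEr !mxE -mulrBr mulrCA le_eqVlt; apply/orP; left; apply/eqP.
by congr (_ * (_ * _))%R; apply: eq_bigr => i _; rewrite !row_mxEl.
Qed.

Lemma lebesgue_shear_last L A : mu (m + 1) (mulmxr (shear_last L) @` A) <= mu (m + 1) A.
Proof.
apply: (@lebesgue_conj_le _ _ (fun=> \sum_j `|L j 0|)%R); first by move=> i; exact: sumr_ge0.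
move=> N; have t0 := @harmonic_gt0 R N; set t := harmonic N in t0 *.
(* Shrinking the last coordinate by [t] replaces the shear [L] by [t *: L]. For [shear_init] the
   last coordinate has to be stretched instead. *)
exists (mulmxr (scale_last t^-1)), (mulmxr (shear_last (t *: L))), (mulmxr (scale_last t)), t^-1%R.
split => [|x|x i xQ|B|B].
- by rewrite invr_gt0.
- rewrite -[x]hsubmxK/= mul_scale_last !mul_shear_last mul_scale_last scalerDr.
  by rewrite -scalemxAr !scalerA mulVf ?gt_eqF// !scale1r.
- have xj j : (`|x 0 j| <= 1)%R by have := xQ j; rewrite !mxE ler_norml.
  have := xj i; rewrite -[x]hsubmxK/= mul_shear_last.
  rewrite -[i]splitK; case: (fintype.split i) => j; rewrite /= ?(row_mxEl, row_mxEr).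
    by move=> /le_trans; apply; rewrite lerDl mulr_ge0 ?sumr_ge0 ?(ltW t0).
  move=> xr; rewrite mxE addrC (le_trans (ler_normD _ _))// lerD//.
  rewrite mxE (le_trans (ler_norm_sum _ _ _))// mulr_suml ler_sum// => k _.
  rewrite [in X in (_ * X)%R]mxE !normrM (gtr0_norm t0) ord1 [leRHS]mulrC -[leRHS]mul1r.
  by apply: ler_wpM2r; [rewrite mulr_ge0// ltW|rewrite mxE; exact: xj].
- by apply: lebesgue_scale_last; rewrite invr_gt0.
- by rewrite invrK; apply: lebesgue_scale_last.
Qed.

Lemma lebesgue_shear_init w A : mu (m + 1) (mulmxr (shear_init w) @` A) <= mu (m + 1) A.
Proof.
apply: (@lebesgue_conj_le _ _ (fun=> \sum_j `|w 0 j|)%R); first by move=> i; exact: sumr_ge0.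
move=> N; have t0 := @harmonic_gt0 R N; set t := harmonic N in t0 *.
exists (mulmxr (scale_last t)), (mulmxr (shear_init (t *: w))), (mulmxr (scale_last t^-1)), t.
split => [|x|x i xQ|B|B] //.
- rewrite -[x]hsubmxK/= mul_scale_last !mul_shear_init mul_scale_last.
  by rewrite -scalemxAr -scalemxAl !scalerA mulfV ?gt_eqF// !scale1r.
- have xj j : (`|x 0 j| <= 1)%R by have := xQ j; rewrite !mxE ler_norml.
  have := xj i; rewrite -[x]hsubmxK/= mul_shear_init.
  rewrite -[i]splitK; case: (fintype.split i) => j; rewrite /= ?(row_mxEl, row_mxEr); last first.
    by move=> /le_trans; apply; rewrite lerDl mulr_ge0 ?sumr_ge0 ?(ltW t0).
  move=> xl; rewrite mxE (le_trans (ler_normD _ _))// lerD//.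
  rewrite mxE big_ord1 !mxE normrM normrM (gtr0_norm t0).
  apply: (@le_trans _ _ (1 * (t * `|w 0 j|)))%R.
    by apply: ler_wpM2r; [rewrite mulr_ge0// ltW|exact: xj].
  rewrite mul1r mulrC ler_pM2r// (bigD1 j)//= lerDl; exact: sumr_ge0.
- exact: lebesgue_scale_last.
- by apply: lebesgue_scale_last; rewrite invr_gt0.
Qed.

End shears.

(** * The isodiametric inequality *)

Section discrete_brunn_minkowski.
Context {R : realType}.

(** [C] contains [A] shifted by the least element [j0] of [B], which stays at or below [i1 + j0],
    and [B] shifted by [i1.+1], which starts above. The second sum [(i + j).+1] reflects that two
    unit cells add up to an interval of length 2. *)
Lemma sumset_level (A B C : pred nat) (a b i1 j0 : nat) :
  (i1 < a)%N -> (j0 < b)%N -> A i1 -> B j0 ->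
  (forall i, (i < a)%N -> A i -> (i <= i1)%N) ->
  (forall j, (j < b)%N -> B j -> (j0 <= j)%N) ->
  (forall i j, (i < a)%N -> (j < b)%N -> A i -> B j -> C (i + j)%N /\ C (i + j).+1) ->
  (\sum_(0 <= i < a) A i + \sum_(0 <= j < b) B j <= \sum_(0 <= k < a + b) C k)%N.
Proof.
move=> i1a j0b Ai1 Bj0 Amax Bmin AB.
rewrite [leqRHS](big_cat_nat (n := (i1 + j0).+1))//=; last by lia.
apply: leq_add.
  rewrite [leqLHS](big_cat_nat (n := i1.+1))//= [X in (_ + X)%N]big1_seq ?addn0; last first.
    move=> i /=; rewrite mem_index_iota => /andP[h1 h2]; case: (boolP (A i)) => // /(Amax _ h2).
    by rewrite leqNgt h1.
  rewrite [leqRHS](big_cat_nat (n := j0))//=; last by lia.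
  apply: leq_trans (leq_addl _ _).
  rewrite -{1}[j0]add0n big_addn subSn ?leq_addl// addnK.
  rewrite big_seq [leqRHS]big_seq; apply: leq_sum => i; rewrite mem_index_iota => /= i1i.
  case: (boolP (A i)) => // Ai; rewrite lt0b.
  have ia : (i < a)%N by lia.
  by have [] := AB i j0 ia j0b Ai Bj0.
rewrite [leqLHS](big_cat_nat (n := j0))//=; last exact: ltnW.
rewrite [X in (X + _)%N]big1_seq ?add0n; last first.
  move=> j /=; rewrite mem_index_iota => /andP[_ h2]; case: (boolP (B j)) => // /(Bmin _ (ltn_trans h2 j0b)).
  by rewrite leqNgt h2.
apply: (@leq_trans (\sum_(i1.+1 + j0 <= k < i1.+1 + b) C k)); last first.
    rewrite addSn [leqRHS](big_cat_nat (n := i1.+1 + b))//=; [exact: leq_addr|lia|lia].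
  rewrite [(_ + j0)%N]addnC big_addn addKn.
  rewrite big_seq [leqRHS]big_seq; apply: leq_sum => j; rewrite mem_index_iota => /andP[_ jb].
  case: (boolP (B j)) => // Bj; rewrite lt0b addnS addnC.
  by have [] := AB i1 j i1a jb Ai1 Bj.
Qed.

(** The hypothesis on [t] says that [f] and [g] have the same positive levels reached, that is,
    equal maxima. The sums are cut into horizontal layers, each handled by [sumset_level]; the
    induction is on the number of positive values. *)
Lemma prekopa_leindler_min (a b : nat) (f g h : nat -> R) :
  (forall i, 0 <= f i) -> (forall j, 0 <= g j) -> (forall k, 0 <= h k) ->
  (forall t, 0 < t -> (exists2 i, (i < a)%N & t <= f i) <-> (exists2 j, (j < b)%N & t <= g j)) ->
  (forall i j, (i < a)%N -> (j < b)%N ->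
     Num.min (f i) (g j) <= h (i + j)%N /\ Num.min (f i) (g j) <= h (i + j).+1) ->
  \sum_(0 <= i < a) f i + \sum_(0 <= j < b) g j <= \sum_(0 <= k < a + b) h k.
Proof.
have [s] := ubnP (\sum_(0 <= i < a) (0 < f i)%R + \sum_(0 <= j < b) (0 < g j)%R)%N.
elim: s f g h => // s IH f g h sz f0 g0 h0 fg fgh.
have [[i0 i0a fi0]|fall] := pselect (exists2 i, (i < a)%N & 0 < f i); last first.
  have f00 i : (i < a)%N -> f i = 0.
    by move=> ia; apply/eqP; rewrite eq_le f0 andbT leNgt; apply/negP => fi; apply: fall; exists i.
  have g00 j : (j < b)%N -> g j = 0.
    move=> jb; apply/eqP; rewrite eq_le g0 andbT leNgt; apply/negP => gj.
    by have [_ []] := fg _ gj => [|i ia gi]; [exists j|apply: fall; exists i => //; exact: lt_le_trans gi].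
  rewrite [X in X + _]big1_seq; last by move=> i /=; rewrite mem_index_iota => /f00.
  rewrite [X in _ + X]big1_seq; last by move=> i /=; rewrite mem_index_iota => /g00.
  by rewrite addr0 sumr_ge0.
have [j0 j0b gj0] : exists2 j, (j < b)%N & 0 < g j.
  have [/(_ (ex_intro2 _ _ i0 i0a (lexx _)))[j jb fj] _] := fg _ fi0.
  by exists j => //; exact: lt_le_trans fj.
pose F (x : 'I_a + 'I_b) := match x with inl i => f i | inr j => g j end.
(* [t] is the least positive value of [f] and [g] together: the bottom layer has constant height
   [t], and removing it makes at least one more value vanish. *)
have [x /= Fx xmin] := @Order.TotalTheory.arg_minP _ _ _ (inl (Ordinal i0a)) (fun x => 0 < F x) F fi0.
pose t := F x; rewrite -/t in Fx xmin.
have tf i : (i < a)%N -> 0 < f i -> t <= f i.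
  by move=> ia fi; exact: (xmin (inl (Ordinal ia))).
have tg j : (j < b)%N -> 0 < g j -> t <= g j.
  by move=> jb gj; exact: (xmin (inr (Ordinal jb))).
pose cut (u : nat -> R) i := Num.max (u i - t) 0.
have cut0 u i : 0 <= cut u i by rewrite le_max lexx orbT.
have cutf i : (i < a)%N -> f i = cut f i + t * (0 < f i)%R%:R.
  move=> ia; rewrite /cut; have := f0 i; rewrite le_eqVlt => /predU1P[<-|fi].
    by rewrite ltxx mulr0 addr0; apply/esym/max_idPr; lra.
  by rewrite fi mulr1 (max_idPl _) ?subrK// subr_ge0 tf.
have cutg j : (j < b)%N -> g j = cut g j + t * (0 < g j)%R%:R.
  move=> jb; rewrite /cut; have := g0 j; rewrite le_eqVlt => /predU1P[<-|gj].
    by rewrite ltxx mulr0 addr0; apply/esym/max_idPr; lra.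
  by rewrite gj mulr1 (max_idPl _) ?subrK// subr_ge0 tg.
(* The cells covered by the sum of the supports of [f] and [g]; there [h] is at least [t]. *)
pose C k := [exists i : 'I_a, [exists j : 'I_b,
  [&& 0 < f i, 0 < g j & (k == i + j)%N || (k == (i + j).+1)%N]]].
have cuth k : cut h k + t * (C k)%:R <= h k.
  rewrite /cut; case: (boolP (C k)) => [/existsP[i /existsP[j /and3P[fi gj kij]]]|_].
    have [h1 h2] := fgh i j (ltn_ord i) (ltn_ord j).
    have tm : t <= Num.min (f i) (g j) by rewrite le_min tf// tg.
    have th : t <= h k by case/orP: kij => /eqP->; exact: le_trans tm _.
    by rewrite mulr1 (max_idPl _) ?subrK// subr_ge0.
  by rewrite mulr0 addr0 ge_max h0 gerBl ltW.
have lev : (\sum_(0 <= i < a) (0 < f i)%R + \sum_(0 <= j < b) (0 < g j)%R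
            <= \sum_(0 <= k < a + b) C k)%N.
  pose P i := (0 < f i) && (i < a)%N; pose Q j := (0 < g j) && (j < b)%N.
  have exP : exists i, P i by exists i0; rewrite /P fi0.
  have exQ : exists j, Q j by exists j0; rewrite /Q gj0.
  have ubP i : P i -> (i <= a)%N by case/andP => _ /ltnW.
  case: (ex_maxnP exP ubP) => i1 /andP[fi1 i1a] i1max.
  case: (ex_minnP exQ) => j1 /andP[gj1 j1b] j1min.
  apply: (@sumset_level (fun i => 0 < f i) (fun j => 0 < g j) C a b i1 j1) => //.
  - by move=> i ia fi; apply: i1max; rewrite /P fi.
  - by move=> j jb gj; apply: j1min; rewrite /Q gj.
  move=> i j ia jb fi gj; split; apply/existsP; exists (Ordinal ia);
    by apply/existsP; exists (Ordinal jb); rewrite /= fi gj eqxx ?orbT.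
have sm (u : nat -> R) i : ((0 < cut u i)%R <= (0 < u i)%R)%N.
  by rewrite /cut lt_max ltxx orbF subr_gt0; case: ltP => //= tu; rewrite (lt_trans Fx tu).
have szc : (\sum_(0 <= i < a) (0 < cut f i)%R + \sum_(0 <= j < b) (0 < cut g j)%R < s)%N.
  move: sz; rewrite ltnS; apply: leq_trans; rewrite !big_mkord.
  have smS n (u : nat -> R) (P : pred 'I_n) :
      (\sum_(i < n | P i) (0 < cut u i)%R <= \sum_(i < n | P i) (0 < u i)%R)%N.
    by apply: leq_sum => i _; exact: sm.
  have [[i ti]|[j tj]] : (exists i : 'I_a, f i = t) \/ (exists j : 'I_b, g j = t).
      by rewrite /t; case: (x) => k; [left|right]; exists k.
    rewrite (bigD1 i)//= [X in (_ < X + _)%N](bigD1 i)//= ti Fx {1}/cut ti subrr maxxx ltxx add0n add1n.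
    by rewrite ltnS leq_add// smS.
  rewrite addnC [ltnRHS]addnC (bigD1 j)//= [X in (_ < X + _)%N](bigD1 j)//= tj Fx {1}/cut tj subrr maxxx ltxx add0n add1n.
  by rewrite ltnS leq_add// smS.
have hyp r : 0 < r -> (exists2 i, (i < a)%N & r <= cut f i) <-> (exists2 j, (j < b)%N & r <= cut g j).
  move=> r0; have cutP u i : (r <= cut u i) = (r + t <= u i).
    by rewrite /cut le_max [r <= 0]leNgt r0 orbF lerBrDr.
  have rt0 : 0 < r + t by rewrite addr_gt0.
  by split=> -[k kb]; rewrite cutP => h'; have [h1 h2] := fg _ rt0;
    [have [|j jb gj] := h1|have [|j jb gj] := h2]; try (by exists k);
    exists j => //; rewrite cutP.
have hyp2 i j : (i < a)%N -> (j < b)%N -> Num.min (cut f i) (cut g j) <= cut h (i + j)%N /\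
    Num.min (cut f i) (cut g j) <= cut h (i + j).+1.
  move=> ia jb; have cutm u v w : Num.min u v <= w ->
      Num.min (Num.max (u - t) 0) (Num.max (v - t) 0) <= Num.max (w - t) 0.
    move=> uvw; rewrite ge_min; apply/orP; move: uvw; have [uv|vu] := leP u v => uw.
      by left; rewrite ge_max !le_max lexx orbT andbT lerD2r uw.
    by right; rewrite ge_max !le_max lexx orbT andbT lerD2r uw.
  by have [h1 h2] := fgh i j ia jb; split; apply: cutm.
have := IH (cut f) (cut g) (cut h) szc (cut0 f) (cut0 g) (cut0 h) hyp hyp2 => IHc.
have levR : t * (\sum_(0 <= i < a) (0 < f i)%R + \sum_(0 <= j < b) (0 < g j)%R)%N%:R
    <= t * (\sum_(0 <= k < a + b) C k)%N%:R by rewrite ler_pM2l// ler_nat.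
have Ef : \sum_(0 <= i < a) f i = \sum_(0 <= i < a) cut f i + t * (\sum_(0 <= i < a) (0 < f i)%R)%N%:R.
  rewrite natr_sum mulr_sumr -big_split/=; apply: eq_big_nat => i /andP[_ ia]; exact: cutf.
have Eg : \sum_(0 <= i < b) g i = \sum_(0 <= i < b) cut g i + t * (\sum_(0 <= i < b) (0 < g i)%R)%N%:R.
  rewrite natr_sum mulr_sumr -big_split/=; apply: eq_big_nat => i /andP[_ ib]; exact: cutg.
have Eh : \sum_(0 <= k < a + b) cut h k + t * (\sum_(0 <= k < a + b) C k)%N%:R <= \sum_(0 <= k < a + b) h k.
  by rewrite natr_sum mulr_sumr -big_split/=; apply: ler_sum => k _; exact: cuth.
move: levR; rewrite natrD mulrDr; move: IHc Eh; rewrite Ef Eg; lra.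
Qed.

End discrete_brunn_minkowski.

Section discrete_prekopa_leindler.
Context {R : realType}.

(** Divide [f] and [g] by their maxima [F] and [G], and [h] by [s = sqrt (F G)]. Since a minimum is
    below the geometric mean, [prekopa_leindler_min] bounds the sum of the two normalised totals,
    and the 4 is that of [4 x y <= (x + y)^2]. *)
Lemma prekopa_leindler1 (N : nat) (f g h : nat -> R) :
  (forall i, 0 <= f i) -> (forall j, 0 <= g j) -> (forall k, 0 <= h k) ->
  (forall i j, (i < N)%N -> (j < N)%N ->
     f i * g j <= h (i + j)%N ^+ 2 /\ f i * g j <= h (i + j).+1 ^+ 2) ->
  4 * ((\sum_(0 <= i < N) f i) * (\sum_(0 <= j < N) g j)) <= (\sum_(0 <= k < N + N) h k) ^+ 2.
Proof.
move=> f0 g0 h0 fgh.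
have mx (u : nat -> R) : (forall i, 0 <= u i) -> \sum_(0 <= i < N) u i = 0 \/
    exists i0, [/\ (i0 < N)%N, 0 < u i0 & forall i, (i < N)%N -> u i <= u i0].
  move=> u0; have [->|N0] := posnP N; first by left; rewrite big_geq.
  have [i0 _ imax] := @Order.TotalTheory.arg_maxP _ _ _ (Ordinal N0) xpredT (fun i : 'I_N => u i) isT.
  have {}imax i : (i < N)%N -> u i <= u i0 by move=> iM; exact: (imax (Ordinal iM)).
  have := u0 i0; rewrite le_eqVlt => /predU1P[ui0|ui0]; [left|by right; exists i0; split].
  rewrite big1_seq// => i /=; rewrite mem_index_iota => /= iM.
  by apply/eqP; rewrite eq_le u0 andbT ui0; exact: imax.
have [->|[i0 [i0N fi0 fmax]]] := mx f f0; first by rewrite mul0r mulr0 sqr_ge0.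
have [->|[j0 [j0N gj0 gmax]]] := mx g g0; first by rewrite !mulr0 sqr_ge0.
set F := f i0 in fi0 fmax; set G := g j0 in gj0 gmax.
pose s := Num.sqrt (F * G).
have s0 : 0 < s by rewrite sqrtr_gt0 mulr_gt0.
have s2 : s ^+ 2 = F * G by rewrite sqr_sqrtr// mulr_ge0// ltW.
have minP x y z : 0 <= x -> 0 <= y -> 0 <= z -> x * y <= z ^+ 2 -> Num.min (x / F) (y / G) <= z / s.
  move=> x0 y0 z0 xyz; have xF : 0 <= x / F by rewrite divr_ge0// ltW.
  have yG : 0 <= y / G by rewrite divr_ge0// ltW.
  have m0 : 0 <= Num.min (x / F) (y / G) by rewrite le_min xF.
  have zs : 0 <= z / s by rewrite divr_ge0// ltW.
  rewrite -ler_sqr ?nnegrE//.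
  apply: (@le_trans _ _ ((x / F) * (y / G))).
    by rewrite expr2; apply: ler_pM => //; rewrite ge_min lexx ?orbT.
  rewrite expr_div_n s2 mulrACA -invfM; apply: ler_wpM2r => //.
  by rewrite invr_ge0 mulr_ge0// ltW.
have := @prekopa_leindler_min R N N (fun i => f i / F) (fun j => g j / G) (fun k => h k / s).
rewrite -!mulr_suml; set Sf := \sum_(0 <= i < N) f i; set Sg := \sum_(0 <= i < N) g i.
set Sh := \sum_(0 <= k < N + N) h k.
have pos (u : nat -> R) c i : (forall i, 0 <= u i) -> 0 < c -> 0 <= u i / c.
  by move=> u0 c0; rewrite divr_ge0// ltW.
move=> /(_ (fun i => pos f F i f0 fi0) (fun i => pos g G i g0 gj0) (fun i => pos h s i h0 s0)) H.
have {}H : Sf / F + Sg / G <= Sh / s.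
  apply: H => [t t0|i j iN jN].
    split=> [[i iN ti]|[j jN tj]]; [exists j0 => //|exists i0 => //].
      by apply: (le_trans ti); rewrite divff ?gt_eqF// ler_pdivrMr// mul1r fmax.
    by apply: (le_trans tj); rewrite divff ?gt_eqF// ler_pdivrMr// mul1r gmax.
  by have [h1 h2] := fgh i j iN jN; split; apply: minP.
have Sf0 : 0 <= Sf by rewrite sumr_ge0.
have Sg0 : 0 <= Sg by rewrite sumr_ge0.
have Sh0 : 0 <= Sh by rewrite sumr_ge0.
have : (Sf / F + Sg / G) ^+ 2 <= (Sh / s) ^+ 2.
  have q1 : 0 <= Sf / F by rewrite divr_ge0// ltW.
  have q2 : 0 <= Sg / G by rewrite divr_ge0// ltW.
  have q3 : 0 <= Sh / s by rewrite divr_ge0// ltW.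
  by rewrite ler_sqr ?nnegrE ?addr_ge0.
rewrite expr_div_n s2 ler_pdivlMr ?mulr_gt0//; apply: le_trans.
have -> : Sf * Sg = (Sf / F) * (Sg / G) * (F * G) by field; rewrite !gt_eqF.
rewrite mulrA ler_pM2r ?mulr_gt0//.
move: (Sf / F) (Sg / G) => x y; have := sqr_ge0 (x - y); rewrite !expr2; lra.
Qed.

(** The sum of the cells of indices [x] and [y] consists of the cells [x + y + e], where each digit
    of [e] is 0 or 1. *)
Fixpoint add_digits (x y e : seq nat) : seq nat :=
  match x, y, e with
  | i :: x', j :: y', k :: e' => (i + j + k)%N :: add_digits x' y' e'
  | _, _, _ => [::]
  end.

Lemma nth_add_digits x y e i : size x = size y -> size x = size e ->
  nth 0%N (add_digits x y e) i = (nth 0%N x i + nth 0%N y i + nth 0%N e i)%N.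
Proof.
elim: x y e i => [|a x IH] [|b y] [|c e]//= [|i]//= [xy] [xe].
exact: IH.
Qed.

Lemma sum_grid_cons k ks (F : seq nat -> R) :
  \sum_(s <- grid (k :: ks)) F s = \sum_(0 <= j < k) \sum_(s <- grid ks) F (j :: s).
Proof. by rewrite /= big_allpairs_dep /index_iota subn0. Qed.

(** Induction on the dimension: the inequality for the slices, with fixed first digits, is the
    hypothesis of [prekopa_leindler1] for the slice sums, the constant [(2 ^+ m) ^+ 2] being put
    into [g]. *)
Lemma prekopa_leindler (m N : nat) (f g h : seq nat -> R) :
  (forall i, 0 <= f i) -> (forall j, 0 <= g j) -> (forall k, 0 <= h k) ->
  (forall x y e, x \in grid (nseq m N) -> y \in grid (nseq m N) -> e \in grid (nseq m 2%N) ->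
     f x * g y <= h (add_digits x y e) ^+ 2) ->
  (2 ^+ m) ^+ 2 * ((\sum_(x <- grid (nseq m N)) f x) * (\sum_(y <- grid (nseq m N)) g y))
    <= (\sum_(z <- grid (nseq m (N + N))) h z) ^+ 2.
Proof.
elim: m f g h => [|m IH] f g h f0 g0 h0 fgh.
  by rewrite !big_seq1 !expr1n mul1r; exact: (fgh [::] [::] [::]).
rewrite ![nseq m.+1 _]/= !sum_grid_cons.
have := @prekopa_leindler1 N (fun i => \sum_(s <- grid (nseq m N)) f (i :: s))
  (fun j => (2 ^+ m) ^+ 2 * \sum_(s <- grid (nseq m N)) g (j :: s))
  (fun k => \sum_(s <- grid (nseq m (N + N))) h (k :: s)).
rewrite -mulr_sumr => H; apply: le_trans (H _ _ _ _) => [|i|j|k|i j iN jN].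
- by rewrite (exprS 2 m) exprMn le_eqVlt; apply/orP; left; apply/eqP; ring.
- by rewrite sumr_ge0.
- by rewrite mulr_ge0 ?sqr_ge0 ?sumr_ge0.
- by rewrite sumr_ge0.
rewrite mulrCA; split.
  apply: IH => // x y e xN yN e2.
  have := fgh (i :: x) (j :: y) (0%N :: e).
  by rewrite !mem_grid/= iN jN -!mem_grid xN yN e2 addn0; apply.
apply: IH => // x y e xN yN e2.
have := fgh (i :: x) (j :: y) (1%N :: e).
by rewrite !mem_grid/= iN jN -!mem_grid xN yN e2 addn1; apply.
Qed.

End discrete_prekopa_leindler.

Lemma nth_grid_lt m k x i : x \in grid (nseq m k) -> (i < m)%N -> (nth 0%N x i < k)%N.
Proof.
rewrite mem_grid; elim: m x i => [|m IH] [|j x] [|i]//= /andP[// jk xm] im.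
exact: IH.
Qed.

Section isodiametric.
Context {R : realType} (m : nat).
Local Notation mu := (@lebesgue_outer_measure R m).
Local Open Scope ereal_scope.

Definition grid_cell (o : 'rV[R]_m) (d : R) (s : seq nat) : set 'rV[R]_m :=
  [set y | forall i, (o 0 i + d * (nth 0%N s i)%:R <= y 0 i <= o 0 i + d * (nth 0%N s i).+1%:R)%R].

Definition meets_cell (B : set 'rV[R]_m) o d s : bool :=
  `[< exists2 y, B y & grid_cell o d s y >].

Lemma grid_cell_cover (B : set 'rV[R]_m) (o : 'rV[R]_m) (d D : R) (N : nat) :
  (0 < d)%R -> (D < d * N%:R)%R ->
  (forall y, B y -> forall i, (o 0 i <= y 0 i <= o 0 i + D)%R) ->
  mu B <= (\sum_(s <- grid (nseq m N)) (meets_cell B o d s)%:R * d ^+ m)%R%:E.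
Proof.
move=> d0 DN oB; pose F s := if meets_cell B o d s then grid_cell o d s else set0.
have BF : B `<=` \big[setU/set0]_(s <- grid (nseq m N)) F s.
  move=> y By; pose f (i : 'I_m) := Num.truncn ((y 0%R i - o 0%R i) / d).
  have fi (i : 'I_m) : ((f i)%:R <= (y 0 i - o 0 i) / d < (f i).+1%:R)%R.
    apply: Num.Theory.truncn_itv; rewrite divr_ge0 ?(ltW d0)// subr_ge0.
    by have /andP[] := oB _ By i.
  have fc : grid_cell o d [seq f i | i <- enum 'I_m] y.
    move=> i; rewrite nth_enum_map; have /andP[] := fi i.
    rewrite ler_pdivlMr// ltr_pdivrMr// ![(_ * d)%R]mulrC => h1 h2; lra.
  rewrite -bigcup_seq; exists [seq f i | i <- enum 'I_m]; last first.
    by rewrite /F /meets_cell asboolT//; exists y.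
  rewrite /= (_ : nseq m N = [seq N | _ <- enum 'I_m]); last first.
    by rewrite -[m in LHS]size_enum_ord; elim: (enum 'I_m) => //= _ s ->.
  apply: grid_map => i; have /andP[+ _] := fi i; rewrite ler_pdivlMr// => h.
  rewrite -(ltr_nat R) -(ltr_pM2r d0); apply: (le_lt_trans h).
  by have /andP[_] := oB _ By i; move: DN; rewrite [(d * _)%R]mulrC; lra.
apply: (le_trans (le_outer_measure _ _ _ BF)); apply: (le_trans (outer_measure_seqU _ _ _)).
rewrite -sumEFin; apply: lee_sum => s _; rewrite /F; case: ifP => _; last first.
  by rewrite outer_measure0 mul0r.
pose a : 'rV[R]_m := (\row_i (o 0 i + d * (nth 0%N s i)%:R))%R.
pose b : 'rV[R]_m := (\row_i (o 0 i + d * (nth 0%N s i).+1%:R))%R.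
have ab : le_row a b by move=> i; rewrite !mxE lerD2l ler_pM2l// ler_nat.
rewrite (_ : grid_cell o d s = box a b); last first.
  by apply/seteqP; split => y h i; have := h i; rewrite !mxE.
apply: (le_trans (lebesgue_box_le ab)); rewrite lee_fin mul1r /box_vol.
rewrite (eq_bigr (fun=> d)) ?prodr_const ?card_ord// => i _.
by rewrite !mxE -natr1; ring.
Qed.

(** The set [(A - A) / 2] lies in the ball of radius [D / 2] and, as in the Brunn-Minkowski
    inequality, is at least as large as [A]. In the discrete form, cells of side [d] meeting [A] and
    [- A] produce cells of side [d / 2] within [m d] of [(A - A) / 2], hence the enlarged radius. *)
Lemma isodiametric_approx (A : set 'rV[R]_m) (D d : R) : (0 <= D)%R -> (0 < d)%R ->
  (forall x y, A x -> A y -> (enorm (x - y) <= D)%R) ->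
  mu A <= ((D / 2 + m.+1%:R * d) ^+ m)%:E * mu (eball 0%R 1%R).
Proof.
move=> D0 d0 AD; have [->|/set0P[a Aa]] := eqVneq A set0.
  rewrite outer_measure0 mule_ge0 ?outer_measure_ge0// lee_fin exprn_ge0// addr_ge0//.
    by rewrite divr_ge0.
  by rewrite mulr_ge0// ltW.
set rho := (D / 2 + m.+1%:R * d)%R.
have rho0 : (0 < rho)%R by rewrite ltr_wpDl ?divr_ge0// mulr_gt0.
pose A' := [set - x | x in A]%R.
pose N := (Num.truncn (2 * D / d)).+1.
have DN : (2 * D < d * N%:R)%R by rewrite [ltRHS]mulrC -ltr_pdivrMr//; exact: Num.Theory.truncnS_gt.
pose o : 'rV[R]_m := (a - const_mx D)%R; pose o' : 'rV[R]_m := (- a - const_mx D)%R.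
have oA y : A y -> forall i, (o 0 i <= y 0 i <= o 0 i + 2 * D)%R.
  move=> Ay i; have := le_trans (coord_le_enorm (y - a) i) (AD _ _ Ay Aa).
  by rewrite !mxE ler_norml => /andP[h1 h2]; apply/andP; split; lra.
have oA' y : A' y -> forall i, (o' 0 i <= y 0 i <= o' 0 i + 2 * D)%R.
  case=> x Ax <- i; have := le_trans (coord_le_enorm (x - a) i) (AD _ _ Ax Aa).
  by rewrite !mxE ler_norml => /andP[h1 h2]; apply/andP; split; lra.
have cA := grid_cell_cover d0 DN oA.
have cA' := grid_cell_cover d0 DN oA'.
have AA' : mu A <= mu A'.
  have := @lebesgue_orthogonal_le R m (-%R) (@opprK _) (@enormN _ _) A'.
  rewrite image_comp (_ : _ @` A = A)//.
  by rewrite -[RHS]image_id; apply: eq_imagel => x _; rewrite /= opprK.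
pose f s : R := (meets_cell A o d s)%:R%R; pose g s : R := (meets_cell A' o' d s)%:R%R.
pose W z := `[< exists x y e, [/\ x \in grid (nseq m N), y \in grid (nseq m N),
  e \in grid (nseq m 2%N) & [/\ meets_cell A o d x, meets_cell A' o' d y & z = add_digits x y e]] >].
have PL : ((2 ^+ m) ^+ 2 * ((\sum_(x <- grid (nseq m N)) f x) * (\sum_(y <- grid (nseq m N)) g y))
    <= (\sum_(z <- grid (nseq m (N + N)%N)) (W z)%:R) ^+ 2)%R.
  apply: prekopa_leindler => // x y e xN yN e2; rewrite /f /g.
  case: (boolP (meets_cell A o d x)) => Ax; last by rewrite mul0r sqr_ge0.
  case: (boolP (meets_cell A' o' d y)) => Ay; last by rewrite mulr0 sqr_ge0.
  by rewrite /W asboolT ?mulr1 ?expr1n//; exists x, y, e.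
(* The half sum of the origins [o] and [o'] is the constant vector [- D], so halving the sum of two
   cells of side [d] gives cells of side [d / 2] in the grid based there. *)
pose p z : 'rV[R]_m := (\row_i (- D + d / 2 * (nth 0%N z i)%:R))%R.
pose q z : 'rV[R]_m := (\row_i (- D + d / 2 * (nth 0%N z i).+1%:R))%R.
have pq z : le_row (p z) (q z) by move=> i; rewrite !mxE lerD2l ler_pM2l ?ler_nat// divr_gt0.
have sz k x : x \in grid (nseq m k) -> size x = m.
  rewrite mem_grid; elim: (m) x => [|j IH] [|c x]//= /andP[_ h]; by rewrite IH.
have d20 : (0 < d / 2)%R by rewrite divr_gt0.
have := @lebesgue_disjoint_boxes R m _ [seq z <- grid (nseq m (N + N)%N) | W z] p q (eball 0%R rho).
rewrite filter_uniq ?uniq_grid// => /(_ isT pq) H.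
have {}H : (\sum_(z <- grid (nseq m (N + N)%N) | W z) (d / 2) ^+ m)%R%:E <= mu (eball 0%R rho).
  rewrite (eq_bigr (fun z => box_vol (p z) (q z))); last first.
    move=> z _; rewrite /box_vol (eq_bigr (fun=> (d / 2)%R)) ?prodr_const ?card_ord// => i _.
    by rewrite !mxE -natr1; ring.
  rewrite -big_filter; apply: H => [z z' x|z].
    rewrite !mem_filter => /andP[_ /sz zm] /andP[_ /sz zm'] h h'.
    apply: (@eq_from_nth _ 0%N) => [|i]; first by rewrite zm.
    rewrite zm => im; have := h (Ordinal im); have := h' (Ordinal im).
    rewrite !mxE /= => /andP[h1 h2] /andP[h3 h4].
    apply/eqP; rewrite eqn_leq; apply/andP; split;
      rewrite -ltnS -(ltr_nat R) -(ltr_pM2l d20); lra.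
  rewrite mem_filter => /andP[/asboolP[x [y [e [xN yN e2 [Ax Ay ->]]]]] _] w wpq.
  have [u Au ux] := asboolW Ax; have [u' [v Av vu'] uy] := asboolW Ay.
  have szx := sz _ _ xN; have szy := sz _ _ yN; have sze := sz _ _ e2.
  rewrite /eball /= subr0 (_ : w = 2^-1 *: (u - v) + (w - 2^-1 *: (u - v)))%R; last first.
    by rewrite addrC subrK.
  apply: (le_trans (ler_enormD _ _)); rewrite /rho lerD//.
    by rewrite enormZ ger0_norm ?invr_ge0// mulrC ler_pM2r ?invr_gt0// AD.
  apply: (@le_trans _ _ (m%:R * d)%R); last by rewrite ler_pM2r// ler_nat.
  apply: enorm_le_coord => [|i]; first exact: ltW.
  have := wpq i; have := ux i; have := uy i; rewrite -vu' !mxE nth_add_digits ?szx//.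
  have S1 k : (k.+1%:R = k%:R + 1 :> R)%R by rewrite natr1.
  rewrite (S1 (nth _ x i)) (S1 (nth _ y i)) (S1 (_ + _)%N) !natrD => /andP[h1 h2] /andP[h3 h4] /andP[h5 h6].
  have e1R : (0 <= ((nth 0%N e i)%:R : R) <= 1)%R.
    by rewrite ler0n -[1%R]/(1%:R)%R ler_nat -ltnS (nth_grid_lt e2).
  move: e1R h1 h2 h3 h4 h5 h6.
  move: (nth _ x i)%:R%R (nth _ y i)%:R%R (nth _ e i)%:R%R => X Y E /andP[E0 E1].
  have dE0 : (0 <= d * E)%R by rewrite mulr_ge0// ltW.
  have dE1 : (d * E <= d)%R by rewrite ler_piMr// ltW.
  by rewrite ler_norml => *; apply/andP; split; lra.
move: H; rewrite lebesgue_eball// => /(le_trans _); apply.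
have Afin : mu A \is a fin_num.
  by rewrite ge0_fin_numE ?outer_measure_ge0// (le_lt_trans cA)// ltry.
move: (cA) (le_trans AA' cA'); rewrite -(fineK Afin) !lee_fin -!mulr_suml.
have -> : (\sum_(z <- grid (nseq m (N + N)%N) | W z) (d / 2) ^+ m =
    (\sum_(z <- grid (nseq m (N + N)%N)) (W z)%:R) * (d / 2) ^+ m)%R.
  rewrite mulr_suml [LHS]big_mkcond/=; apply: eq_bigr => z _.
  by case: (W z); rewrite ?mul1r ?mul0r.
move: PL; rewrite /f /g; set SA := (\sum_(x <- _) (meets_cell A o d x)%:R)%R.
set SA' := (\sum_(x <- _) (meets_cell A' o' d x)%:R)%R.
set SW := (\sum_(z <- _) _)%R; rewrite expr_div_n.
have SA0 : (0 <= SA)%R by rewrite sumr_ge0.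
have SA'0 : (0 <= SA')%R by rewrite sumr_ge0.
have SW0 : (0 <= SW)%R by rewrite sumr_ge0.
have : (0 < d ^+ m)%R by rewrite exprn_gt0.
have : (0 < 2 ^+ m :> R)%R by rewrite exprn_gt0.
have : (0 <= fine (mu A))%R by rewrite fine_ge0// outer_measure_ge0.
move: (fine _) (d ^+ m)%R (2 ^+ m)%R => x e t x0 t0 e0 PL xA xA'.
have xe : (0 <= x / e)%R by apply: divr_ge0 => //; exact: ltW.
(* Here [x] is the measure of [A], [e = d^m] and [t = 2^m]; both counts of cells are at least
   [x / e]. *)
have : ((t * (x / e)) ^+ 2 <= SW ^+ 2)%R.
  apply: le_trans PL; rewrite exprMn ler_pM2l ?exprn_gt0// expr2.
  by apply: ler_pM => //; rewrite ler_pdivrMr.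
have txe : (0 <= t * (x / e))%R by apply: mulr_ge0 => //; exact: ltW.
rewrite ler_sqr ?nnegrE// => H.
have -> : (x = (t * (x / e)) * (e / t))%R by field; rewrite !gt_eqF.
by rewrite ler_pM2r ?divr_gt0.
Qed.

Theorem isodiametric (A : set 'rV[R]_m) (D : R) : (0 <= D)%R ->
  (forall x y, A x -> A y -> (enorm (x - y) <= D)%R) ->
  mu A <= ((D / 2) ^+ m)%:E * mu (eball 0%R 1%R).
Proof.
move=> D0 AD; rewrite -(fineK (eball_fin m)) -EFinM.
apply: (lee_cvg (u := fun N =>
  (D / 2 + m.+1%:R * harmonic N) ^+ m * fine (mu (eball 0%R 1%R)))%R).
  apply: cvgMr_tmp; have := @cvg_prodD_harmonic R m (fun=> D / 2)%R (fun=> m.+1%:R%R).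
  by under eq_fun do rewrite prodr_const card_ord; rewrite prodr_const card_ord.
move=> N; rewrite EFinM fineK ?eball_fin//.
exact: (isodiametric_approx D0 (@harmonic_gt0 R N) AD).
Qed.

End isodiametric.

(** * Hausdorff measure *)

Section caratheodory_criterion.
Context {R : realType} (n : nat) (nu : {outer_measure set 'rV[R]_n -> \bar R}).
Local Open Scope ereal_scope.

(** The defining property of a metric outer measure. *)
Definition separated_additive := forall (A B : set 'rV[R]_n) (r : R), (0 < r)%R ->
  (forall a b, A a -> B b -> (r <= enorm (a - b))%R) -> nu A + nu B <= nu (A `|` B).

(** Caratheodory's criterion. The points of [X] off [C] are exhausted by the sets [Y k] at distance
    at least [1/(k+1)] from [C]. Shells [Y k.+1 \ Y k] of equal parity are separated from each
    other, so the measures of all shells add up to at most [3 nu X]; the tail of this series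
    controls what is missed by [Y N]. *)
Lemma caratheodory_closed (C : set 'rV[R]_n) : separated_additive -> closed C ->
  nu.-caratheodory C.
Proof.
move=> sep cC; apply: le_caratheodory_measurable => X.
have [->|Xoo] := eqVneq (nu X) +oo; first by rewrite leey.
have Xfin : nu X \is a fin_num by rewrite ge0_fin_numE ?outer_measure_ge0// ltey.
pose Y k := [set x | X x /\ forall c, C c -> (harmonic k <= enorm (x - c))%R].
have harm_le j k : (j <= k)%N -> (harmonic k <= harmonic j :> R)%R.
  by move=> jk; rewrite /harmonic lef_pV2 ?posrE// ler_nat.
have harm_lt k : (harmonic k.+1 < harmonic k :> R)%R.
  by rewrite /harmonic ltf_pV2 ?posrE// ltr_nat.
have Yle j k : (j <= k)%N -> Y j `<=` Y k.
  by move=> jk x [Xx h]; split => // c /h; apply: le_trans; exact: harm_le.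
have YX k : Y k `<=` X by move=> x [].
pose s k := nu (Y k.+1 `\` Y k).
have s0 k : 0 <= s k by exact: outer_measure_ge0.
have skip k : nu (Y k) + s k.+1 <= nu (Y k.+2).
  apply: (@le_trans _ _ (nu (Y k `|` (Y k.+2 `\` Y k.+1)))).
    apply: (@sep _ _ (harmonic k - harmonic k.+1)%R); first by rewrite subr_gt0.
    move=> a b [Xa ha] [[Xb _] nb].
    have [c Cc bc] : exists2 c, C c & (enorm (b - c) < harmonic k.+1)%R.
      apply: contra_notP nb => h; split => // c Cc; rewrite leNgt; apply/negP => bc.
      by apply: h; exists c.
    have := ha _ Cc; have -> : (a - c = (a - b) + (b - c))%R by rewrite addrA subrK.
    by move=> /le_trans/(_ (ler_enormD _ _)); lra.
  apply: le_outer_measure => x [/Yle|[]//]; apply.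
  by rewrite ltnW.
have evens e J : \sum_(j < J) s (2 * j + e).+1%N <= nu (Y (2 * J + e)%N).
  elim: J => [|J IH]; first by rewrite big_ord0 outer_measure_ge0.
  rewrite big_ord_recr/= mulnS -addnA add2n; apply: le_trans (skip _).
  exact: leeD2r.
have part J : \sum_(k < (2 * J).+1) s k =
    s 0%N + (\sum_(j < J) s (2 * j + 0).+1%N + \sum_(j < J) s (2 * j + 1).+1%N).
  elim: J => [|J IH]; first by rewrite !big_ord0 muln0 big_ord1 !adde0.
  rewrite mulnS 2!big_ord_recr/= IH !big_ord_recr/= -!addeA; congr (_ + (_ + _)).
  rewrite [RHS]addeCA addn0 addn1; congr (_ + (_ + _)).
have sfin : \sum_(k <oo) s k < +oo.
  apply: (@le_lt_trans _ _ (nu X + (nu X + nu X))); last by rewrite !lte_add_pinfty// ltey.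
  apply: lime_le; first exact: is_cvg_nneseries.
  apply: nearW => J; rewrite big_mkord.
  apply: (@le_trans _ _ (\sum_(k < (2 * J).+1) s k)).
    rewrite -!(big_mkord xpredT s); apply: lee_sum_nneg_natr => //.
    by lia.
  have sX k : nu (Y k) <= nu X by apply: le_outer_measure.
  rewrite part; apply: leeD; last by apply: leeD; apply: le_trans (evens _ _) (sX _).
  by apply: le_outer_measure => x [[]].
have tail := @nneseries_tail_cvg _ _ xpredT sfin (fun k _ => s0 k).
apply/lee_addgt0Pr => e e0.
have [N Ne] : exists N, \sum_(N <= k <oo) s k <= e%:E.
  have : \forall N \near \oo, \sum_(N <= k <oo) s k < e%:E.
    apply: (tail [set x | x < e%:E]); apply: open_nbhs_nbhs; split; last by rewrite /= lte_fin.
    exact: open_ereal_lt_ereal.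
  by move=> [N _ /(_ N (leqnn N))/= /ltW h]; exists N.
have XC : X `&` ~` C `<=` Y N `|` \bigcup_(k in ~` `I_N) (Y k.+1 `\` Y k).
  move=> x [Xx nCx].
  have [e' e'0 xe] : exists2 e', (0 < e')%R & forall c, C c -> (e' <= enorm (x - c))%R.
    apply: contra_notP nCx => h; apply: (closed_enorm cC) => e' e'0.
    apply: contrapT => h'; apply: h; exists e' => // c Cc; rewrite leNgt; apply/negP => xc.
    by apply: h'; exists c => //; rewrite enormB.
  have [M Mx] : exists M, Y M x.
    exists (Num.truncn e'^-1); split => // c /xe; apply: le_trans.
    rewrite /harmonic -[leRHS]invrK lef_pV2 ?posrE ?invr_gt0//.
    by apply: ltW; exact: Num.Theory.truncnS_gt.
  have [YN|YN] := pselect (Y N x); [by left|right].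
  have [k [kM Nk h1 h2]] : exists k, [/\ (k <= M)%N, (N <= k)%N, Y k.+1 x & ~ Y k x].
    elim: M Mx => [|M IH] Mx; first by exfalso; apply: YN; exact: Yle Mx.
    have [/IH[k [kM Nk h1 h2]]|YM] := pselect (Y M x).
      by exists k; split => //; exact: leqW.
    exists M; split => //; rewrite leqNgt; apply/negP => MN; apply: YN.
    exact: Yle Mx.
  by exists k => //=; apply/negP; rewrite -leqNgt.
apply: (@le_trans _ _ (nu (X `&` C) + (nu (Y N) + e%:E))).
  apply: leeD2l; apply: (le_trans (le_outer_measure _ _ _ XC)).
  apply: (le_trans (outer_measureU2 _ _ _)); apply: leeD2l.
  apply: (le_trans _ Ne); exact: outer_measure_sigma_subadditive_tail.
rewrite addeA leeD2r//; apply: (le_trans (@sep _ _ (harmonic N) (@harmonic_gt0 R N) _)).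
  by move=> a b [_ Ca] [_ h]; rewrite enormB; exact: h.
by apply: le_outer_measure => x [[]|[]].
Qed.

End caratheodory_criterion.

Section hausdorff_measurable.
Context {R : realType} (n m : nat).
Local Open Scope ereal_scope.
Implicit Types U V : set 'rV[R]_n.

Lemma lee_expe (x y : \bar R) k : 0 <= x -> x <= y -> x ^+ k <= y ^+ k.
Proof.
move=> x0 xy; elim: k => [|k IH]; first by rewrite !expe0.
by rewrite !expeS; apply: lee_pmul => //; exact: expe_ge0.
Qed.

Lemma le_diam U V : U `<=` V -> diam U <= diam V.
Proof. by move=> UV; apply: le_ereal_sup => _ [[x y] [/= Ux Uy] <-]; exists (x, y) => //=; split; exact: UV. Qed.

Lemma enorm_le_diam U x y : U x -> U y -> (enorm (x - y))%:E <= diam U.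
Proof. by move=> Ux Uy; apply: ereal_sup_ubound; exists (x, y). Qed.

Lemma diam_nonneg U : U !=set0 -> 0 <= diam U.
Proof.
by move=> [y Uy]; apply: le_trans (enorm_le_diam Uy Uy); rewrite lee_fin enorm_ge0.
Qed.

Lemma hausdorff_gauge_nonneg (d : R) U : 0 <= hausdorff_gauge m d U.
Proof.
rewrite /hausdorff_gauge; case: ifPn => // /set0P U0; case: ifP => // _.
by rewrite mule_ge0 ?expe_ge0// mule_ge0 ?diam_nonneg// lee_fin invr_ge0.
Qed.

Lemma hausdorff_gauge_le (d d' : R) U V : (d' <= d)%R -> U `<=` V ->
  hausdorff_gauge m d U <= hausdorff_gauge m d' V.
Proof.
move=> dd UV; rewrite {1}/hausdorff_gauge; case: ifPn => [_|/set0P U0].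
  exact: hausdorff_gauge_nonneg.
have V0 : V !=set0 by case: U0 => x /UV; exists x.
rewrite [leRHS]/hausdorff_gauge [leRHS]ifF; last by apply/negbTE/set0P.
case: (leP (diam V) d'%:E) => Vd; last by rewrite leey.
rewrite ifT; last by rewrite (le_trans (le_diam UV))// (le_trans Vd)// lee_fin.
apply: lee_wpmul2l => //; apply: lee_expe.
  by rewrite mule_ge0 ?diam_nonneg// lee_fin invr_ge0.
by apply: lee_wpmul2l; [rewrite lee_fin invr_ge0|exact: le_diam].
Qed.

(** In a cover of gauge parameter [e < r], a set meeting both [A] and [B] has diameter at least [r]
    and infinite gauge. The cover thus splits into one of [A] and one of [B]. *)
Lemma hausdorff_separated : separated_additive (@hausdorff_outer_measure R n m).
Proof.
move=> A B r r0 AB; set z := (X in _ <= X).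
have g0 d : @hausdorff_gauge R n m d set0 = 0 by rewrite /hausdorff_gauge eqxx.
(* Two independent parameters, so that the suprema defining the measures of [A] and of [B] can be
   taken one after the other. *)
have key (d d' : R) : (0 < d)%R -> (0 < d')%R ->
    cover_measure (hausdorff_gauge m d) A + cover_measure (hausdorff_gauge m d') B <= z.
  move=> d0 d'0; pose e : R := Num.min (Num.min d d') (r / 2)%R.
  have e0 : (0 < e)%R by rewrite !lt_min d0 d'0 divr_gt0.
  have er : (e < r)%R by rewrite gt_min; apply/orP; right; lra.
  have ed : (e <= d)%R by rewrite !ge_min lexx.
  have ed' : (e <= d')%R by rewrite !ge_min lexx orbT.
  apply: (@le_trans _ _ (cover_measure (hausdorff_gauge m e) (A `|` B))); last first.
    by apply: ereal_sup_ubound; exists e.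
  apply: le_ereal_inf_tmp => _ [U ABU <-].
  have le1 (f : R) (Z : set 'rV[R]_n) : Z `<=` A `|` B ->
      cover_measure (hausdorff_gauge m f) Z <= \sum_(k <oo) hausdorff_gauge m f (U k `&` Z).
    by move=> ZAB; apply: cover_measure_le => x Zx; have [k _ Ukx] := ABU _ (ZAB _ Zx); exists k.
  apply: (le_trans (leeD (le1 d A _) (le1 d' B _))) => [x|x|]; [by left|by right|].
  rewrite -nneseriesD; [|by move=> *; exact: hausdorff_gauge_nonneg..].
  apply: lee_nneseries => [k _ _|k _]; first by rewrite adde_ge0// hausdorff_gauge_nonneg.
  have [UA|/set0P[a [Ua Aa]]] := eqVneq (U k `&` A) set0.
    by rewrite UA g0 add0e; apply: hausdorff_gauge_le => // x [].
  have [UB|/set0P[b [Ub Bb]]] := eqVneq (U k `&` B) set0.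
    by rewrite UB g0 adde0; apply: hausdorff_gauge_le => // x [].
  rewrite [leRHS]/hausdorff_gauge [leRHS]ifF; last by apply/negbTE/set0P; exists a.
  rewrite [leRHS]ifF ?leey//; apply/negbTE; rewrite -ltNge.
  apply: (@lt_le_trans _ _ (enorm (a - b))%:E); first by rewrite lte_fin (lt_le_trans er)// AB.
  exact: enorm_le_diam.
have z0 : 0 <= z by exact: outer_measure_ge0.
have [->|zoo] := eqVneq z +oo; first by rewrite leey.
have zfin : z \is a fin_num by rewrite ge0_fin_numE// ltey.
have c0 d X : 0 <= cover_measure (@hausdorff_gauge R n m d) X.
  by apply: cover_measure_ge0 => U; exact: hausdorff_gauge_nonneg.
have fin1 (a b : \bar R) : 0 <= a -> 0 <= b -> a + b <= z -> b \is a fin_num.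
  move=> a0 b0 abz; rewrite ge0_fin_numE//; apply: (@le_lt_trans _ _ z); last by rewrite ltey.
  by apply: le_trans abz; rewrite leeDr.
have half d' : (0 < d')%R -> hausdorff_outer m A + cover_measure (hausdorff_gauge m d') B <= z.
  move=> d'0; have bf : cover_measure (@hausdorff_gauge R n m d') B \is a fin_num.
    by apply: fin1 (key _ _ ltr01 d'0).
  rewrite -leeBrDr//; apply: ge_ereal_sup => _ [d d0 <-]; rewrite leeBrDr//.
  exact: key.
have HA0 : 0 <= hausdorff_outer m A by exact: (@outer_measure_ge0 _ _ (@hausdorff_outer_measure R n m)).
have af : hausdorff_outer m A \is a fin_num.
  by apply: (fin1 (cover_measure (@hausdorff_gauge R n m 1) B)) => //; rewrite addeC; exact: half.
rewrite /= addeC -leeBrDr//; apply: ge_ereal_sup => _ [d' d'0 <-].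
by rewrite leeBrDr// addeC; exact: half.
Qed.

Lemma hausdorff_closed_measurable (C : set 'rV[R]_n) : closed C ->
  measurable (C : set (caratheodory_type (@hausdorff_outer_measure R n m))).
Proof. move=> cC; apply: caratheodory_closed => //; exact: hausdorff_separated. Qed.

End hausdorff_measurable.

(** * Tubes *)

Section tubes.
Context {R : realType} (m : nat).
Local Notation mu n := (@lebesgue_outer_measure R n).
Implicit Types (u v p x y : 'rV[R]_(m + 1)) (c s : R).
Local Open Scope ereal_scope.

(* The part of the union of the lines of direction [v] through [E] lying in a
   slab transverse to [v]. *)
Definition tube v p c s (E : set 'rV[R]_(m + 1)) : set 'rV[R]_(m + 1) :=
  [set x | (`|dot x p - c| <= s)%R /\ exists2 y, E y & exists t, x = (y + t *: v)%R].

(** The projection along [v] onto the hyperplane orthogonal to [u]. *)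
Definition oblique u v y := (y - (dot y u / dot v u) *: v)%R.

Lemma dot_row_mx (a b : 'rV[R]_m) (s t : 'rV[R]_1) :
  dot (row_mx a s) (row_mx b t) = (dot a b + s 0 0 * t 0 0)%R.
Proof.
rewrite /dot big_split_ord/= big_ord1 !row_mxEr; congr (_ + _)%R.
by apply: eq_bigr => i _; rewrite !row_mxEl.
Qed.

Lemma lebesgue_translate_le n (z : 'rV[R]_n) A : mu n [set x + z | x in A]%R <= mu n A.
Proof.
have := @lebesgue_affine_le R n 1%R z A ltr01; rewrite expr1n mul1e.
by under [X in mu n X <= _ -> _]eq_imagel do rewrite scale1r.
Qed.

(** After a reflection taking the last basis vector to [u], the oblique projection of [E] becomes a
    set [A] in dimension [m], of diameter at most [D]. The tube is the image of a cylinder over [A]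
    of height [2 s] under shears, a reflection, a translation and a dilation of one coordinate by
    [dot v u]. *)
Lemma lebesgue_tube_le u v p c s E (D : R) :
  enorm u = 1%R -> (0 < dot v u)%R -> dot v p = 1%R -> (0 < s)%R -> (0 <= D)%R ->
  (forall y y', E y -> E y' -> (enorm (oblique u v y - oblique u v y') <= D)%R) ->
  mu (m + 1) (tube v p c s E) <=
  (2 * s * dot v u)%:E * (((D / 2) ^+ m)%:E * mu m (eball 0%R 1%R)).
Proof.
move=> u1 vu vp s0 D0 ED; pose e : 'rV[R]_(m + 1) := row_mx 0%R 1%R.
have e1 : enorm e = 1%R.
  by rewrite /enorm dot_row_mx dot0l add0r mxE mulr1 sqrtr1.
have [f [fK fdot fe]] := householder e1 u1.
have fadj x y : dot (f x) y = dot x (f y) by rewrite -{1}(fK y) fdot.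
have fnorm x : enorm (f x) = enorm x by rewrite /enorm fdot.
have dote z : dot z e = rsubmx z 0%R 0%R.
  by rewrite -{1}(hsubmxK z) dot_row_mx dot0r add0r [X in (_ * X)%R]mxE mulr1.
pose A : set 'rV[R]_m := [set a | exists2 y, E y & f (oblique u v y) = row_mx a 0%R].
have oblE y : dot (oblique u v y) u = 0%R.
  by rewrite dotBl dotZl divfK ?subrr// gt_eqF.
have fobl y : f (oblique u v y) = row_mx (lsubmx (f (oblique u v y))) 0%R.
  rewrite -{1}(hsubmxK (f _)); congr row_mx; apply/rowP => i.
  by rewrite !ord1 -dote fadj fe oblE mxE.
have Adiam a a' : A a -> A a' -> (enorm (a - a') <= D)%R.
  move=> [y Ey ya] [y' Ey' ya']; apply: le_trans (ED _ _ Ey Ey').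
  rewrite -[leRHS]fnorm linearB ya ya' /enorm opp_row_mx add_row_mx dot_row_mx.
  by rewrite subr0 mxE mulr0 addr0.
have Av := isodiametric D0 Adiam.
apply: (@le_trans _ _ ((2 * s * dot v u)%:E * mu m A)); last first.
  by apply: lee_wpmul2l => //; rewrite lee_fin !mulr_ge0// ltW.
pose w := lsubmx (f v); pose al := dot v u; pose b := lsubmx (f p).
have fv : f v = row_mx w al%:M.
  rewrite -[LHS]hsubmxK; congr row_mx; apply/rowP => i.
  by rewrite !ord1 -dote fadj fe [RHS]mxE eqxx.
(* [G] sends [(a, r)] to the point of the line of direction [v] through [f (a, 0)] at which the form
   [dot _ p] has the value [r]. *)
pose G z := f (z *m shear_last (- b^T) *m scale_last al *m shear_init (al^-1 *: w))%R.
have tubeG : tube v p c s E `<=` [set G z + c *: v | z in cylinder A (- s) s]%R.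
  move=> x [xs [y Ey [t xy]]].
  pose a := lsubmx (f (oblique u v y)).
  pose tau := (dot y u / dot v u + t)%R.
  have xE : (x = oblique u v y + tau *: v)%R.
    by rewrite xy /oblique /tau scalerDl addrA subrK.
  have oE : oblique u v y = f (row_mx a 0)%R by rewrite -fobl fK.
  have la : (a *m b^T = (dot (oblique u v y) p)%:M)%R.
    apply/rowP => i; rewrite ord1 oE fadj -(hsubmxK (f p)) dot_row_mx [X in (_ + X * _)%R]mxE.
    rewrite mul0r addr0 [RHS]mxE eqxx mulr1n mxE.
    apply: eq_bigr => j _. by rewrite [X in (_ * X)%R = _]mxE.
  have xp : (dot x p = dot (oblique u v y) p + tau)%R by rewrite xE dotDl dotZl vp mulr1.
  exists (row_mx a (dot x p - c)%:M); last first.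
    rewrite /G mul_shear_last mul_scale_last mul_shear_init mulmxN la.
    have -> : (- (dot (oblique u v y) p)%:M + (dot x p - c)%:M = (tau - c)%:M :> 'M[R]_1)%R.
      by rewrite -raddfN -raddfD /= xp; congr _%:M; ring.
    rewrite -scalemxAr -scalemxAl scalerA mulVf ?gt_eqF// scale1r mul_scalar_mx.
    have -> : (row_mx (a + (tau - c) *: w) (al *: (tau - c)%:M) =
       row_mx a 0 + (tau - c) *: row_mx w al%:M)%R.
      by rewrite scale_row_mx add_row_mx add0r !scale_scalar_mx [(al * _)%R]mulrC.
    by rewrite linearD linearZ/= -fv fK -oE -addrA -scalerDl subrK xE.
  split; rewrite ?row_mxKl ?row_mxKr; first by exists y => //; exact: fobl.
  by rewrite mxE eqxx mulr1n -ler_norml.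
apply: (le_trans (le_outer_measure _ _ _ tubeG)).
rewrite -(image_comp G (fun x => x + c *: v)%R).
apply: (le_trans (lebesgue_translate_le _ _)).
rewrite -(image_comp (fun z => z *m shear_last (- b^T) *m scale_last al *m shear_init (al^-1 *: w))%R f).
apply: (le_trans (lebesgue_orthogonal_le fK fnorm _)).
rewrite -(image_comp (fun z => z *m shear_last (- b^T) *m scale_last al)%R (mulmxr (shear_init (al^-1 *: w)))%R).
apply: (le_trans (lebesgue_shear_init _ _)).
rewrite -(image_comp (mulmxr (shear_last (- b^T)))%R (mulmxr (scale_last al))).
apply: (le_trans (lebesgue_scale_last _ vu)).
rewrite mulrC EFinM -muleA; apply: lee_wpmul2l; first by rewrite lee_fin ltW.
apply: (le_trans (lebesgue_shear_last _ _)).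
apply: (le_trans (lebesgue_cylinder_le _ _)); first lra.
by rewrite opprK -mulr2n mulr_natl.
Qed.

Lemma oblique_dist u v y y' (eps : R) : enorm u = 1%R -> (0 < dot v u)%R ->
  (`|dot (y - y') u| <= eps * enorm (y - y'))%R ->
  (enorm (oblique u v y - oblique u v y') <=
   enorm (y - y') * (1 + eps * enorm v / dot v u))%R.
Proof.
move=> u1 vu yu.
have -> : (oblique u v y - oblique u v y' = (y - y') - (dot (y - y') u / dot v u) *: v)%R.
  by rewrite /oblique dotBl mulrBl scalerBl !opprB addrACA [RHS]addrACA [(- y' + _)%R]addrC.
apply: (le_trans (ler_enormD _ _)); rewrite mulrDr mulr1 lerD2l enormN enormZ.
rewrite normrM normfV (gtr0_norm vu) mulrAC.
have -> : (enorm (y - y') * (eps * enorm v / dot v u) = (eps * enorm (y - y')) * enorm v / dot v u)%R.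
  by ring.
by rewrite ler_pM2r ?invr_gt0// ler_wpM2r ?enorm_ge0.
Qed.

(** On a nearly flat set the projection along [v] stretches by at most [k]. The isodiametric bound
    for the projection of a covering set is then exactly [k^m] times its Hausdorff gauge, both being
    normalised by the unit ball. *)
Lemma lebesgue_tube_hausdorff u v p c s E (eps : R) :
  enorm u = 1%R -> (0 < dot v u)%R -> dot v p = 1%R -> (0 < s)%R -> (0 <= eps)%R ->
  (forall y y', E y -> E y' -> (`|dot (y - y') u| <= eps * enorm (y - y'))%R) ->
  mu (m + 1) (tube v p c s E) <=
  (2 * s * dot v u * (1 + eps * enorm v / dot v u) ^+ m)%:E * hausdorff_outer m E.
Proof.
move=> u1 vu vp s0 eps0 flat; set k := (1 + _)%R.
have k0 : (0 < k)%R.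
  by rewrite /k ltr_pwDl// divr_ge0 ?mulr_ge0 ?enorm_ge0// ltW.
set C := (2 * s * dot v u * _)%R.
have C0 : (0 < C)%R by rewrite !mulr_gt0// exprn_gt0.
(* Hausdorff measure is a supremum over the gauge parameter and the bound holds for any of them; 1
   is as good as any. *)
apply: (@le_trans _ _ (C%:E * cover_measure (hausdorff_gauge m 1%R) E)); last first.
  apply: lee_wpmul2l; first by rewrite lee_fin ltW.
  by apply: ereal_sup_ubound; exists 1%R => //=.
rewrite -lee_pdivrMl//; apply: le_ereal_inf_tmp => _ [U EU <-]; rewrite lee_pdivrMl//.
have tubeU : tube v p c s E `<=` \bigcup_j tube v p c s (E `&` U j).
  move=> x [xs [y Ey [t xy]]]; have [j _ Ujy] := EU _ Ey.
  by exists j => //; split => //; exists y => //; exists t.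
apply: (le_trans (le_outer_measure _ _ _ tubeU)).
apply: (le_trans (outer_measure_sigma_subadditive _ _)).
rewrite -nneseriesZl; last by move=> j _; exact: hausdorff_gauge_nonneg.
apply: lee_nneseries => [j _ _|j _]; first exact: outer_measure_ge0.
rewrite /hausdorff_gauge; case: ifPn => [/eqP->|/set0P Uj0].
  rewrite setI0 mule0 (_ : tube _ _ _ _ _ = set0) ?outer_measure0//.
  by rewrite -subset0 => x [_ []].
case: ifP => [dU|_]; last by rewrite gt0_muley ?leey// lte_fin.
have dfin : diam (U j) \is a fin_num.
  by rewrite ge0_fin_numE ?diam_nonneg// (le_lt_trans dU)// ltry.
pose d := fine (diam (U j)).
have dE : diam (U j) = d%:E by rewrite fineK.
have d0 : (0 <= d)%R by rewrite -lee_fin -dE diam_nonneg.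
apply: (le_trans (@lebesgue_tube_le u v p c s _ (d * k)%R u1 vu vp s0 _ _)).
- by rewrite mulr_ge0// ltW.
- move=> y y' [Ey Uy] [Ey' Uy']; apply: (le_trans (oblique_dist u1 vu (flat _ _ Ey Ey'))).
  by rewrite ler_pM2r// -lee_fin -dE enorm_le_diam.
rewrite dE -EFinM -EFin_expe [X in _ <= _ * X]muleC !muleA -!EFinM; apply: lee_wpmul2r.
  exact: outer_measure_ge0.
rewrite lee_fin /C le_eqVlt; apply/orP; left; apply/eqP.
have -> : (d * k / 2 = k * (2^-1 * d))%R by ring.
by rewrite exprMn; ring.
Qed.

(** A crude density bound that does not involve the boundary integral, obtained from the tube over
    the ball itself. It serves when that integral is infinite, and to exclude singular volume
    preserving maps. *)
Lemma slab_finite v (r : R) : v != 0%R -> (0 < r)%R -> exists2 Q : R, (0 < Q)%R &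
  forall p c s, dot v p = 1%R -> (0 < s)%R ->
  mu (m + 1) [set x | (enorm x <= r)%R /\ (`|dot x p - c| <= s)%R] <= (2 * s * Q)%:E.
Proof.
move=> v0 r0; pose u := ((enorm v)^-1 *: v)%R.
have nv : (0 < enorm v)%R by rewrite enorm_gt0.
have u1 : enorm u = 1%R by rewrite enormZ ger0_norm ?invr_ge0 ?enorm_ge0// mulVf ?gt_eqF.
have vuE : dot v u = enorm v by rewrite dotZr -enorm_sqr expr2 mulrA mulVf ?gt_eqF// mul1r.
have vu : (0 < dot v u)%R by rewrite vuE.
pose D := (2 * r * (1 + 1 * enorm v / dot v u))%R.
have w0 : (0 < fine (mu m (eball 0%R 1%R)))%R by rewrite -lte_fin fineK ?eball_fin ?eball_gt0.
have D0 : (0 < D)%R by rewrite /D vuE mul1r divff ?gt_eqF// !mulr_gt0.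
exists (enorm v * ((D / 2) ^+ m * fine (mu m (eball 0%R 1%R))))%R.
  by rewrite !mulr_gt0// exprn_gt0// divr_gt0.
move=> p c s vp s0.
have sub : [set x | (enorm x <= r)%R /\ (`|dot x p - c| <= s)%R] `<=`
    tube v p c s [set x | (enorm x <= r)%R].
  by move=> x [xr xs]; split => //; exists x => //; exists 0%R; rewrite scale0r addr0.
apply: (le_trans (le_outer_measure _ _ _ sub)).
apply: (le_trans (lebesgue_tube_le c u1 vu vp s0 (ltW D0) _)) => [y y' /= yr y'r|].
  apply: (le_trans (@oblique_dist u v y y' 1%R u1 vu _)).
    by rewrite mul1r; apply: le_trans (ler_dot _ _) _; rewrite u1 mulr1.
  apply: ler_wpM2r; first by rewrite vuE mul1r divff ?gt_eqF.
  by apply: (le_trans (ler_enormD _ _)); rewrite enormN; lra.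
by rewrite vuE -[X in _ * (_ * X)](fineK (eball_fin m)) -!EFinM lee_fin !mulrA.
Qed.

End tubes.

(** * Hahn-Banach and supporting hyperplanes *)

Section hahn_banach.
Context {R : realType} (n : nat).
Implicit Types (p q : 'rV[R]_n -> R) (x y e : 'rV[R]_n).

Definition sublinear p := (forall x y, p (x + y) <= p x + p y) /\
  (forall a x, 0 < a -> p (a *: x) <= a * p x).

Lemma sublinear0 p : sublinear p -> p 0 = 0.
Proof.
move=> [_ pZ]; apply/eqP; rewrite eq_le; apply/andP; split.
  by have := pZ 2^-1 0; rewrite scaler0 invr_gt0 => /(_ (ltr0Sn _ _)); lra.
by have := pZ 2 0; rewrite scaler0 => /(_ (ltr0Sn _ _)); lra.
Qed.

Lemma sublinearZ p a x : sublinear p -> 0 < a -> p (a *: x) = a * p x.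
Proof.
move=> [_ pZ] a0; apply/eqP; rewrite eq_le pZ//=.
have := pZ a^-1 (a *: x); rewrite invr_gt0 => /(_ a0).
rewrite scalerA mulVf ?gt_eqF// scale1r => h.
by rewrite -ler_pdivlMl.
Qed.

Lemma sublinearN p x : sublinear p -> - p (- x) <= p x.
Proof. by move=> sp; have := sp.1 x (- x); rewrite subrr sublinear0//; lra. Qed.

(* The largest sublinear function below [p] sending [- e] to [- p e]. *)
Lemma sublinear_step p e : sublinear p ->
  exists q, [/\ sublinear q, forall x, q x <= p x & q (- e) <= - p e].
Proof.
move=> sp; have [pD pZ] := sp.
pose S x := [set p (x + t *: e) - t * p e | t in [set t : R | 0 <= t]].
have Slb x t : 0 <= t -> - p (- x) <= p (x + t *: e) - t * p e.
  move=> t0; have := pD (x + t *: e) (- x); rewrite addrAC subrr add0r.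
  move: t0; rewrite le_eqVlt => /predU1P[<-|t0].
    by rewrite scale0r addr0 sublinear0//; lra.
  by rewrite sublinearZ//; lra.
have Sl x : has_lbound (S x) by exists (- p (- x)) => _ [t t0 <-]; exact: Slb.
have S0 x : S x !=set0 by exists (p (x + 0 *: e) - 0 * p e); exists 0 => //=.
pose q x := inf (S x).
have qle x t : 0 <= t -> q x <= p (x + t *: e) - t * p e.
  by move=> t0; apply: ge_inf => //; exists t.
have qge x l : (forall t, 0 <= t -> l <= p (x + t *: e) - t * p e) -> l <= q x.
  by move=> h; apply: lb_le_inf => // _ [t t0 <-]; exact: h.
have qp x : q x <= p x by have := qle x 0 (lexx _); rewrite scale0r addr0 mul0r subr0.
exists q; split => //.
  split => [x y|a x a0].
    rewrite -lerBlDr; apply: (qge) => s s0; rewrite lerBlDr -lerBlDl.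
    apply: (qge) => t t0; rewrite lerBlDr.
    apply: (le_trans (qle (x + y) (s + t) (addr_ge0 s0 t0))).
    rewrite scalerDl addrACA; have := pD (x + s *: e) (y + t *: e); lra.
  rewrite -ler_pdivrMl//; apply: (qge) => t t0; rewrite ler_pdivrMl//.
  apply: (le_trans (qle (a *: x) (a * t) (mulr_ge0 (ltW a0) t0))).
  by rewrite -scalerA -scalerDr sublinearZ//; lra.
by have := qle (- e) 1 ler01; rewrite scale1r addNr sublinear0//; lra.
Qed.

Lemma sublinear_steps (s : seq 'rV[R]_n) p : sublinear p ->
  exists q, [/\ sublinear q, forall x, q x <= p x &
    forall e, e \in s -> q (- e) <= - q e].
Proof.
elim: s p => [|e s IH] p sp; first by exists p; split.
have [q [sq qp qe]] := sublinear_step e sp.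
have [r [sr rq rs]] := IH q sq.
exists r; split => // [x|e']; first exact: le_trans (rq x) (qp x).
rewrite inE => /predU1P[->|]; last exact: rs.
by have := rq (- e); have := rq e; have := qp e; lra.
Qed.

(** The first step forces the value at [x0], the next ones make the function odd on each basis
    vector. Since every step only lowers the function, oddness obtained earlier persists, and a
    sublinear function odd on a basis is linear. *)
Theorem hahn_banach p x0 : sublinear p ->
  exists2 w, forall x, dot w x <= p x & dot w x0 = p x0.
Proof.
move=> sp; have [q0 [sq0 q0p q0x]] := sublinear_step x0 sp.
have [q [sq qq0 qd]] := sublinear_steps [seq delta_mx 0 i | i <- enum 'I_n] sq0.
have {}qd i : q (- delta_mx 0 i) <= - q (delta_mx 0 i).
  by apply: qd; apply: map_f; rewrite mem_enum.
pose w : 'rV[R]_n := \row_i q (delta_mx 0 i).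
have qZ i a : q (a *: delta_mx 0 i) <= a * q (delta_mx 0 i).
  have [a0|a0|->] := ltgtP a 0; last by rewrite scale0r mul0r sublinear0.
    rewrite -[a]opprK scaleNr -scalerN sublinearZ ?oppr_gt0// opprK -[leRHS]mulrNN.
    by apply: ler_wpM2l => //; rewrite oppr_ge0 ltW.
  by rewrite sublinearZ.
have qw x : q x <= dot w x.
  rewrite {1}(row_sum_delta x) /dot.
  elim/big_ind2: _ => [|a b c d ab cd|i _]; first by rewrite sublinear0.
    by apply: (le_trans (sq.1 _ _)); exact: lerD.
  by rewrite mxE mulrC; exact: qZ.
have wq x : dot w x <= q x.
  by have := sublinearN x sq; have := qw (- x); rewrite dotNr; lra.
exists w => [x|]; first by apply: (le_trans (wq x)); exact: le_trans (qq0 x) (q0p x).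
apply/eqP; rewrite eq_le; apply/andP; split.
  by apply: (le_trans (wq x0)); exact: le_trans (qq0 x0) (q0p x0).
by have := wq (- x0); have := qq0 (- x0); rewrite dotNr; lra.
Qed.

End hahn_banach.

(** * Symmetric convex bodies and their images under linear maps *)

Section convex_body_theory.
Context {R : realType} (n : nat).
Implicit Types (K : set 'rV[R]_n) (x y u v : 'rV[R]_n).

Lemma compact_enorm_bounded K : compact K -> exists2 r : R, 0 < r & forall x, K x -> enorm x <= r.
Proof.
move=> cK; have [M [Mr KM]] := compact_bounded cK.
pose b : R := Num.max (M + 1) 1.
have b0 : 0 < b by rewrite lt_max ltr01 orbT.
have Mb : M < b by rewrite lt_max ltrDl ltr01.
exists (n%:R * b + 1); first by rewrite ltr_wpDl// mulr_ge0// ltW.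
move=> x Kx; apply: (@le_trans _ _ (n%:R * b)); last by rewrite lerDl.
apply: enorm_le_coord => [|i]; first exact: ltW.
have := KM b Mb x Kx; apply: le_trans.
rewrite /Num.Def.normr/= mx_normrE.
exact: (@le_bigmax _ _ _ 0 (fun i => `|x i.1 i.2|) (0, i)).
Qed.

Lemma body_closed K : convex_body K -> closed K.
Proof. by move=> [cK _ _]; apply: compact_closed cK; exact: norm_hausdorff. Qed.

Lemma body_convex K x y (t : R) : convex_body K -> 0 <= t -> t <= 1 -> K x -> K y ->
  K (t *: x + (1 - t) *: y).
Proof.
move=> [_ cK _] t0 t1 Kx Ky; have := cK x y (Itv01 t0 t1).
by rewrite !inE => /(_ Kx Ky).
Qed.

Lemma body_oppr K x : symmetric_set K -> K x -> K (- x).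
Proof. by move=> sK Kx; rewrite -sK; exists x. Qed.

Lemma interior_ball K x : K° x <-> exists2 e : R, 0 < e & forall y, enorm (y - x) < e -> K y.
Proof. exact: nbhs_enorm. Qed.

Lemma body_ball K : convex_body K -> symmetric_set K ->
  exists2 r : R, 0 < r & forall y, enorm y <= r -> K y.
Proof.
move=> bK sK; have [_ _ [c /interior_ball[e e0 eK]]] := bK.
exists (e / 2); first by rewrite divr_gt0.
move=> y yr; have ye : enorm y < e by apply: le_lt_trans yr _; lra.
have K1 : K (c + y) by apply: eK; rewrite addrAC subrr add0r.
have K2 : K (- (c - y)).
  by apply: body_oppr => //; apply: eK; rewrite addrAC subrr add0r enormN.
have := @body_convex K _ _ 2^-1 bK _ _ K1 K2.
have -> : 2^-1 *: (c + y) + (1 - 2^-1) *: - (c - y) = y.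
  have -> : 1 - 2^-1 = 2^-1 :> R by field.
  by rewrite -scalerDr opprB [_ + (y - c)]addrC addrA subrK -mulr2n -(scaler_nat 2 y) scalerA mulVf ?scale1r.
by apply; rewrite ?invr_ge0 ?invf_le1 ?ler1n.
Qed.

(* A point [t *: x] of [K] with [1 < t] pushes a ball around [0] to a ball around [x]. *)
Lemma body_interior K x (t : R) : convex_body K -> symmetric_set K -> 1 < t -> K (t *: x) -> K° x.
Proof.
move=> bK sK t1 Ktx; have [r r0 rK] := body_ball bK sK.
have t0 : 0 < t by exact: lt_trans t1.
have ti : t^-1 < 1 by rewrite invf_lt1.
apply/interior_ball; exists (r * (1 - t^-1)); first by rewrite mulr_gt0// subr_gt0.
move=> y yx; have -> : y = t^-1 *: (t *: x) + (1 - t^-1) *: ((1 - t^-1)^-1 *: (y - x)).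
  by rewrite !scalerA mulVf ?gt_eqF// mulfV ?gt_eqF ?subr_gt0// !scale1r addrC subrK.
apply: body_convex => //; [by rewrite invr_ge0 ltW|exact: ltW|].
apply: rK; rewrite enormZ gtr0_norm ?invr_gt0 ?subr_gt0// ler_pdivrMl ?subr_gt0//.
by rewrite mulrC ltW.
Qed.

(** The Minkowski gauge. Its value at [x] is at least 1 also on the boundary, because a value below
    1 puts some [t *: x] with [1 < t] in [K], and [body_interior] applies. *)
Lemma gauge_sublinear K : convex_body K -> symmetric_set K ->
  exists p, [/\ sublinear p, forall x, K x -> p x <= 1 & forall x, ~ K° x -> 1 <= p x].
Proof.
move=> bK sK; have [r r0 rK] := body_ball bK sK.
pose S x := [set t : R | 0 < t /\ K (t^-1 *: x)].
have Sl x : has_lbound (S x) by exists 0 => t [/ltW].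
have S0 x : S x !=set0.
  exists (enorm x / r + 1); have q0 : 0 < enorm x / r + 1.
    by rewrite ltr_wpDl// divr_ge0 ?enorm_ge0// ltW.
  split=> //; apply: rK; rewrite enormZ gtr0_norm ?invr_gt0// ler_pdivrMl//.
  by rewrite mulrDl mul1r divfK ?gt_eqF// lerDl ltW.
pose p x := inf (S x).
have ple x t : S x t -> p x <= t by move=> h; exact: ge_inf.
have pge x l : (forall t, S x t -> l <= t) -> l <= p x by move=> h; exact: lb_le_inf.
exists p; split.
- split=> [x y|a x a0].
    rewrite -lerBlDr; apply: (pge) => s [s0 Ks]; rewrite lerBlDr -lerBlDl.
    apply: (pge) => t [t0 Kt]; rewrite lerBlDl; apply: ple; split; first exact: addr_gt0.
    have st0 : 0 < s + t by exact: addr_gt0.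
    have -> : (s + t)^-1 *: (x + y) = (s / (s + t)) *: (s^-1 *: x) + (1 - s / (s + t)) *: (t^-1 *: y).
      rewrite !scalerA scalerDr; congr (_ *: _ + _ *: _).
        by rewrite mulrAC mulfV ?mul1r// gt_eqF.
      by field; rewrite !gt_eqF.
    apply: body_convex => //; first by rewrite divr_ge0// ltW.
    by rewrite ler_pdivrMr// mul1r lerDl ltW.
  rewrite -ler_pdivrMl//; apply: (pge) => t [t0 Kt]; rewrite ler_pdivrMl//; apply: ple.
  split; first exact: mulr_gt0.
  by rewrite scalerA invfM mulrAC mulVf ?mul1r// gt_eqF.
- by move=> x Kx; apply: ple; split => //; rewrite invr1 scale1r.
- move=> x nKx; apply: (pge) => t [t0 Kt]; rewrite leNgt; apply/negP => t1.
  by apply: nKx; apply: (@body_interior _ _ t^-1) => //; rewrite invf_gt1.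
Qed.

Lemma supporting_normal K x : convex_body K -> symmetric_set K -> K x -> ~ K° x ->
  exists u, unit_outer_normal K x u.
Proof.
move=> bK sK Kx nKx; have [p [sp p1 pge]] := gauge_sublinear bK sK.
have [w wp wx] := hahn_banach x sp.
have w0 : w != 0.
  by apply/eqP => w0; have := pge _ nKx; rewrite -wx w0 dot0l; lra.
have nw : 0 < enorm w by rewrite enorm_gt0.
exists ((enorm w)^-1 *: w); split.
  by rewrite enormZ gtr0_norm ?invr_gt0// mulVf ?gt_eqF.
move=> y Ky; rewrite dotZr dotBl pmulr_rle0 ?invr_gt0// subr_le0 !(dotC _ w) wx.
by apply: (le_trans (wp y)); apply: (le_trans (p1 _ Ky)); exact: pge.
Qed.

Lemma boundaryE K x : convex_body K -> boundary K x <-> K x /\ ~ K° x.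
Proof.
move=> bK; split=> -[Kx nKx]; split=> //; first exact: body_closed Kx.
exact: subset_closure.
Qed.

Lemma exit_point K x v : convex_body K -> K x -> v != 0 ->
  exists2 t : R, 0 <= t & K (x + t *: v) /\ ~ K° (x + t *: v).
Proof.
move=> bK Kx v0; have [cK _ _] := bK; have [r r0 Kr] := compact_enorm_bounded cK.
have nv : 0 < enorm v by rewrite enorm_gt0.
pose S := [set t : R | 0 <= t /\ K (x + t *: v)].
have S0 : S !=set0 by exists 0; split => //; rewrite scale0r addr0.
have Sub : ubound S (2 * r / enorm v).
  move=> t [t0 Kt]; rewrite ler_pdivlMr// -[t]ger0_norm// -enormZ.
  have -> : t *: v = (x + t *: v) - x by rewrite addrAC subrr add0r.
  by apply: (le_trans (ler_enormD _ _)); rewrite enormN; have := Kr _ Kx; have := Kr _ Kt; lra.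
have hS : has_sup S by split => //; exists (2 * r / enorm v).
pose t := sup S.
have t0 : 0 <= t by apply: ub_le_sup; [case: hS|split => //; rewrite scale0r addr0].
exists t => //; split.
  apply: closed_enorm (body_closed bK) _ => e e0.
  have [s [s0 Ks] ts] := sup_adherent (divr_gt0 e0 nv) hS.
  exists (x + s *: v) => //.
  have st : s <= t by apply: ub_le_sup; [case: hS|split].
  rewrite opprD addrACA subrr add0r -scalerBl enormZ -ltr_pdivlMr//.
  by rewrite ler0_norm ?subr_le0// opprB; move: ts; rewrite -/t; lra.
move=> /interior_ball[e e0 eK].
have : S (t + e / 2 / enorm v).
  have e2 : 0 <= e / 2 / enorm v by rewrite !divr_ge0// ltW.
  split; first exact: addr_ge0.
  apply: eK; rewrite opprD addrACA subrr add0r -scalerBl addrAC subrr add0r enormZ.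
  by rewrite ger0_norm// divfK ?gt_eqF//; lra.
move=> /(ub_le_sup hS.2); rewrite -/t leNgt => /negP; apply.
by rewrite ltrDl !divr_gt0.
Qed.

Lemma linear_bounded (f : {linear 'rV[R]_n -> 'rV[R]_n}) :
  exists2 L : R, 0 < L & forall x, enorm (f x) <= L * enorm x.
Proof.
exists (\sum_i enorm (f (delta_mx 0 i)) + 1).
  by rewrite ltr_wpDl// sumr_ge0// => i _; exact: enorm_ge0.
move=> x; apply: (@le_trans _ _ ((\sum_i enorm (f (delta_mx 0 i))) * enorm x)); last first.
  by rewrite ler_wpM2r ?enorm_ge0// lerDl.
rewrite {1}(row_sum_delta x) linear_sum mulr_suml.
elim/big_ind2: _ => [|a b c d ab cd|i _]; first by rewrite enorm0.
  by apply: (le_trans (ler_enormD _ _)); exact: lerD.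
by rewrite linearZ enormZ mulrC; apply: ler_wpM2l; [exact: enorm_ge0|exact: coord_le_enorm].
Qed.

Lemma linear_image_compact K (f : {linear 'rV[R]_n -> 'rV[R]_n}) : compact K -> compact (f @` K).
Proof.
have [L L0 fL] := linear_bounded f.
move=> cK; apply: continuous_compact cK; apply: continuous_subspaceT => x.
move=> A /nbhs_enorm[e e0 eA]; apply/nbhs_enorm; exists (e / L); first by rewrite divr_gt0.
move=> y yx; apply: eA; rewrite -linearB; apply: (le_lt_trans (fL _)).
by rewrite mulrC -ltr_pdivlMr.
Qed.

End convex_body_theory.

(** * Slabs and the boundary integral *)

Section normal_pieces.
Context {R : realType} (n : nat).
Implicit Types (K : set 'rV[R]_n) (x y u v : 'rV[R]_n).

Lemma dot_lipschitz (w : 'rV[R]_n) x y : dot w x <= dot w y + enorm w * enorm (x - y).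
Proof.
have -> : dot w x = dot w y + dot w (x - y) by rewrite dotBr; ring.
by rewrite lerD2l (le_trans (ler_norm _))// ler_dot.
Qed.

Lemma closed_dot_le (w : 'rV[R]_n) (c : R) : closed [set u | dot w u <= c].
Proof.
apply: enorm_closed => u h /=; apply/ler_addgt0Pr => e e0.
have w0 : 0 < enorm w + 1 by rewrite ltr_wpDl// enorm_ge0.
have [u' u'c uu'] := h _ (divr_gt0 e0 w0).
apply: (le_trans (dot_lipschitz w u u')); apply: lerD => //.
rewrite enormB; apply: (@le_trans _ _ ((enorm w + 1) * (e / (enorm w + 1)))).
  by apply: ler_pM; [exact: enorm_ge0|exact: enorm_ge0|rewrite lerDl|exact: ltW].
by rewrite mulrC divfK// gt_eqF.
Qed.

Lemma closed_sphere : closed [set u : 'rV[R]_n | enorm u = 1].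
Proof.
have le1 (u u' : 'rV[R]_n) : enorm u <= enorm u' + enorm (u' - u).
  by have := ler_enormD u' (u - u'); rewrite subrKC enormB.
apply: enorm_closed => u h /=; apply/eqP; rewrite eq_le; apply/andP; split;
  apply/ler_addgt0Pr => e e0; have [u' /= u'1 uu'] := h e e0.
  by have := le1 u u'; rewrite u'1; lra.
by have := le1 u' u; rewrite u'1 enormB; lra.
Qed.

Lemma bounded_enorm_compact (A : set 'rV[R]_n) (r : R) : closed A -> (forall x, A x -> enorm x <= r) ->
  compact A.
Proof.
move=> cA Ar; apply: bounded_closed_compact => //.
exists r; split; first exact: num_real.
move=> M rM x Ax /=; rewrite /Num.Def.normr/= mx_normrE.
have r0 : 0 <= r by apply: le_trans (Ar _ Ax); exact: enorm_ge0.
apply: bigmax_le => [|i _]; first exact: ltW (le_lt_trans r0 rM).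
by rewrite (ord1 i.1); apply: (le_trans (coord_le_enorm _ _)); apply: (le_trans (Ar _ Ax)); exact: ltW.
Qed.

Lemma sphere_net (eps : R) : 0 < eps -> exists us : seq 'rV[R]_n,
  (forall u, u \in us -> enorm u = 1) /\
  forall u, enorm u = 1 -> exists2 u', u' \in us & enorm (u - u') <= eps.
Proof.
move=> e0; have : compact [set u : 'rV[R]_n | enorm u = 1].
  by apply: (@bounded_enorm_compact _ 1); [exact: closed_sphere|move=> x /= ->].
rewrite compact_cover => /(_ _ [set u : 'rV[R]_n | enorm u = 1]
  (fun u => [set y | enorm (y - u) < eps])).
case=> [u _|u u1|D DS SD].
- rewrite openE => y /= yu; apply/nbhs_enorm; exists (eps - enorm (y - u)); first by rewrite subr_gt0.
  move=> z zy /=; have -> : z - u = (z - y) + (y - u) by rewrite addrA subrK.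
  by apply: (le_lt_trans (ler_enormD _ _)); rewrite -ltrBrDr.
- by exists u => //=; rewrite subrr enorm0.
exists (finmap.enum_fset D); split => [u uD|u u1].
  by have := DS _ uD; rewrite inE.
by have [u' /= u'D uu'] := SD _ u1; exists u' => //; exact: ltW.
Qed.

(** Asking for some normal near [u], and not for [normal K x] itself, makes this set closed and
    hence Hausdorff measurable. *)
Definition normal_near K u (eps : R) : set 'rV[R]_n :=
  [set x | K x /\ exists2 u', unit_outer_normal K x u' & enorm (u' - u) <= eps].

(** Normals at points tending to [x] accumulate at a normal at [x]. In terms of filters: the sets
    [S e] of normals at [x] up to an error [e] are closed, nonempty, nested and inside the compact
    unit sphere, so they have a common point. *)
Lemma closed_normal_near K u (eps : R) : closed K -> closed (normal_near K u eps).
Proof.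
move=> cK; apply: enorm_closed => x h; split.
  by apply: (closed_enorm cK) => e e0; have [y [Ky _] yx] := h e e0; exists y.
pose S (e : R) := [set u' | [/\ enorm u' = 1, enorm (u' - u) <= eps &
  forall k, K k -> dot (k - x) u' <= e]].
have cS e : closed (S e).
  have -> : S e = [set u' | enorm u' = 1] `&` eball u eps `&`
      \bigcap_(k in K) [set u' | dot (k - x) u' <= e].
    by apply/seteqP; split => u' => [[h1 h2 h3]|[[h1 h2] h3]]; split => //; exact: h3.
  apply: closedI; first by apply: closedI; [exact: closed_sphere|exact: eball_closed].
  by apply: closed_bigI => k _; exact: closed_dot_le.
have S0 e : 0 < e -> S e !=set0.
  move=> e0; have [y [Ky [u' [u'1 nu'] uu']] yx] := h e e0.
  exists u'; split => // k Kk.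
  have -> : dot (k - x) u' = dot (k - y) u' + dot (y - x) u' by rewrite !dotBl; ring.
  rewrite -[leRHS]add0r lerD ?nu'// (le_trans (ler_norm _))// (le_trans (ler_dot _ _))//.
  by rewrite u'1 mulr1 ltW.
have Sle (e e' : R) : e <= e' -> S e `<=` S e'.
  by move=> ee' u' [h1 h2 h3]; split => // k /h3/le_trans; apply.
pose F := filter_from [set e : R | 0 < e] S.
have FF : ProperFilter F.
  apply: filter_from_proper => //.
  apply: filter_from_filter; first by exists 1 => /=.
  move=> e e' /= e0 e'0; exists (Num.min e e') => /=; first by rewrite lt_min e0.
  by move=> u' h'; split; apply: Sle h'; rewrite ge_min lexx ?orbT.
have cpt : compact (S 1).
  by apply: (@bounded_enorm_compact _ 1) => // u' [-> _ _].
have FS1 : F (S 1) by exists 1 => /=.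
have [u' [[u'1 uu' _] cl]] := cpt F FF FS1.
exists u' => //; split => // k Kk.
have Su' e : 0 < e -> S e u'.
  by move=> e0; apply: cS => B nB; apply: cl => //; exists e.
have H : forall e : R, 0 < e -> dot (k - x) u' <= 0 + e.
  by move=> e e0; rewrite add0r; have [_ _] := Su' e e0; apply.
by apply/ler_addgt0Pr.
Qed.

Lemma unit_normal_boundary K x u : unit_outer_normal K x u -> ~ K° x.
Proof.
move=> [u1 nu] /interior_ball[e e0 eK].
have : K (x + (e / 2) *: u).
  apply: eK; rewrite addrAC subrr add0r enormZ u1 mulr1 ger0_norm; lra.
move=> /nu; rewrite addrAC subrr add0r dotZl -enorm_sqr u1 expr1n; lra.
Qed.

Lemma boundary_normal K x : convex_body K -> symmetric_set K -> boundary K x ->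
  unit_outer_normal K x (normal K x).
Proof.
move=> bK sK /(boundaryE _ bK)[Kx nKx]; rewrite /normal.
have [u nu] := supporting_normal bK sK Kx nKx.
exact: (@xgetPex _ 0 [set v | unit_outer_normal K x v] (ex_intro _ u nu)).
Qed.

Lemma closed_boundary K : closed (boundary K).
Proof.
have -> : boundary K = closure K `&` ~` K° by [].
by apply: closedI; [exact: closed_closure|apply: open_closedC; exact: open_interior].
Qed.

(** A point is assigned to the first vector of the list that is close to one of its normals; the
    order of [us] thus carries information. *)
Definition normal_piece K (us : seq 'rV[R]_n) (eps : R) (i : nat) : set 'rV[R]_n :=
  normal_near K (nth 0 us i) eps `\` \bigcup_(j in `I_i) normal_near K (nth 0 us j) eps.

Lemma normal_piece_disjoint K us eps i j x :
  normal_piece K us eps i x -> normal_piece K us eps j x -> i = j.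
Proof.
move=> [xi ni] [xj nj]; have [ij|ji|//] := ltngtP i j.
  by exfalso; apply: nj; exists i.
by exfalso; apply: ni; exists j.
Qed.

Lemma normal_piece_boundary K us eps i x : normal_piece K us eps i x -> boundary K x.
Proof.
move=> [[Kx [u nu _]] _]; split; first exact: subset_closure.
exact: unit_normal_boundary nu.
Qed.

Lemma normal_piece_flat K us eps i y y' :
  normal_piece K us eps i y -> normal_piece K us eps i y' ->
  `|dot (y - y') (nth 0 us i)| <= eps * enorm (y - y').
Proof.
move=> [[Ky [u [u1 nu] uu]] _] [[Ky' [u' [u'1 nu'] uu']] _].
have half (a b : 'rV[R]_n) (w : 'rV[R]_n) : enorm (w - nth 0 us i) <= eps -> dot (a - b) w <= 0 ->
    dot (a - b) (nth 0 us i) <= eps * enorm (a - b).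
  move=> wu h; apply: (le_trans (dot_lipschitz _ _ w)).
  rewrite -[leRHS]add0r; apply: lerD => //; rewrite mulrC enormB.
  by apply: ler_wpM2r => //; exact: enorm_ge0.
rewrite ler_norml; apply/andP; split; last exact: half uu' (nu' _ Ky).
by rewrite lerNl -dotNl opprB enormB; exact: half uu (nu _ Ky').
Qed.

Lemma normal_piece_cover K us eps x : (exists2 i, (i < size us)%N & normal_near K (nth 0 us i) eps x) ->
  exists2 i, (i < size us)%N & normal_piece K us eps i x.
Proof.
move=> [i iM xi].
have ex : exists i, `[< normal_near K (nth 0 us i) eps x >] by exists i; exact: asboolT.
case: (ex_minnP ex) => j /asboolP xj jmin; exists j.
  by apply: leq_ltn_trans iM; apply: jmin; exact: asboolT.
split => // -[k /= kj xk]; have := jmin k (asboolT xk).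
by rewrite leqNgt kj.
Qed.

Lemma normal_piece_measurable (m : nat) K us eps i : closed K ->
  measurable (normal_piece K us eps i : set (caratheodory_type (@hausdorff_outer_measure R n m))).
Proof.
move=> cK; apply: measurableD.
  by apply: hausdorff_closed_measurable; exact: closed_normal_near.
apply: bigcup_measurable => j _.
by apply: hausdorff_closed_measurable; exact: closed_normal_near.
Qed.

(* Sorting the net by [|dot v u|] makes its value at [us_i] a lower bound, up to
   [eps], of [|dot v n|] for all the normals [n] at a point of the [i]-th piece. *)
Lemma normal_piece_lower K us eps i x v : convex_body K -> symmetric_set K -> 0 <= eps ->
  (forall u, enorm u = 1 -> exists2 u', u' \in us & enorm (u - u') <= eps) ->
  sorted (fun u u' => `|dot v u| <= `|dot v u'|) us -> (i < size us)%N ->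
  normal_piece K us eps i x ->
  `|dot v (nth 0 us i)| - eps * enorm v <= `|dot v (normal K x)|.
Proof.
move=> bK sK eps0 net srt iM xi.
have [u1 nu] := boundary_normal bK sK (normal_piece_boundary xi).
have [u' u'us uu'] := net _ u1.
pose k := index u' us; have kM : (k < size us)%N by rewrite index_mem.
have u'E : nth 0 us k = u' by rewrite nth_index.
(* The chosen normal at [x] is close to the [k]-th vector, and [i] is the first index of this kind
   for any normal at [x]. *)
have ik : (i <= k)%N.
  rewrite leqNgt; apply/negP => ki; have [_ +] := xi; apply; exists k => //.
  have [[Kx _] _] := xi; split=> //; exists (normal K x) => //.
  by rewrite u'E.
have vik : `|dot v (nth 0 us i)| <= `|dot v u'|.
  rewrite -u'E; apply: (@sorted_leq_nth _ (fun u u' => `|dot v u| <= `|dot v u'|)) => //.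
  by move=> a b c; exact: le_trans.
have := ler_dot v (u' - normal K x); rewrite enormB.
have := ler_distD 0 (dot v u') (dot v (normal K x)); rewrite dotBr.
have : enorm v * enorm (normal K x - u') <= eps * enorm v.
  by rewrite mulrC ler_wpM2r ?enorm_ge0.
have := lerB_dist (dot v u') (dot v (normal K x)).
lra.
Qed.

Local Open Scope ereal_scope.

(** The pieces are disjoint and measurable, and [normal_piece_lower] places a staircase over them
    below the integrand; the maximum with 0 keeps the steps nonnegative. *)
Lemma boundary_integral_ge (m : nat) K us eps v : convex_body K -> symmetric_set K -> (0 <= eps)%R ->
  (forall u, enorm u = 1%R -> exists2 u', u' \in us & (enorm (u - u') <= eps)%R) ->
  sorted (fun u u' => `|dot v u| <= `|dot v u'|)%R us ->
  \sum_(i < size us) (Num.max (`|dot v (nth 0%R us i)| - eps * enorm v) 0)%R%:E *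
    hausdorff_outer m (normal_piece K us eps i)
  <= \int[hausdorff n m]_(x in boundary K) `|dot v (normal K x)|%:E.
Proof.
move=> bK sK eps0 net srt; set a := fun i => Num.max (`|dot v (nth 0%R us i)| - eps * enorm v)%R 0%R.
pose B i : set (caratheodory_type (@hausdorff_outer_measure R n m)) := normal_piece K us eps i.
have mB i : measurable (B i) by apply: normal_piece_measurable; exact: body_closed.
have mbd : measurable (boundary K : set (caratheodory_type (@hausdorff_outer_measure R n m))).
  by apply: hausdorff_closed_measurable; exact: closed_boundary.
have a0 i : (0 <= a i)%R by rewrite le_max lexx orbT.
apply: (@lower_integral_staircase _ _ R (hausdorff n m) _ _ a B) => //.
  by move=> i x; exact: normal_piece_boundary.
move=> x bx.
have [[i iM Bi]|none] := pselect (exists2 i, (i < size us)%N & B i x); last first.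
  rewrite big1// => i _; rewrite indicE memNset ?mulr0// => Bi.
  by apply: none; exists i.
rewrite (bigD1 (Ordinal iM))//= big1 ?addr0 => [|j /eqP ji].
  rewrite indicE mem_set// mulr1 ge_max normr_ge0 andbT.
  exact: normal_piece_lower Bi.
rewrite indicE memNset ?mulr0// => Bj; apply: ji; apply: val_inj.
exact: normal_piece_disjoint Bj Bi.
Qed.

End normal_pieces.

Section slabs.
Context {R : realType}.

Lemma ler_pow_limit (x y : R) (k m : nat) :
  (forall t, 0 < t -> t < 1 -> (1 - t) ^+ k * x <= (1 + t) ^+ m * y) -> x <= y.
Proof.
move=> h.
have c1 : (fun N => \prod_(i < k) (1 + (- 2^-1) * harmonic N) * x : R) @ \oo --> x.
  rewrite -[X in _ --> X]mul1r; apply: cvgMr_tmp.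
  have := @cvg_prodD_harmonic R k (fun=> 1) (fun=> - 2^-1).
  by rewrite (big1 _ (fun=> 1)).
have c2 : (fun N => \prod_(i < m) (1 + 2^-1 * harmonic N) * y : R) @ \oo --> y.
  rewrite -[X in _ --> X]mul1r; apply: cvgMr_tmp.
  have := @cvg_prodD_harmonic R m (fun=> 1) (fun=> 2^-1).
  by rewrite (big1 _ (fun=> 1)).
rewrite -(cvg_lim _ c1)// -(cvg_lim _ c2)//.
apply: ler_lim; [by apply/cvg_ex; exists x|by apply/cvg_ex; exists y|].
apply: nearW => N; rewrite !prodr_const !card_ord mulNr.
have h0 : 0 < harmonic N :> R := harmonic_gt0 N.
have h1 : harmonic N <= 1 :> R by rewrite /harmonic invf_le1// ler1n.
by apply: h; [rewrite mulr_gt0|lra].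
Qed.

Context (m : nat).
Local Notation mu n := (@lebesgue_outer_measure R n).
Implicit Types (K : set 'rV[R]_(m + 1)) (u v p x y : 'rV[R]_(m + 1)).

(* The normals at the points where the lines of direction [v] through
   [(1 - d) K] leave [K] make a definite angle with [v^\perp]. *)
Lemma exit_normal K v x y u (r rho d t : R) : (forall z, enorm z <= r -> K z) ->
  (forall z, K z -> enorm z <= rho) -> 0 < r -> 0 < d -> d < 1 -> 0 <= t ->
  K x -> y = (1 - d) *: x + t *: v -> K y -> unit_outer_normal K y u ->
  d * r * enorm v <= 2 * rho * dot v u.
Proof.
move=> rK Krho r0 d0 d1 t0 Kx yE Ky [u1 nu].
have uu : dot u u = 1 by rewrite -enorm_sqr u1 expr1n.
have ry : r <= dot y u.
  have := nu (r *: u); rewrite dotBl dotZl uu mulr1 subr_le0; apply.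
  by apply: rK; rewrite enormZ u1 mulr1 ger0_norm// ltW.
have xy : dot x u <= dot y u by have := nu x Kx; rewrite dotBl subr_le0.
have tvu : d * r <= t * dot v u.
  have -> : t * dot v u = dot y u - (1 - d) * dot x u by rewrite yE dotDl !dotZl; ring.
  have h1 : d * r <= d * dot y u by rewrite ler_pM2l.
  have h2 : (1 - d) * dot x u <= (1 - d) * dot y u by rewrite ler_pM2l// subr_gt0.
  move: h1 h2; rewrite !mulrBl !mul1r.
  move: (d * r) (d * dot y u) (d * dot x u) => *; lra.
have tv : t * enorm v <= 2 * rho.
  rewrite -[t]ger0_norm// -enormZ; have -> : t *: v = y - (1 - d) *: x by rewrite yE addrAC subrr add0r.
  apply: (le_trans (ler_enormD _ _)); rewrite enormN enormZ ger0_norm ?subr_ge0 ?(ltW d1)//.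
  have := Krho _ Ky; have : (1 - d) * enorm x <= 1 * rho.
    apply: ler_pM; rewrite ?subr_ge0 ?enorm_ge0 ?(ltW d1)//; last exact: Krho.
    by rewrite gerBl ltW.
  lra.
have vu0 : 0 <= dot v u.
  rewrite leNgt; apply/negP => vu; have : t * dot v u <= 0 by rewrite mulr_ge0_le0// ltW.
  by apply/negP; rewrite -ltNge (lt_le_trans _ tvu)// mulr_gt0.
apply: (@le_trans _ _ (t * dot v u * enorm v)); first by rewrite ler_wpM2r ?enorm_ge0.
by rewrite mulrAC; apply: ler_wpM2r.
Qed.

Local Open Scope ereal_scope.

(** Every line of direction [v] through the shrunken slab is followed forwards to its exit point.
    The pieces met there have [dot v u] at least [eta], which bounds the distortion of their tubes
    by one factor. *)
Lemma slab_half K v p c s (r rho d eta : R) us (eps : R) : convex_body K -> symmetric_set K ->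
  v != 0%R -> dot v p = 1%R -> (0 < s)%R ->
  (forall z, enorm z <= r -> K z)%R -> (forall z, K z -> enorm z <= rho)%R ->
  (0 < r)%R -> (0 < rho)%R -> (0 < d)%R -> (d < 1)%R -> (0 < eta)%R ->
  (2 * rho * (2 * eta) <= d * r * enorm v)%R -> (0 <= eps)%R -> (eps * enorm v <= eta)%R ->
  (forall u, u \in us -> enorm u = 1%R) ->
  (forall u, enorm u = 1%R -> exists2 u', u' \in us & (enorm (u - u') <= eps)%R) ->
  mu (m + 1) [set x | (exists2 k, K k & x = (1 - d) *: k)%R /\ (`|dot x p - c| <= s)%R] <=
  \sum_(i < size us | (eta <= dot v (nth 0%R us i))%R)
    (2 * s * dot v (nth 0%R us i) * (1 + eps * enorm v / eta) ^+ m)%:E *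
      hausdorff_outer m (normal_piece K us eps i).
Proof.
move=> bK sK v0 vp s0 rK Krho r0 rho0 d0 d1 eta0 etaE eps0 epsE us1 net.
set Sd := [set x | _].
have sub : Sd `<=` \big[setU/set0]_(i < size us | (eta <= dot v (nth 0%R us i))%R)
    tube v p c s (normal_piece K us eps i).
  move=> x [[k Kk xk] xs].
  have Kx : K x.
    have K0 : K 0%R by apply: rK; rewrite enorm0 ltW.
    have := @body_convex _ _ K k 0%R (1 - d)%R bK; rewrite scaler0 addr0 -xk; apply => //.
      by rewrite subr_ge0 ltW.
    by rewrite gerBl ltW.
  have [t t0 [Ky nKy]] := exit_point bK Kx v0.
  set y := (x + t *: v)%R in Ky nKy.
  (* The normals at the exit point satisfy the bound with [2 * eta]; half of it is spent on passing
     to a net vector at distance [eps]. *)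
  have ang u : unit_outer_normal K y u -> (2 * eta <= dot v u)%R.
    move=> nu; have := @exit_normal K v k y u r rho d t rK Krho r0 d0 d1 t0 Kk _ Ky nu.
    rewrite -xk => /(_ erefl) h; have := le_trans etaE h.
    by rewrite ler_pM2l// mulr_gt0.
  have [u nu] := supporting_normal bK sK Ky nKy.
  have [u' u'us uu'] := net _ nu.1.
  have [|i iM yi] := @normal_piece_cover _ _ K us eps y.
    exists (index u' us); first by rewrite index_mem.
    by split => //; exists u => //; rewrite nth_index.
  have vi : (eta <= dot v (nth 0 us i))%R.
    have [[_ [w nw wu]] _] := yi.
    have := ang _ nw; have := ler_dot v (w - nth 0%R us i); rewrite dotBr.
    have : (enorm v * enorm (w - nth 0%R us i) <= eps * enorm v)%R.
      by rewrite mulrC ler_wpM2r ?enorm_ge0.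
    have := ler_norm (dot v w - dot v (nth 0%R us i)).
    lra.
  rewrite (bigD1 (Ordinal iM))//=; left; split => //; exists y => //; exists (- t)%R.
  by rewrite /y scaleNr addrK.
apply: (le_trans (le_outer_measure _ _ _ sub)).
rewrite -big_filter; apply: (le_trans (outer_measure_seqU _ _ _)).
rewrite -[leRHS]big_filter big_seq [leRHS]big_seq.
apply: lee_sum => i; rewrite mem_filter => /andP[vi _].
have vi0 : (0 < dot v (nth 0%R us i))%R by exact: lt_le_trans vi.
have ui1 : enorm (nth 0%R us i) = 1%R by apply: us1; apply: mem_nth.
apply: (le_trans (lebesgue_tube_hausdorff c ui1 vi0 vp s0 eps0 _)).
  by move=> y y'; exact: normal_piece_flat.
apply: lee_wpmul2r; first exact: (@outer_measure_ge0 _ _ (@hausdorff_outer_measure R (m + 1) m)).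
have ev0 : (0 <= eps * enorm v)%R by rewrite mulr_ge0 ?enorm_ge0.
rewrite lee_fin; apply: ler_wpM2l; first by rewrite !mulr_ge0// ltW.
have a0 : (0 <= eps * enorm v / dot v (nth 0%R us i))%R by rewrite divr_ge0// ltW.
have b0 : (0 <= eps * enorm v / eta)%R by rewrite divr_ge0// ltW.
have ab : (eps * enorm v / dot v (nth 0%R us i) <= eps * enorm v / eta)%R.
  by rewrite ler_wpM2l// lef_pV2 ?posrE.
by apply: lerXn2r; rewrite ?nnegrE ?addr_ge0// lerD2l.
Qed.

End slabs.

Section slab_boundary.
Context {R : realType} (m : nat).
Local Notation mu n := (@lebesgue_outer_measure R n).
Implicit Types (K : set 'rV[R]_(m + 1)) (u v p x y : 'rV[R]_(m + 1)).
Local Open Scope ereal_scope.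

Lemma lebesgue_bounded n (A : set 'rV[R]_n) (r : R) : (forall x : 'rV[R]_n, A x -> enorm x <= r)%R ->
  mu n A \is a fin_num.
Proof.
move=> Ar; rewrite ge0_fin_numE ?outer_measure_ge0//.
pose b : 'rV[R]_n := const_mx `|r|%R.
have Ab : A `<=` box (- b)%R b.
  move=> x Ax i; rewrite !mxE -ler_norml (le_trans (coord_le_enorm _ _))//.
  exact: le_trans (Ar _ Ax) (ler_norm _).
apply: (le_lt_trans (le_outer_measure _ _ _ Ab)); apply: box_finite => i.
by rewrite !mxE; have := normr_ge0 r; lra.
Qed.

(** [slab_half] is used for [v] and for [- v]. A piece contributes to at most one of the two sums,
    according to the sign of [dot v u], so twice the volume is bounded by a single boundary integral
    with factor [2 s], up to errors governed by [t]. *)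
Lemma slab_shrunk K v p c s (r rho d : R) (I : R) : convex_body K -> symmetric_set K ->
  v != 0%R -> dot v p = 1%R -> (0 < s)%R ->
  (forall z, enorm z <= r -> K z)%R -> (forall z, K z -> enorm z <= rho)%R ->
  (0 < r)%R -> (0 < rho)%R -> (0 < d)%R -> (d < 1)%R ->
  \int[hausdorff (m + 1) m]_(x in boundary K) `|dot v (normal K x)|%:E = I%:E ->
  mu (m + 1) [set x | (exists2 k, K k & x = (1 - d) *: k)%R /\ (`|dot x p - c| <= s)%R]
    <= (s * I)%:E.
Proof.
move=> bK sK v0 vp s0 rK Krho r0 rho0 d0 d1 IE.
set Sd := [set x | _].
have nv : (0 < enorm v)%R by rewrite enorm_gt0.
have Sfin : mu (m + 1) Sd \is a fin_num.
  apply: (@lebesgue_bounded _ _ rho) => x [[k Kk ->] _].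
  rewrite enormZ ger0_norm ?subr_ge0 ?(ltW d1)//; have := Krho _ Kk.
  have := mulr_ge0 (ltW d0) (enorm_ge0 k); rewrite mulrBl mul1r; lra.
rewrite -(fineK Sfin) lee_fin; set X := fine _.
have XE : mu (m + 1) Sd = X%:E by rewrite fineK.
pose eta := (d * r * enorm v / (4 * rho))%R.
have eta0 : (0 < eta)%R by rewrite divr_gt0 ?mulr_gt0.
have etaE : (2 * rho * (2 * eta) <= d * r * enorm v)%R.
  by rewrite le_eqVlt; apply/orP; left; apply/eqP; rewrite /eta; field; rewrite gt_eqF.
suff : (2 * X <= 2 * (s * I))%R by rewrite ler_pM2l.
apply: (@ler_pow_limit R _ _ 1 m) => t t0 t1; rewrite expr1.
(* With [eps * enorm v = t * eta], the distortion of the tubes becomes [(1 + t)^m] and the loss in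
   the staircase a factor [1 - t]. *)
pose eps := (t * eta / enorm v)%R.
have eps0 : (0 < eps)%R by apply: divr_gt0 => //; exact: mulr_gt0.
have epsv : (eps * enorm v = t * eta)%R by rewrite /eps divfK// gt_eqF.
have [us0 [us01 net0]] := sphere_net (m + 1) eps0.
pose us := sort (fun u u' => `|dot v u| <= `|dot v u'|)%R us0.
have us1 u : u \in us -> enorm u = 1%R by rewrite mem_sort; exact: us01.
have net u : enorm u = 1%R -> exists2 u', u' \in us & (enorm (u - u') <= eps)%R.
  by move=> /net0[u' u'us uu']; exists u' => //; rewrite mem_sort.
have srt : sorted (fun u u' => `|dot v u| <= `|dot v u'|)%R us.
  by apply: sort_sorted => u u'; exact: le_total.
have epsE : (eps * enorm v <= eta)%R by rewrite epsv ler_piMl// ltW.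
have low := @boundary_integral_ge R (m + 1) m K us eps v bK sK (ltW eps0) net srt.
have up1 := slab_half c bK sK v0 vp s0 rK Krho r0 rho0 d0 d1 eta0 etaE (ltW eps0) epsE us1 net.
(* Changing the signs of [v], [p] and [c] describes the same slab, with the lines followed to their
   other end. *)
have Nv0 : (- v != 0)%R by rewrite oppr_eq0.
have Nvp : (dot (- v) (- p) = 1)%R by rewrite dotNl dotNr opprK.
have epsNE : (eps * enorm (- v) <= eta)%R by rewrite enormN.
have etaNE : (2 * rho * (2 * eta) <= d * r * enorm (- v))%R by rewrite enormN.
have up2 := slab_half (- c)%R bK sK Nv0 Nvp s0 rK Krho r0 rho0 d0 d1 eta0 etaNE (ltW eps0) epsNE us1 net.
have SdN : [set x | (exists2 k, K k & x = (1 - d) *: k)%R /\ (`|dot x (- p) - - c| <= s)%R] = Sd.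
  have E x : (`|dot x (- p) - - c| = `|dot x p - c|)%R by rewrite dotNr -opprD normrN.
  by apply/seteqP; split => x [h1 h2]; split=> //; move: h2; rewrite E.
rewrite {}SdN -/Sd XE in up1 up2.
pose H i := hausdorff_outer m (normal_piece K us eps i).
have H0 i : 0 <= H i by exact: (@outer_measure_ge0 _ _ (@hausdorff_outer_measure R (m + 1) m)).
pose w (i : nat) := nth 0%R us i.
pose k := (2 * s * (1 + t) ^+ m)%R.
have k0 : (0 < k)%R by rewrite !mulr_gt0// exprn_gt0// addr_gt0.
have teta : (eps * enorm v / eta = t)%R by rewrite epsv mulfK// gt_eqF.
have {}up1 : X%:E <= \sum_(i < size us) (if (eta <= dot v (w i))%R then k * dot v (w i) else 0)%R%:E * H i.
  apply: (le_trans up1); rewrite [leLHS]big_mkcond/=; apply: lee_sum => i _.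
  rewrite teta /w; case: ifP => _; last by rewrite mul0e.
  by rewrite /k [X in X%:E * _](_ : _ = 2 * s * (1 + t) ^+ m * dot v (nth 0 us i))%R//; ring.
have {}up2 : X%:E <= \sum_(i < size us) (if (eta <= - dot v (w i))%R then k * (- dot v (w i)) else 0)%R%:E * H i.
  apply: (le_trans up2); rewrite [leLHS]big_mkcond/=; apply: lee_sum => i _.
  rewrite enormN teta /w dotNl; case: ifP => _; last by rewrite mul0e.
  by rewrite /k [X in X%:E * _](_ : _ = 2 * s * (1 + t) ^+ m * (- dot v (nth 0 us i)))%R//; ring.
(* Termwise: where a term is nonzero [|dot v (w i)|] is at least [eta], so subtracting [t * eta]
   from it leaves at least its part [1 - t]. *)
have key : ((1 - t) * (2 * X))%R%:E <= k%:E * \sum_(i < size us)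
    (Num.max (`|dot v (w i)| - eps * enorm v) 0)%R%:E * H i.
  rewrite EFinM (_ : (2 * X)%:E = X%:E + X%:E)%R; last by rewrite -EFinD; congr _%:E; ring.
  apply: (@le_trans _ _ ((1 - t)%:E * \sum_(i < size us)
     ((if (eta <= dot v (w i))%R then k * dot v (w i) else 0)%R%:E * H i +
      (if (eta <= - dot v (w i))%R then k * (- dot v (w i)) else 0)%R%:E * H i))).
    apply: lee_wpmul2l; first by rewrite lee_fin subr_ge0 ltW.
    by rewrite big_split/=; exact: leeD.
  have c1 i : (0 <= if (eta <= dot v (w i)) then k * dot v (w i) else 0)%R.
    by case: ifP => // h; rewrite mulr_ge0 ?(ltW k0)// (le_trans (ltW eta0)).
  have c2 i : (0 <= if (eta <= - dot v (w i)) then k * (- dot v (w i)) else 0)%R.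
    by case: ifP => // h; rewrite mulr_ge0 ?(ltW k0)// (le_trans (ltW eta0)).
  rewrite !ge0_sume_distrr; last 2 first.
  - by move=> i _; rewrite mule_ge0// lee_fin le_max lexx orbT.
  - by move=> i _; rewrite adde_ge0// mule_ge0// lee_fin.
  apply: lee_sum => i _.
  rewrite -ge0_muleDl ?lee_fin// !muleA; apply: lee_wpmul2r => //.
  rewrite -EFinD -!EFinM lee_fin epsv.
  have mm (x y : R) : (x <= Num.max x y)%R by rewrite le_max lexx.
  have m0 (x : R) : (0 <= Num.max x 0)%R by rewrite le_max lexx orbT.
  have [h1|h1] := leP eta (dot v (w i)).
    rewrite ifF; last by apply/negbTE; rewrite -ltNge; lra.
    rewrite addr0 mulrCA; apply: ler_wpM2l; first exact: ltW.
    apply: le_trans (mm _ _); rewrite ger0_norm; last by lra.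
    have : (t * eta <= t * dot v (w i))%R by rewrite ler_pM2l.
    rewrite mulrBl mul1r; lra.
  have [h2|h2] := leP eta (- dot v (w i))%R.
    rewrite add0r mulrCA; apply: ler_wpM2l; first exact: ltW.
    apply: le_trans (mm _ _); rewrite ler0_norm; last by lra.
    have : (t * eta <= t * - dot v (w i))%R by rewrite ler_pM2l.
    rewrite mulrBl mul1r; lra.
  by rewrite addr0 mulr0 mulr_ge0// ltW.
rewrite -lee_fin; apply: (le_trans key).
apply: (@le_trans _ _ (k%:E * I%:E)).
  by apply: lee_wpmul2l; [rewrite lee_fin ltW|rewrite -IE].
by rewrite -EFinM lee_fin /k le_eqVlt; apply/orP; left; apply/eqP; ring.
Qed.

(** Scaling by [1 - t] maps the slab of [K] into a slab of the shrunken body, with [c] and [s]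
    scaled alike; then [t] tends to 0. *)
Theorem slab_boundary K v p c s : convex_body K -> symmetric_set K ->
  v != 0%R -> dot v p = 1%R -> (0 < s)%R ->
  mu (m + 1) [set x | K x /\ (`|dot x p - c| <= s)%R]
  <= s%:E * \int[hausdorff (m + 1) m]_(x in boundary K) `|dot v (normal K x)|%:E.
Proof.
move=> bK sK v0 vp s0; set I := \int[_]_(x in _) _.
have I0 : 0 <= I by apply: integral_ge0 => x _; rewrite lee_fin.
have [->|Ioo] := eqVneq I +oo; first by rewrite gt0_muley ?leey// lte_fin.
have Ifin : I \is a fin_num by rewrite ge0_fin_numE// ltey.
have [r r0 rK] := body_ball bK sK.
have [rho rho0 Krho] := compact_enorm_bounded (let: And3 cK _ _ := bK in cK).
set S := [set x | _].
have Sfin : mu (m + 1) S \is a fin_num.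
  by apply: (@lebesgue_bounded _ _ rho) => x [Kx _]; exact: Krho.
rewrite -(fineK Ifin) -(fineK Sfin) -EFinM lee_fin.
apply: (@ler_pow_limit R _ _ (m + 1) 0) => t t0 t1; rewrite mul1r.
rewrite -lee_fin EFinM fineK// -lebesgue_scale ?subr_gt0//.
have IE : I = (fine I)%:E by rewrite fineK.
have t10 : (0 < 1 - t)%R by rewrite subr_gt0.
apply: (@le_trans _ _ ((1 - t) * s * fine I)%:E); last first.
  rewrite lee_fin; apply: ler_wpM2r; first by rewrite fine_ge0.
  by rewrite ler_piMl ?(ltW s0)// gerBl ltW.
apply: le_trans (slab_shrunk ((1 - t) * c)%R bK sK v0 vp (mulr_gt0 t10 s0) rK Krho r0 rho0 t0 t1 IE).
apply: le_outer_measure => _ [x [Kx xs] <-]; split; first by exists x.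
by rewrite dotZl -mulrBr normrM (gtr0_norm t10) ler_pM2l.
Qed.

End slab_boundary.

(** * Variance and the Poincare constant *)

Section variance.
Context {R : realType}.

(** The steps are the increments of the squares [(j l)^2]. The second bound in the induction is what
    allows the next step to be added when [y] exceeds it. *)
Lemma staircase_le (l y : R) (k : nat) : 0 <= l -> 0 <= y ->
  \sum_(j < k) (2 * j + 1)%N%:R * l ^+ 2 * (j.+1%:R * l < y)%R%:R <= y ^+ 2.
Proof.
move=> l0 y0; suff : \sum_(j < k) (2 * j + 1)%N%:R * l ^+ 2 * (j.+1%:R * l < y)%R%:R <= y ^+ 2 /\
    \sum_(j < k) (2 * j + 1)%N%:R * l ^+ 2 * (j.+1%:R * l < y)%R%:R <= (k%:R * l) ^+ 2 by case.
elim: k => [|k [IH1 IH2]]; first by rewrite big_ord0 !sqr_ge0.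
have kk : (k%:R * l) ^+ 2 + (2 * k + 1)%N%:R * l ^+ 2 = (k.+1%:R * l) ^+ 2.
  by rewrite natrD natrM -natr1; ring.
have kl : 0 <= (2 * k + 1)%N%:R * l ^+ 2 by rewrite mulr_ge0 ?sqr_ge0.
rewrite big_ord_recr/=; case: (ltP (k.+1%:R * l) y) => h.
  rewrite mulr1; have S2 : (k.+1%:R * l) ^+ 2 <= y ^+ 2.
    by rewrite ler_sqr ?nnegrE ?mulr_ge0// ltW.
  by split; lra.
by rewrite mulr0 addr0; split => //; lra.
Qed.

Context (d : measure_display) (T : measurableType d) (mu : {measure set T -> \bar R}).

(* Bathtub principle, with the distribution function of [|g - a|] sampled at six
   equally spaced levels; six is enough for the constant 16. *)
Lemma variance_lower (W : set T) (g : T -> R) (V q b : R) : measurable W ->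
  mu W = V%:E -> 0 < V -> 0 < q -> measurable_fun W g -> (forall x, W x -> `|g x| <= b) ->
  (forall c s : R, 0 < s -> (mu (W `&` [set z | (`|g z - c| <= s)%R]) <= (2 * s * q)%:E)%E) ->
  V ^+ 3 / (16 * q ^+ 2) <= \int[mu]_(x in W) (g x ^+ 2) - V^-1 * (\int[mu]_(x in W) g x) ^+ 2.
Proof.
move=> mW WV V0 q0 mg gb dens.
have Wfin : (mu W < +oo)%E by rewrite WV ltry.
have ig : mu.-integrable W (EFin \o g) by exact: bound_integrable gb.
have ig2 : mu.-integrable W (EFin \o (fun x => g x ^+ 2)).
  apply: (@bound_integrable _ _ _ _ _ _ (b ^+ 2)) => // [|x Wx]; first exact: measurable_funX.
  by rewrite normrX ler_sqr ?nnegrE ?gb// (le_trans _ (gb _ Wx)).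
have ic c : mu.-integrable W (EFin \o (fun=> c : R)).
  exact: (@bound_integrable _ _ _ _ _ _ `|c|).
set G := \int[mu]_(x in W) g x; set G2 := \int[mu]_(x in W) (g x ^+ 2).
pose a := G / V.
have va : \int[mu]_(x in W) ((g x - a) ^+ 2) = G2 - V^-1 * G ^+ 2.
  have -> : \int[mu]_(x in W) ((g x - a) ^+ 2) =
      \int[mu]_(x in W) (g x ^+ 2 - ((2 * a) * g x - a ^+ 2)).
    by apply: eq_Rintegral => x _; ring.
  have ic2 : mu.-integrable W (EFin \o (fun x => 2 * a * g x)).
    have := integrableZl mW (2 * a) ig; apply: eq_integrable => // x _.
  rewrite RintegralB//; last first.
    have := integrableB mW ic2 (ic (a ^+ 2)); apply: eq_integrable => // x _.
  rewrite RintegralB// RintegralZl// Rintegral_cst// WV /= -/G -/G2 /a.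
  by field; rewrite gt_eqF.
rewrite -va.
(* The set where [|g - a|] is at most [j.+1 * l] then has at most [j.+1 / 6] of the mass [V]. The
   six levels contribute [55/6] of [l^2 V], and 9 is needed for 1/16, as [9 / 144 = 1/16]. *)
pose l := V / (12 * q); have l0 : 0 < l by rewrite divr_gt0 ?mulr_gt0.
have c0 (j : nat) : 0 <= (2 * j + 1)%N%:R * l ^+ 2.
  by apply: mulr_ge0 => //; exact: sqr_ge0.
pose B j := W `&` [set z | j.+1%:R * l < `|g z - a|].
have mga : measurable_fun W (fun z => `|g z - a|).
  by apply: measurableT_comp => //; exact: measurable_funB.
have mB j : measurable (B j).
  rewrite /B (_ : [set z | _] = (fun z => `|g z - a|) @^-1` `]j.+1%:R * l, +oo[%classic).
    exact: mga.
  by apply/seteqP; split => z /=; rewrite in_itv/= andbT.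
have muB j : ((V * (1 - j.+1%:R / 6))%:E <= mu (B j))%E.
  have jl : 0 < j.+1%:R * l by rewrite mulr_gt0.
  have dj := dens a (j.+1%:R * l) jl.
  have dE : 2 * (j.+1%:R * l) * q = V * (j.+1%:R / 6) by rewrite /l; field; rewrite gt_eqF.
  have : (mu W <= mu (B j) + mu (W `&` [set z | (`|g z - a| <= j.+1%:R * l)%R]))%E.
    rewrite -measureU//; last 2 first.
    - have -> : W `&` [set z | `|g z - a| <= j.+1%:R * l] = W `\` B j.
        apply/seteqP; split => z [Wz h]; split => //=.
          by move=> [_ /=]; rewrite ltNge h.
        by rewrite leNgt; apply/negP => h'; apply: h.
      exact: measurableD.
    - rewrite -subset0 => z [[_ /= h1] [_ /=]]; by rewrite leNgt h1.
    apply: le_measure; rewrite ?inE//.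
      apply: measurableU => //.
      have -> : W `&` [set z | `|g z - a| <= j.+1%:R * l] = W `\` B j.
        apply/seteqP; split => z [Wz h]; split => //=.
          by move=> [_ /=]; rewrite ltNge h.
        by rewrite leNgt; apply/negP => h'; apply: h.
      exact: measurableD.
    by move=> z Wz; have [h|h] := leP `|g z - a| (j.+1%:R * l); [right|left].
  have Bfin : mu (B j) \is a fin_num.
    rewrite ge0_fin_numE//; apply: le_lt_trans Wfin; apply: le_measure; rewrite ?inE//.
    exact: subIsetl.
  rewrite -(fineK Bfin) WV => /le_trans/(_ (leeD2l _ dj)).
  by rewrite -EFinD !lee_fin dE; lra.
have sumE : ((V ^+ 3 / (16 * q ^+ 2))%:E <=
    \sum_(j < 6) ((2 * j + 1)%N%:R * l ^+ 2)%:E * mu (B j))%E.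
  apply: (@le_trans _ _ (\sum_(j < 6) ((2 * j + 1)%N%:R * l ^+ 2 * (V * (1 - j.+1%:R / 6)))%:E)%E); last first.
    apply: lee_sum => j _; rewrite EFinM; apply: lee_wpmul2l => //.
    by rewrite lee_fin.
  rewrite sumEFin lee_fin !big_ord_recr big_ord0/= /l expr_div_n exprMn.
  have -> : V ^+ 3 / (16 * q ^+ 2) = V ^+ 2 / (144 * q ^+ 2) * V * 9.
    by field; rewrite gt_eqF.
  have : 0 <= V ^+ 2 / (144 * q ^+ 2) * V.
    by apply: mulr_ge0; [apply: divr_ge0; [|apply: mulr_ge0 => //]; exact: sqr_ge0|exact: ltW].
  have -> : (12 : R) ^+ 2 = 144 by ring.
  move: (V ^+ 2 / _) => z; rewrite !mulrA; lra.
have iga : mu.-integrable W (EFin \o (fun x => (g x - a) ^+ 2)).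
  have := integrableB mW ig2 (integrableB mW (integrableZl mW (2 * a) ig) (ic (a ^+ 2))).
  apply: eq_integrable => // x _ /=.
  by rewrite -?EFinM -?EFinB -?EFinN -?EFinD; congr (_%:E); ring.
rewrite /Rintegral -lee_fin fineK; last exact: integrable_fin_num.
apply: (le_trans sumE).
apply: (@lower_integral_staircase _ _ _ _ W 6 (fun j => (2 * j + 1)%N%:R * l ^+ 2) B) => //.
  by move=> j x [].
move=> x Wx; rewrite -[leRHS]real_normK ?num_real//.
apply: le_trans (staircase_le 6 (ltW l0) (normr_ge0 _)).
apply: ler_sum => j _; rewrite indicE.
rewrite (_ : x \in B j = (j.+1%:R * l < `|g x - a|))//.
by apply/idP/idP => [/set_mem[]//|h]; apply/mem_set; split.
Qed.

End variance.

Section linear_forms.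
Context {R : realType} (n : nat).
Implicit Types (x z th : 'rV[R]_n).

Lemma dot_measurable th : measurable_fun
  [set: caratheodory_type (@lebesgue_outer_measure R n)] (fun z => dot z th).
Proof.
apply: (measurability _ (RGenOInfty.measurableE R)) => //= _ [_ [c ->] <-].
rewrite setTI.
have -> : (fun z => dot z th) @^-1` `]c, +oo[%classic = ~` [set z | dot th z <= c].
  apply/seteqP; split => z; rewrite /= in_itv/= andbT dotC ltNge.
    by move=> /negP.
  by move=> /negP.
by apply: measurableC; apply: lebesgue_closed_measurable; exact: closed_dot_le.
Qed.

Definition dot_form th : 'rV[R]_n -> R^o := fun z => dot z th.

Lemma dot_form_linear th : linear (dot_form th).
Proof. by move=> a x y; rewrite /dot_form dotDl dotZl. Qed.

HB.instance Definition _ th := GRing.isLinear.Build R 'rV[R]_n R^o _ (dot_form th) (dot_form_linear th).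

Lemma dot_form_continuous th : continuous (dot_form th).
Proof.
move=> x A /nbhs_ballP[e /= e0 eA]; apply/nbhs_enorm.
have w0 : 0 < enorm th + 1 by rewrite ltr_wpDl// enorm_ge0.
exists (e / (enorm th + 1)); first by rewrite divr_gt0.
move=> y yx; apply: eA; rewrite /ball/= /dot_form -dotBl.
apply: (le_lt_trans (ler_dot _ _)); rewrite enormB.
apply: (@le_lt_trans _ _ (enorm (y - x) * (enorm th + 1))).
  by apply: ler_wpM2l; [exact: enorm_ge0|rewrite lerDl].
by rewrite -ltr_pdivlMr.
Qed.

Lemma grad_dot th x : grad (fun z => dot z th) x = th.
Proof.
apply/rowP => i; rewrite mxE.
have df : differentiable (dot_form th) x.
  by apply: linear_differentiable; exact: dot_form_continuous.
rewrite (_ : (fun z => dot z th) = dot_form th)// deriveE//.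
rewrite diff_lin; last exact: dot_form_continuous.
rewrite /= /dot_form /dot (bigD1 i)//= big1 ?addr0 => [|j ji].
  by rewrite mxE !eqxx mul1r.
by rewrite mxE (negbTE ji) mul0r.
Qed.

Lemma dot_C1 (K : set 'rV[R]_n) th : C1_on K (fun z => dot z th).
Proof.
move=> x _; split.
  have df : differentiable (dot_form th) x.
    by apply: linear_differentiable; exact: dot_form_continuous.
  exact: df.
rewrite (_ : grad _ = fun=> th); first exact: cst_continuous.
by apply/funext => z; exact: grad_dot.
Qed.

End linear_forms.

(** * In-radius and Poincare constant of volume preserving images *)

Section volume_preserving_maps.
Context {R : realType} (m : nat).
Local Notation mu := (@lebesgue_outer_measure R (m + 1)).
Variables (K : set 'rV[R]_(m + 1)) (bK : convex_body K) (sK : symmetric_set K).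
Variables (T : {linear 'rV[R]_(m + 1) -> 'rV[R]_(m + 1)}) (vT : volume_preserving T).

Lemma body_volume_gt0 : (0 < mu K)%E.
Proof. by have [_ _ [x Kx]] := bK; apply: (box_interior_gt0 Kx). Qed.

Lemma body_volume_fin : mu K \is a fin_num.
Proof.
have [cK _ _] := bK; have [r r0 Kr] := compact_enorm_bounded cK.
exact: lebesgue_bounded Kr.
Qed.

Lemma volume_image (A : set 'rV[R]_(m + 1)) : closed A -> mu (T @` A) = mu A.
Proof. by move=> cA; apply: vT; exact: lebesgue_closed_measurable. Qed.

Lemma image_body_compact : compact (T @` K).
Proof. by have [cK _ _] := bK; exact: linear_image_compact. Qed.

Lemma image_body_closed : closed (T @` K).
Proof. apply: compact_closed image_body_compact; exact: norm_hausdorff. Qed.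

(* A singular [T] would flatten [K] into a hyperplane, of measure zero. *)
Lemma volume_preserving_inj x : T x = 0 -> x = 0.
Proof.
move=> Tx; apply/eqP; apply/negPn/negP => x0.
have /det0P : exists2 v : 'rV[R]_(m + 1), v != 0 & v *m lin1_mx T = 0.
  by exists x => //; rewrite mul_rV_lin1.
rewrite -det_tr => /det0P[th th0 thT].
have flat z : dot (T z) th = 0.
  have : (z *m lin1_mx T) *m th^T = 0.
    by rewrite -mulmxA -[X in z *m X]trmxK trmx_mul trmxK thT trmx0 mulmx0.
  rewrite mul_rV_lin1 => /matrixP/(_ 0 0); rewrite !mxE => <-.
  by apply: eq_bigr => j _; rewrite mxE.
have [r r0 Tr] := compact_enorm_bounded image_body_compact.
have [Q Q0 slab] := slab_finite th0 r0.
pose p := (dot th th)^-1 *: th.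
have tt : dot th th != 0 by rewrite dotxx_eq0.
have thp : dot th p = 1 by rewrite dotZr mulVf.
have V0 := body_volume_gt0; have Vf := body_volume_fin.
have Vle s : 0 < s -> fine (mu K) <= 2 * s * Q.
  move=> s0; rewrite -lee_fin fineK// -(volume_image (body_closed bK)).
  apply: le_trans (slab p 0 s thp s0); apply: le_outer_measure => _ [z Kz <-].
  split; first by apply: Tr; exists z.
  by rewrite subr0 dotZr flat mulr0 normr0 ltW.
have V1 : 0 < fine (mu K) by rewrite -lte_fin fineK.
have := Vle (fine (mu K) / (4 * Q)); rewrite divr_gt0 ?mulr_gt0// => /(_ isT).
have -> : 2 * (fine (mu K) / (4 * Q)) * Q = fine (mu K) / 2 by field; rewrite gt_eqF.
lra.
Qed.

(** By symmetry a ball in [T K] may be centred at 0. If its radius exceeded [|T v|], it would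
    contain some [t *: T v] with [1 < t]; injectivity puts [t *: v] in [K], where the form
    [dot _ u0] would have the value [t * h > h]. *)
Lemma inradius_image (u0 v : 'rV[R]_(m + 1)) (h : R) : 0 < h -> dot v u0 = h ->
  (forall k, K k -> dot k u0 <= h) -> (inradius (T @` K) <= (enorm (T v))%:E)%E.
Proof.
move=> h0 vh Kh; apply: ge_ereal_sup => _ [rho [rho0 [c cT]] <-]; rewrite lee_fin leNgt.
apply/negP => Tvr.
have Tv0 : T v != 0.
  by apply/eqP => /volume_preserving_inj v0; move: h0; rewrite -vh v0 dot0l ltxx.
have nTv : 0 < enorm (T v) by rewrite enorm_gt0.
have ball0 y : enorm y <= rho -> (T @` K) y.
  move=> yr.
  have [k1 Kk1 Tk1] : (T @` K) (c + y) by apply: cT; rewrite /eball /= addrAC subrr add0r.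
  have [k2 Kk2 Tk2] : (T @` K) (c - y) by apply: cT; rewrite /eball /= addrAC subrr add0r enormN.
  exists (2^-1 *: k1 + (1 - 2^-1) *: (- k2)).
    by apply: body_convex; rewrite ?invr_ge0 ?invf_le1 ?ler1n//; exact: body_oppr.
  have -> : 1 - 2^-1 = 2^-1 :> R by field.
  rewrite -scalerDr linearZ/= linearB/= Tk1 Tk2 opprB [_ + (y - c)]addrC addrA subrK.
  by rewrite -mulr2n -(scaler_nat 2 y) scalerA mulVf ?scale1r.
pose t := rho / enorm (T v); have t1 : 1 < t by rewrite ltr_pdivlMr// mul1r.
have [k Kk Tk] : (T @` K) (t *: T v).
  by apply: ball0; rewrite enormZ ger0_norm ?divfK ?gt_eqF// (le_trans ler01)// ltW.
have kE : k = t *: v.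
  by apply/eqP; rewrite -subr_eq0; apply/eqP/volume_preserving_inj; rewrite linearB linearZ/= Tk subrr.
by have := Kh _ Kk; rewrite kE dotZl vh leNgt ltr_pMl// t1.
Qed.

(** The test function is the linear form along the unit vector [th] of [T v], whose gradient has
    norm 1. Its slabs in [T K] are images of slabs of [K] narrower by the factor [|T v|], so its
    density is at most [q = Q / |T v|], and [variance_lower] gives [C >= V / (4 q)]. *)
Lemma poincare_image (v : 'rV[R]_(m + 1)) (Q C : R) : v != 0 -> 0 < Q -> 0 <= C ->
  (forall p (c s : R), dot v p = 1 -> 0 < s ->
     (mu [set x | K x /\ (`|dot x p - c| <= s)%R] <= (2 * s * Q)%:E)%E) ->
  poincare_inequality (T @` K) C -> enorm (T v) * fine (mu K) <= 4 * Q * C.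
Proof.
move=> v0 Q0 C0 slab PI.
have Tv0 : T v != 0 by apply/eqP => /volume_preserving_inj/eqP; rewrite (negbTE v0).
have nT : 0 < enorm (T v) by rewrite enorm_gt0.
pose th := (enorm (T v))^-1 *: T v.
have th1 : enorm th = 1 by rewrite enormZ ger0_norm ?invr_ge0 ?enorm_ge0// mulVf ?gt_eqF.
have Vf := body_volume_fin; have V1 : 0 < fine (mu K) by rewrite -lte_fin fineK// body_volume_gt0.
set V := fine (mu K) in V1 *.
pose W : set (caratheodory_type (@lebesgue_outer_measure R (m + 1))) := T @` K.
have mW : measurable W by apply: lebesgue_closed_measurable; exact: image_body_closed.
have WV : lebesgue (m + 1) W = V%:E.
  by rewrite fineK//; exact: volume_image (body_closed bK).
pose g z := dot z th.
have mg : measurable_fun W g by apply: measurable_funTS; exact: dot_measurable.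
have [r r0 Wr] := compact_enorm_bounded image_body_compact.
have gb x : W x -> `|g x| <= r.
  by move=> Wx; apply: (le_trans (ler_dot _ _)); rewrite th1 mulr1; exact: Wr.
pose q := Q / enorm (T v); have q0 : 0 < q by rewrite divr_gt0.
(* The transpose of [T] applied to [th], divided by [|T v|] so that [dot v p = 1]. *)
pose p : 'rV[R]_(m + 1) := (enorm (T v))^-1 *: (th *m (lin1_mx T)^T).
have dp x : dot x p = dot (T x) th / enorm (T v).
  rewrite dotZr mulrC; congr (_ / _).
  have E (a b : 'rV[R]_(m + 1)) : dot a b = (a *m b^T) 0 0.
    by rewrite mxE; apply: eq_bigr => j _; rewrite mxE.
  by rewrite !E trmx_mul trmxK mulmxA mul_rV_lin1.
have vp : dot v p = 1.
  rewrite dp dotZr -enorm_sqr expr2 mulrA mulVf ?gt_eqF// mul1r mulfV// gt_eqF//.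
have dens (c s : R) : 0 < s -> (lebesgue (m + 1) (W `&` [set z | (`|g z - c| <= s)%R]) <= (2 * s * q)%:E)%E.
  move=> s0; pose S := [set x | K x /\ (`|dot x p - c / enorm (T v)| <= s / enorm (T v))%R].
  have sT : 0 < s / enorm (T v) by rewrite divr_gt0.
  have := slab p (c / enorm (T v)) (s / enorm (T v)) vp sT; rewrite -/S.
  have -> : 2 * (s / enorm (T v)) * Q = 2 * s * q by rewrite /q; ring.
  have -> : W `&` [set z | (`|g z - c| <= s)%R] = T @` S.
    have E x : (`|dot x p - c / enorm (T v)| <= s / enorm (T v)) = (`|g (T x) - c| <= s).
      by rewrite dp -mulrBl normrM normfV (gtr0_norm nT) ler_pM2r ?invr_gt0.
    apply/seteqP; split => [_ [[x Kx <-]] /= h|_ [x [Kx]] + <-].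
      by exists x => //; split => //; rewrite E.
    by rewrite E => h; split => //; exists x.
  have cS : closed S.
    have -> : S = K `&` ([set x | dot p x <= c / enorm (T v) + s / enorm (T v)] `&`
        [set x | dot (- p) x <= s / enorm (T v) - c / enorm (T v)]).
      apply/seteqP; split => x /=.
        by rewrite /S /= ler_norml dotNl (dotC p) => -[Kx /andP[h1 h2]]; split => //; split; lra.
      by rewrite /S /= ler_norml dotNl (dotC p) => -[Kx [h1 h2]]; split => //; apply/andP; split; lra.
    by apply: closedI; [exact: body_closed|apply: closedI; exact: closed_dot_le].
  by rewrite -(volume_image cS).
have var := variance_lower mW WV V1 q0 mg gb dens.
have gradE x : enorm (grad g x) ^+ 2 = 1 by rewrite /g grad_dot th1 expr1n.
have Wfin : (lebesgue (m + 1) W < +oo)%E by rewrite WV ltry.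
have i1 := bound_integrable mW Wfin mg gb.
have i2 : (lebesgue (m + 1)).-integrable W (EFin \o (fun x => g x ^+ 2)).
  apply: (bound_integrable (M := r ^+ 2) mW Wfin (measurable_funX 2 mg)) => x Wx.
  by rewrite normrX ler_sqr ?nnegrE ?gb// ltW.
have i3 : (lebesgue (m + 1)).-integrable W (EFin \o (fun x => enorm (grad g x) ^+ 2)).
  rewrite (_ : (fun x => enorm (grad g x) ^+ 2) = fun=> 1); last by apply/funext.
  by apply: (bound_integrable (M := 1) mW Wfin (measurable_cst _)) => x _; rewrite normr1.
have := PI g (@dot_C1 R (m + 1) (T @` K) th) i1 i2 i3; rewrite -/W WV /= => /(le_trans var).
rewrite (_ : \int[lebesgue (m + 1)]_(x in W) (enorm (grad g x) ^+ 2) = V); last first.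
  under eq_Rintegral do rewrite gradE.
  by rewrite Rintegral_cst// WV mul1r.
have -> : V ^+ 3 / (16 * q ^+ 2) = (enorm (T v) * V / (4 * Q)) ^+ 2 * V.
  by rewrite /q; field; rewrite !gt_eqF.
rewrite ler_pM2r// ler_sqr ?nnegrE//; last first.
  by apply: divr_ge0; [apply: mulr_ge0; exact: ltW|apply: mulr_ge0 => //; exact: ltW].
by rewrite ler_pdivrMr ?mulr_gt0// [C * _]mulrC.
Qed.

End volume_preserving_maps.

(** * The inequality *)

Section reduction.
Context {R : realType} (m : nat).
Local Notation mu := (@lebesgue_outer_measure R (m + 1)).
Variables (K : set 'rV[R]_(m + 1)) (bK : convex_body K) (sK : symmetric_set K).
Variables (N : 'rV[R]_(m + 1) -> R) (sN : seminorm N).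
Local Open Scope ereal_scope.

Lemma seminormN x : N (- x)%R = N x.
Proof. by rewrite -scaleN1r sN.2 normrN1 mul1r. Qed.

Lemma seminorm_ge0 x : (0 <= N x)%R.
Proof.
have N0 : N 0%R = 0%R by rewrite -(scale0r (0%R : 'rV[R]_(m + 1))) sN.2 normr0 mul0r.
by have := sN.1 x (- x)%R; rewrite subrr N0 seminormN; lra.
Qed.

Lemma seminorm_sublinear : sublinear N.
Proof. by split=> [|a x a0]; [exact: sN.1|rewrite sN.2 gtr0_norm]. Qed.

Let kappa := ereal_inf [set 2%:E * poincare_constant (T @` K) / inradius (T @` K)
   | T in [set T : {linear 'rV[R]_(m + 1) -> 'rV[R]_(m + 1)} | volume_preserving T]].
Let M := \int[hausdorff (m + 1) m]_(x in boundary K) (N (normal K x))%:E.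

Lemma body_contains0 : K 0%R.
Proof. by have [r r0 rK] := body_ball bK sK; apply: rK; rewrite enorm0 ltW. Qed.

Lemma inradius_ge0 (T : {linear 'rV[R]_(m + 1) -> 'rV[R]_(m + 1)}) : 0 <= inradius (T @` K).
Proof.
apply: ereal_sup_ubound; exists 0%R => //; split => //; exists 0%R => x.
rewrite /eball /= subr0 => x0; exists 0%R; first exact: body_contains0.
by apply/esym/eqP; rewrite linear0 -enorm_eq0 eq_le x0 enorm_ge0.
Qed.

Lemma poincare_constant_ge0 (W : set 'rV[R]_(m + 1)) : 0 <= poincare_constant W.
Proof. by apply: le_ereal_inf_tmp => _ [C [C0 _] <-]; rewrite lee_fin. Qed.

Lemma kappa_ge0 : 0 <= kappa.
Proof.
apply: le_ereal_inf_tmp => _ [T vT <-].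
by rewrite mule_ge0 ?inve_ge0 ?inradius_ge0// mule_ge0 ?poincare_constant_ge0.
Qed.

Lemma normal_support x : boundary K x ->
  (0 < dot x (normal K x))%R /\ forall k, K k -> (dot k (normal K x) <= dot x (normal K x))%R.
Proof.
move=> bx; have [u1 nu] := boundary_normal bK sK bx.
have sup k : K k -> (dot k (normal K x) <= dot x (normal K x))%R.
  by move=> /nu; rewrite dotBl subr_le0.
split => //; have [r r0 rK] := body_ball bK sK.
apply: (lt_le_trans r0); have := sup (r *: normal K x)%R.
rewrite dotZl -enorm_sqr u1 expr1n mulr1; apply.
by apply: rK; rewrite enormZ u1 mulr1 ger0_norm// ltW.
Qed.

(** The constant [c] depends on [x] through [v]; its only role is to be eliminated through [kappa].
    The bound [2 Q <= I] gives the first inequality, the slab bound with the same [Q] gives the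
    second. *)
Lemma support_ratio x : boundary K x -> (0 < N (normal K x))%R ->
  exists2 c : R, (0 < c)%R &
    (N (normal K x) / dot x (normal K x) * fine (mu K))%:E <= c%:E * M /\ c%:E <= kappa.
Proof.
move=> bx Nu0; have [h0 sup] := normal_support bx.
set u0 := normal K x in Nu0 h0 sup *; set h := dot x u0 in h0 sup *.
have Vf := body_volume_fin bK.
have V0 : (0 < fine (mu K))%R by rewrite -lte_fin fineK// body_volume_gt0.
have [w wN wu] := hahn_banach u0 seminorm_sublinear.
pose a := (h / N u0)%R; have a0 : (0 < a)%R by rewrite divr_gt0.
pose v := (a *: w)%R.
have vu : dot v u0 = h by rewrite dotZl wu /a divfK// gt_eqF.
have v0 : v != 0%R by apply/eqP => v0; move: h0; rewrite -vu v0 dot0l ltxx.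
have vN u : (a^-1 * `|dot v u| <= N u)%R.
  rewrite dotZl normrM (gtr0_norm a0) mulrA mulVf ?gt_eqF// mul1r ler_norml wN andbT lerNl.
  by rewrite -dotNr -(seminormN u) wN.
pose I := \int[hausdorff (m + 1) m]_(x in boundary K) `|dot v (normal K x)|%:E.
have I0 : 0 <= I by apply: integral_ge0 => y _; rewrite lee_fin.
have IM : a^-1%:E * I <= M.
  rewrite -lower_integralZ ?invr_gt0//; apply: lower_integral_le => y _.
    by rewrite -EFinM lee_fin mulr_ge0// invr_ge0 ltW.
  by rewrite -EFinM lee_fin.
have [rho rho0 Krho] := compact_enorm_bounded (let: And3 cK _ _ := bK in cK).
have [Q0 Q00 slabQ0] := slab_finite v0 rho0.
have slabQ p c s : dot v p = 1%R -> (0 < s)%R ->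
    mu [set x | K x /\ (`|dot x p - c| <= s)%R] <= (2 * s * Q0)%:E.
  move=> vp s0; apply: le_trans (slabQ0 p c s vp s0); apply: le_outer_measure => y [Ky ys].
  by split => //; exact: Krho.
have slabI p c s : dot v p = 1%R -> (0 < s)%R ->
    mu [set x | K x /\ (`|dot x p - c| <= s)%R] <= s%:E * I.
  by move=> vp s0; exact: slab_boundary.
(* [Q] has to be a positive real for [c] to make sense. If [I] is infinite the crude [Q0] provides
   it; otherwise [I / 2] is available from [slab_boundary]. *)
have [Q [Qpos QI slab]] : exists Q : R, [/\ (0 < Q)%R, (2 * Q)%:E <= I &
    forall p (c s : R), dot v p = 1%R -> (0 < s)%R ->
    mu [set x | K x /\ (`|dot x p - c| <= s)%R] <= (2 * s * Q)%:E].
  have [Iy|Ioo] := eqVneq I +oo; first by exists Q0; split => //; rewrite Iy leey.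
  have Ifin : I \is a fin_num by rewrite ge0_fin_numE// ltey.
  pose p := ((dot v v)^-1 *: v)%R.
  have vp : dot v p = 1%R by rewrite dotZr mulVf// dotxx_eq0.
  (* A slab wide enough to contain all of [K] has positive volume, so [I] cannot vanish. *)
  have Ipos : (0 < fine I)%R.
    rewrite lt_neqAle fine_ge0// andbT; apply/eqP => IE.
    pose s := (rho * enorm p + 1)%R.
    have s0 : (0 < s)%R by rewrite ltr_wpDl// mulr_ge0 ?enorm_ge0// ltW.
    have : mu K <= s%:E * I.
      apply: le_trans (slabI p 0%R s vp s0); apply: le_outer_measure => y Ky; split => //.
      rewrite subr0 (le_trans (ler_dot _ _))// (@le_trans _ _ (rho * enorm p)%R)//.
        by rewrite ler_wpM2r ?enorm_ge0// Krho.
      by rewrite lerDl.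
    by rewrite -(fineK Ifin) -IE mule0 -(fineK Vf) lee_fin leNgt V0.
  exists (Num.min Q0 (fine I / 2))%R; split.
  - by rewrite lt_min Q00 divr_gt0.
  - rewrite -[leRHS]fineK// lee_fin -ler_pdivlMl// mulrC ge_min.
    by rewrite [X in _ || X]lexx orbT.
  - move=> p' c s vp' s0; have [Q1|Q1] := leP Q0 (fine I / 2)%R; first exact: slabQ.
    apply: (le_trans (slabI _ _ _ vp' s0)); rewrite -(fineK Ifin) -EFinM lee_fin /=.
    by rewrite le_eqVlt; apply/orP; left; apply/eqP; field.
pose c := (fine (mu K) / (2 * Q))%R.
have c0 : (0 < c)%R by rewrite divr_gt0// mulr_gt0.
exists c => //; split.
  have -> : (N u0 / h * fine (mu K) = c * (a^-1 * (2 * Q)))%R.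
    by rewrite /c /a; field; rewrite !gt_eqF.
  rewrite EFinM; apply: lee_wpmul2l; first by rewrite lee_fin ltW.
  apply: le_trans IM; rewrite EFinM; apply: lee_wpmul2l => //.
  by rewrite lee_fin invr_ge0 ltW.
apply: le_ereal_inf_tmp => _ [T vT <-].
have ir := inradius_image bK sK vT h0 vu sup.
have Tv0 : (0 < enorm (T v))%R.
  rewrite enorm_gt0; apply/eqP => /(volume_preserving_inj bK vT)/eqP.
  by rewrite (negbTE v0).
have P0 : (enorm (T v) * c / 2)%:E <= poincare_constant (T @` K).
  apply: le_ereal_inf_tmp => _ [C [C0 PC] <-]; rewrite lee_fin.
  have := poincare_image bK vT v0 Qpos C0 slab PC.
  rewrite /c => h1; rewrite ler_pdivrMr// mulrA ler_pdivrMr ?mulr_gt0//.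
  by apply: (le_trans h1); rewrite le_eqVlt; apply/orP; left; apply/eqP; ring.
apply: (@le_trans _ _ (2%:E * (enorm (T v) * c / 2)%:E * (enorm (T v))%:E^-1)).
  rewrite inver gt_eqF// -!EFinM lee_fin le_eqVlt; apply/orP; left; apply/eqP.
  by field; rewrite gt_eqF.
apply: lee_pmul.
- by rewrite -EFinM lee_fin; do 2 (apply: mulr_ge0 => //); apply: mulr_ge0; exact: ltW.
- by rewrite inve_ge0 lee_fin ltW.
- exact: lee_wpmul2l.
- by rewrite lee_pV2 ?inE ?inradius_ge0// lee_fin ltW.
Qed.

Theorem reverse_minkowski :
  \int[hausdorff (m + 1) m]_(x in boundary K) (N (normal K x) ^+ 2 / dot x (normal K x))%:E
  <= kappa * (M ^+ 2 / mu K).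
Proof.
have Vf := body_volume_fin bK.
have V0 : (0 < fine (mu K))%R by rewrite -lte_fin fineK// body_volume_gt0.
have M0 : 0 <= M by apply: integral_ge0 => y _; rewrite lee_fin seminorm_ge0.
have VE : mu K = (fine (mu K))%:E by rewrite fineK.
have RHS0 : 0 <= kappa * (M ^+ 2 / mu K).
  rewrite mule_ge0 ?kappa_ge0// mule_ge0 ?expe_ge0// inve_ge0 VE lee_fin ltW//.
(* If [N] vanishes on all the chosen normals, the left side is 0. Otherwise one point with [0 < N]
   makes both [M] and [kappa] positive, which rules out the product of 0 and infinity on the
   right. *)
have [[x bx Nx]|none] := pselect (exists2 x, boundary K x & (0 < N (normal K x))%R); last first.
  rewrite integral0_eq// => x bx; have -> : N (normal K x) = 0%R; last by rewrite expr0n mul0r.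
  apply/eqP; rewrite eq_le seminorm_ge0 andbT leNgt; apply/negP => Nx.
  by apply: none; exists x.
have [c c0 [cM ck]] := support_ratio bx Nx.
have [h0 _] := normal_support bx.
have Mpos : 0 < M.
  rewrite lt_neqAle M0 andbT; apply/eqP => ME; move: cM; rewrite -ME mule0 lee_fin leNgt.
  by rewrite !mulr_gt0// invr_gt0.
have kpos : 0 < kappa by apply: lt_le_trans ck; rewrite lte_fin.
have VVpos : 0 < (mu K)^-1 by rewrite VE inver gt_eqF// lte_fin invr_gt0.
(* By positivity of the other factors, an infinite [kappa] or [M] makes the right side infinite; the
   computation below is then in the reals. *)
have [ky|koo] := eqVneq kappa +oo.
  by rewrite ky gt0_mulye ?leey// mule_gt0// expe_gt0.
have [My|Moo] := eqVneq M +oo.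
  have y2 : +oo ^+ 2 = +oo :> \bar R := mulyy.
  by rewrite My y2 gt0_mulye// gt0_muley// leey.
have kf : kappa \is a fin_num by rewrite ge0_fin_numE ?kappa_ge0// ltey.
have Mf : M \is a fin_num by rewrite ge0_fin_numE// ltey.
pose k := fine kappa; pose Mr := fine M; pose V := fine (mu K).
have kE : kappa = k%:E by rewrite fineK.
have ME : M = Mr%:E by rewrite fineK.
have k0 : (0 < k)%R by rewrite -lte_fin -kE.
have Mr0 : (0 < Mr)%R by rewrite -lte_fin -ME.
have q0 : (0 < k * Mr / V)%R by rewrite divr_gt0// mulr_gt0.
apply: (@le_trans _ _ (\int[hausdorff (m + 1) m]_(x in boundary K) ((k * Mr / V)%:E * (N (normal K x))%:E))).
  apply: lower_integral_le => y by_; have [hy _] := normal_support by_.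
    by rewrite lee_fin divr_ge0 ?sqr_ge0// ltW.
  rewrite -EFinM lee_fin expr2 -mulrA mulrC; apply: ler_wpM2r; first exact: seminorm_ge0.
  have := seminorm_ge0 (normal K y); rewrite le_eqVlt => /predU1P[<-|Ny].
    by rewrite mul0r ltW.
  have [c' c'0 [c'M c'k]] := support_ratio by_ Ny.
  rewrite ler_pdivlMr// -lee_fin; apply: (le_trans c'M); rewrite ME -EFinM lee_fin.
  by apply: ler_wpM2r; [exact: ltW|rewrite -lee_fin -kE].
rewrite lower_integralZ// -/M; last by move=> y _; rewrite lee_fin seminorm_ge0.
rewrite kE ME VE inver gt_eqF// -EFin_expe -!EFinM lee_fin le_eqVlt; apply/orP; left; apply/eqP.
by rewrite -/V; field; rewrite gt_eqF.
Qed.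

End reduction.

Local Open Scope ereal_scope.

Theorem theorem1p4 (R : realType) (n : nat) (n_gt0 : (0 < n)%N)
    (K : set 'rV[R]_n) (K_body : convex_body K) (K_sym : symmetric_set K)
    (N : 'rV[R]_n -> R) (N_seminorm : seminorm N) :
  \int[hausdorff n n.-1]_(x in boundary K)
     (N (normal K x) ^+ 2 / dot x (normal K x))%:E
  <= ereal_inf [set 2%:E * poincare_constant (T @` K) / inradius (T @` K)
               | T in [set T : {linear 'rV[R]_n -> 'rV[R]_n}
                      | volume_preserving T]]
     * ((\int[hausdorff n n.-1]_(x in boundary K) (N (normal K x))%:E) ^+ 2
        / lebesgue n K).
Proof.
(* The dimension is brought to the form [m + 1], in which [lsubmx] and [rsubmx] split off the last
   coordinate, with [n.-1] generalised to [m] beforehand. *)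
have : n = (n.-1 + 1)%N by rewrite addn1 prednK.
move: K K_body K_sym N N_seminorm; move: n.-1 => m + + + + + nE.
rewrite {n n_gt0}nE => K K_body K_sym N N_seminorm.
exact: reverse_minkowski.
Qed.
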